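(* Let $n>5$. Every saturated blocker $B$ for triangulations of a convex $n$-gon having exactly $n-1$ edges is, up to a cyclic rotation of the vertex labels $0,\dots,n-1$, of one of the following three types. Type 1: $B=B_{\mathrm{Sea}}\cup B_1\cup B_2$, where for some $4\le m\le n-3$ and some $2<\ell<m$: $B_{\mathrm{Sea}}=\{(\ell-2,\ell),(\ell-2,\ell+1),(\ell-1,\ell+2),(\ell,\ell+2)\}$; $B_1=\{(0,2),(1,3),\dots,(\ell-3,\ell-1),(\ell+1,\ell+3),\dots,(m,m+2)\}$; and $B_2=\{(m+3,i_1),(m+4,i_2),\dots,(n-1,i_{n-3-m})\}$ with all $i_j\in\{1,\dots,\ell-1,\ell+1,\dots,m+1\}$, such that whenever $|i_{j_1}-i_{j_2}|\ge 2$, the diagonals $(m+2+j_1,i_{j_1})$ and $(m+2+j_2,i_{j_2})$ do not cross. Type 2: $B=B_{\mathrm{Buf}}\cup B_1\cup B_2$, where for some $5\le m\le n-3$ and some $2<\ell<m-1$: $B_{\mathrm{Buf}}=\{(\ell-2,\ell),(\ell-2,\ell+1),(\ell-1,\ell+2),(\ell,\ell+3),(\ell+1,\ell+3)\}$; $B_1=\{(0,2),\dots,(\ell-3,\ell-1),(\ell+2,\ell+4),\dots,(m,m+2)\}$; and $B_2=\{(m+3,i_1),(m+4,i_2),\dots,(n-1,i_{n-3-m})\}$ with all $i_j\in\{1,\dots,\ell-1,\ell+2,\dots,m+1\}$, such that whenever $|i_{j_1}-i_{j_2}|\ge 2$, the diagonals $(m+2+j_1,i_{j_1})$ and $(m+2+j_2,i_{j_2})$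 do not cross. Type 3: $B=B_{\mathrm{Bouq}}\cup B_{1,L}\cup B_{1,R}\cup B_{2,L}\cup B_{2,R}$, where for integers $\ell,m,k,t$ with $0<\ell<m+2<k<k+1<k+t\le n-1$: $B_{\mathrm{Bouq}}=\{(\ell-1,\ell+1),(k,\ell-1),(k+t,\ell+1),(k,k+t),(k+1,\ell),(k+2,\ell),\dots,(k+t-1,\ell)\}$; $B_{1,L}=\{(\ell,\ell+2),\dots,(m,m+2)\}$ if $\ell<m+1$ and $B_{1,L}=\emptyset$ if $\ell=m+1$; $B_{1,R}=\{(0,2),\dots,(\ell-2,\ell)\}$ if $\ell>1$ and $B_{1,R}=\emptyset$ if $\ell=1$; $B_{2,L}=\{(m+3,i_1),\dots,(k-1,i_{k-m-3})\}$ if $k>m+3$ and $B_{2,L}=\emptyset$ if $k=m+3$; $B_{2,R}=\{(k+t+1,i_{k+t-m-1}),\dots,(n-1,i_{n-3-m})\}$ if $k+t<n-1$ and $B_{2,R}=\emptyset$ if $k+t=n-1$; where $i_1,\dots,i_{k-m-3}\in\{\ell,\dots,m+1\}$ and $i_{k+t-m-1},\dots,i_{n-3-m}\in\{1,\dots,\ell\}$, and whenever $|i_{j_1}-i_{j_2}|\ge 2$, the diagonals $(m+2+j_1,i_{j_1})$ and $(m+2+j_2,i_{j_2})$ do not cross.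
   Context: Let $P$ be a convex polygon with $n$ vertices labeled $0,1,\dots,n-1$ in cyclic order (indices modulo $n$). An edge $(i,j)$ is the segment between vertices $i$ and $j$; boundary edges are $(i,i+1)$, and diagonals are the other edges. Two edges cross if they share an interior point. A triangulation of $P$ is a maximal set of pairwise non-crossing diagonals of $P$. A blocker (for triangulations) is a set $B$ of diagonals having at least one diagonal in common with every triangulation of $P$. A blocker $B$ is saturated if for every $e\in B$ the set $B\setminus\{e\}$ is not a blocker. *)

(* Defs.v *)
(* Vertices of the convex n-gon are 'I_n; an edge is the
   2-element set of its endpoints. *)
From mathcomp Require Import all_boot.
Set Implicit Arguments.
Unset Strict Implicit.
Unset Printing Implicit Defensive.

Definition edge (n a b : nat) : {set 'I_n} :=
  [set x : 'I_n | (val x == a %% n) || (val x == b %% n)].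

Definition diagonal (n : nat) (e : {set 'I_n}) : bool :=
  [exists a : 'I_n, exists b : 'I_n,
     [&& e == [set a; b], a.+1 < b & ~~ ((val a == 0) && (val b == n.-1))]].

(* Two chords of a convex polygon share an interior point iff their four
   endpoints are distinct and interleave in the cyclic order. *)
Definition cross (n : nat) (e f : {set 'I_n}) : bool :=
  [exists a : 'I_n, exists b : 'I_n, exists c : 'I_n, exists d : 'I_n,
     [&& e == [set a; b], f == [set c; d], a < c, c < b & b < d]] ||
  [exists a : 'I_n, exists b : 'I_n, exists c : 'I_n, exists d : 'I_n,
     [&& f == [set a; b], e == [set c; d], a < c, c < b & b < d]].

Definition is_triangulation (n : nat) (T : {set {set 'I_n}}) : Prop :=
  [/\ (forall e, e \in T -> diagonal e),
      (forall e f, e \in T -> f \in T -> ~~ cross e f) &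
      (forall e, diagonal e -> e \notin T -> exists2 f, f \in T & cross e f)].

Definition is_blocker (n : nat) (B : {set {set 'I_n}}) : Prop :=
  (forall e, e \in B -> diagonal e) /\
  (forall T : {set {set 'I_n}}, is_triangulation T -> exists2 e, e \in B & e \in T).

Definition saturated_blocker (n : nat) (B : {set {set 'I_n}}) : Prop :=
  is_blocker B /\ (forall e, e \in B -> ~ is_blocker (B :\ e)).

Definition edges (n r : nat) (s : seq (nat * nat)) : {set {set 'I_n}} :=
  [set:: [seq edge n (p.1 + r) (p.2 + r) | p <- s]].

Definition shorts (a len : nat) : seq (nat * nat) :=
  [seq (k, k + 2) | k <- iota a len].

Definition fan (m : nat) (i : nat -> nat) (J : seq nat) : seq (nat * nat) :=
  [seq (m + 2 + j, i j) | j <- J].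

Definition fan_noncross (n m : nat) (i : nat -> nat) (J : seq nat) : Prop :=
  forall j1 j2, j1 \in J -> j2 \in J ->
    (i j1 + 2 <= i j2) || (i j2 + 2 <= i j1) ->
    ~~ cross (edge n (m + 2 + j1) (i j1)) (edge n (m + 2 + j2) (i j2)).

Definition type1 (n : nat) (B : {set {set 'I_n}}) : Prop :=
  exists (r m l : nat) (i : nat -> nat),
    [/\ 4 <= m <= n - 3, 2 < l < m,
        (forall j, j \in iota 1 (n - 3 - m) -> (1 <= i j <= m + 1) && (i j != l)),
        fan_noncross n m i (iota 1 (n - 3 - m)) &
        B = edges n r
              ([:: (l - 2, l); (l - 2, l + 1); (l - 1, l + 2); (l, l + 2)]
               ++ (shorts 0 (l - 2) ++ shorts (l + 1) (m - l))
               ++ fan m i (iota 1 (n - 3 - m)))].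

Definition type2 (n : nat) (B : {set {set 'I_n}}) : Prop :=
  exists (r m l : nat) (i : nat -> nat),
    [/\ 5 <= m <= n - 3, 2 < l < m - 1,
        (forall j, j \in iota 1 (n - 3 - m) ->
            (1 <= i j <= l - 1) || (l + 2 <= i j <= m + 1)),
        fan_noncross n m i (iota 1 (n - 3 - m)) &
        B = edges n r
              ([:: (l - 2, l); (l - 2, l + 1); (l - 1, l + 2); (l, l + 3); (l + 1, l + 3)]
               ++ (shorts 0 (l - 2) ++ shorts (l + 2) (m - l - 1))
               ++ fan m i (iota 1 (n - 3 - m)))].

Definition type3 (n : nat) (B : {set {set 'I_n}}) : Prop :=
  exists (r l m k t : nat) (i : nat -> nat),
    let JL := iota 1 (k - m - 3) in
    let JR := iota (k + t - m - 1) (n - 1 - (k + t)) in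
    [/\ [&& 0 < l, l < m + 2, m + 2 < k, k + 1 < k + t & k + t <= n - 1],
        (forall j, j \in JL -> l <= i j <= m + 1),
        (forall j, j \in JR -> 1 <= i j <= l),
        fan_noncross n m i (JL ++ JR) &
        B = edges n r
              ([:: (l - 1, l + 1); (k, l - 1); (k + t, l + 1); (k, k + t)]
               ++ [seq (k + s, l) | s <- iota 1 (t - 1)]
               ++ shorts l (m + 1 - l) ++ shorts 0 (l - 1)
               ++ fan m i JL ++ fan m i JR)].

(* Main.v *)
(** A vertex v is a middle if its short diagonal (v - 1, v + 1) belongs to B, and an ear otherwise.
    Removing an ear leaves a blocker of the smaller polygon, and a blocker of an N-gon has at least
    N - 2 chords; so the ears of B have degree 1 or 2, and two non-adjacent ears of degree 2 are
    joined by a chord of B. Explicit triangulations made of one or two fans show that a vertex of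
    degree 1 is joined to a middle, and that two maximal runs of middles are not both bounded on the
    same side by an ear of degree 1. If no two ears are joined, then there are at most two runs: with
    a single one B would properly contain a blocker with n - 2 chords, and with two runs the ears of
    degree 2 between them give types 1 and 2. If two ears are joined, then only one run has length at
    least 2, and zigzag triangulations between this run and the remaining vertices give type 3. *)
From HB Require Import structures.
From Stdlib Require Import ZArith.
Require Import Defs.
From mathcomp Require Import all_boot.
From Stdlib Require Import Lia Classical.

Set Implicit Arguments.
Unset Strict Implicit.
Unset Printing Implicit Defensive.

(** A blocker of an N-gon needs N - 2 chords, and B has only one more than that for N = n. Deleting
    d vertices so that the rest stays blocked leaves at least n - d - 2 chords, so at most d + 1
    chords of B may touch the deleted ones; every degree bound comes from this slack of one.
    Saturation enters in two ways. B cannot properly contain a blocker with n - 2 chords, which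
    excludes regular configurations; and every chord of B lies in a triangulation meeting B nowhere
    else, which excludes a chord of B under which every triangulation must use another chord of B.
    All remaining facts are obtained by exhibiting a triangulation that misses B. The chords joining
    a run of middles to the other vertices j are recorded by a function I. As long as I never jumps
    up by two or more, walking through the triangles shows that the short diagonals and these chords
    already block. So without joined ears a second run must exist, and with joined ears p and q the
    only possible jump, from I p to I q, must occur: this is the bouquet. *)

HB.instance Definition _ := hasDecEq.Build Z Z.eqb_spec.

Local Open Scope Z_scope.

(** * Triangulations of an interval of labels *)

Lemma Zrange_dec (P : Z -> bool) (a c : Z) :
  (exists2 y, a <= y < c & P y) \/ (forall y, a <= y < c -> ~~ P y).
Proof.
case: (Z_le_gt_dec a c) => [ac|ca]; last by right=> y; lia.
have [k ->] : exists k : nat, c = a + Z.of_nat k by exists (Z.to_nat (c - a)); lia.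
elim: k => [|k [[y yr Py]|IH]]; first by right=> y; lia.
  by left; exists y => //; lia.
case Pk: (P (a + Z.of_nat k)).
  by left; exists (a + Z.of_nat k) => //; lia.
right=> y yr; case: (Z.eq_dec y (a + Z.of_nat k)) => [->|ne]; first by rewrite Pk.
by apply: IH; lia.
Qed.

Lemma Zfirst (P : Z -> bool) (a c : Z) : a <= c -> P c ->
  exists2 k, a <= k <= c & P k /\ forall j, a <= j < k -> ~~ P j.
Proof.
move=> ac Pc.
have [d def_c] : exists d : nat, c = a + Z.of_nat d by exists (Z.to_nat (c - a)); lia.
elim: d a ac def_c => [|d IH] a ac def_c.
  by exists c; [lia | split=> // j; lia].
case Pa: (P a); first by exists a; [lia | split=> // j; lia].
have [||k kr [Pk kmin]] := IH (a + 1); [lia | lia |].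
exists k; [lia | split=> // j jr].
by case: (Z.eq_dec j a) => [->|ne]; [rewrite Pa | apply: kmin; lia].
Qed.

Lemma Zlast (P : Z -> bool) (a c : Z) : a <= c -> P a ->
  exists2 k, a <= k <= c & P k /\ forall j, k < j <= c -> ~~ P j.
Proof.
move=> ac Pa.
have [||k kr [Pk kmin]] := @Zfirst (fun z => P (- z)) (- c) (- a); first by lia.
  by rewrite Z.opp_involutive.
exists (- k); [lia | split=> // j jr].
by rewrite -(Z.opp_involutive j); apply: kmin; lia.
Qed.

Definition chordfree (b : Z -> Z -> bool) : Prop := forall x, ~~ b x (x + 1).

Lemma chordfree_at (b : Z -> Z -> bool) (x y : Z) :
  chordfree b -> y = x + 1 -> ~~ b x y.
Proof. by move=> side ->; apply: side. Qed.

(** The label c is the apex of the triangle on the closing chord (x, y). That chord itself is not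
    tested against b, so the whole n-gon is the interval from r to r + n - 1, closed by a side.
    Sides and diagonals need no separate cuts because b is false on sides. *)
Inductive tri (b : Z -> Z -> bool) : Z -> Z -> Prop :=
| tri_side x : tri b x (x + 1)
| tri_cut x c y : x < c < y -> ~~ b x c -> ~~ b c y ->
    tri b x c -> tri b c y -> tri b x y.

Lemma tri_side' (b : Z -> Z -> bool) (x y : Z) : y = x + 1 -> tri b x y.
Proof. by move->; apply: tri_side. Qed.

Lemma tri_lt (b : Z -> Z -> bool) (x y : Z) : tri b x y -> x < y.
Proof. by case=> *; lia. Qed.

Lemma tri_ear (b : Z -> Z -> bool) (x y : Z) :
  chordfree b -> y = x + 2 -> tri b x y.
Proof.
move=> side ->; apply: (@tri_cut _ _ (x + 1)); [lia | exact: side | | exact: tri_side |].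
  by apply: chordfree_at => //; lia.
by apply: tri_side'; lia.
Qed.

(** The triangles (c, y - 1, y) are appended one by one on the right of the interval from c to p. *)
Lemma tri_fanl (b : Z -> Z -> bool) (c p d : Z) : chordfree b ->
  tri b c p -> p <= d -> (forall y, p <= y < d -> ~~ b c y) -> tri b c d.
Proof.
move=> side tcp pd free.
have [k def_d] : exists k : nat, d = p + Z.of_nat k by exists (Z.to_nat (d - p)); lia.
elim: k d pd def_d free => [|k IH] d pd def_d free.
  by have -> : d = p by lia.
have cp := tri_lt tcp.
apply: (@tri_cut _ _ (d - 1)); [lia | by apply: free; lia | | |].
- by apply: chordfree_at => //; lia.
- by apply: IH => [||y ?]; [lia | lia | apply: free; lia].
by apply: tri_side'; lia.
Qed.

Lemma tri_fanr (b : Z -> Z -> bool) (a p d : Z) : chordfree b ->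
  tri b p d -> a <= p -> (forall x, a < x <= p -> ~~ b x d) -> tri b a d.
Proof.
move=> side tpd ap free.
have [k def_a] : exists k : nat, a = p - Z.of_nat k by exists (Z.to_nat (p - a)); lia.
elim: k a ap def_a free => [|k IH] a ap def_a free.
  by have -> : a = p by lia.
have pd := tri_lt tpd.
apply: (@tri_cut _ _ (a + 1)); [lia | exact: side | by apply: free; lia | |].
- exact: tri_side.
by apply: IH => [||y ?]; [lia | lia | apply: free; lia].
Qed.

(** The increasing enumeration of the integers other than v, used to relabel a polygon after v is
    deleted. *)
Definition skip (v x : Z) : Z := if x <? v then x else x + 1.

Lemma skip_spec (v x : Z) : x < v /\ skip v x = x \/ v <= x /\ skip v x = x + 1.
Proof. by rewrite /skip; case: Z.ltb_spec; lia. Qed.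

Lemma skip_lt (v x y : Z) : x < y -> skip v x < skip v y.
Proof. by rewrite /skip; case: (Z.ltb_spec x v); case: (Z.ltb_spec y v); lia. Qed.

(** The triangle (v - 1, v, v + 1) is glued back onto the side that had closed the gap at v. *)
Lemma tri_skip (b : Z -> Z -> bool) (v x y : Z) : chordfree b ->
  tri (fun x y => b (skip v x) (skip v y)) x y -> tri b (skip v x) (skip v y).
Proof.
move=> side; elim=> {x y} [x|x c y xcy bxc bcy _ txc _ tcy].
  rewrite {2}/skip; case: Z.ltb_spec => ?; rewrite /skip; case: Z.ltb_spec => ?; try lia.
  - exact: tri_side.
  - by apply: tri_ear => //; lia.
  exact: tri_side.
by apply: (@tri_cut _ _ (skip v c)) => //; split; apply: skip_lt; lia.
Qed.

Lemma chordfree_skip (b : Z -> Z -> bool) (v : Z) : chordfree b ->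
  ~~ b (v - 1) (v + 1) -> chordfree (fun x y => b (skip v x) (skip v y)).
Proof.
move=> side ear x; rewrite /skip; case: Z.ltb_spec => ?; case: Z.ltb_spec => ?; try lia.
- exact: side.
- by have -> : x = v - 1 by [lia]; have -> : v - 1 + 1 + 1 = v + 1 by lia.
exact: side.
Qed.

(* Removing a vertex whose short diagonal is absent keeps the smaller polygon blocked and loses at
   least one chord, because the fan at that vertex must be hit. *)
Lemma blocked_lower_bound (k : nat) (b : Z -> Z -> bool) :
  chordfree b -> ~ tri b 0 (Z.of_nat k + 2) ->
  exists2 s : seq (Z * Z), uniq s & size s = k.+1 /\
    forall p, p \in s -> [/\ 0 <= p.1, p.1 + 2 <= p.2, p.2 <= Z.of_nat k + 2,
                            p <> (0, Z.of_nat k + 2) & b p.1 p.2].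
Proof.
elim: k b => [|k IH] b side nt; first by case: nt; apply: tri_ear.
have [[v vr short]|short] :=
  Zrange_dec (fun v => ~~ b (v - 1) (v + 1)) 1 (Z.of_nat k + 3); last first.
  (* With no vertex to delete, the short diagonals around 1, ..., k + 2 are already N - 2 chords,
     where N = k + 4. *)
  exists [seq (Z.of_nat i, Z.of_nat i + 2) | i <- iota 0 k.+2].
    by rewrite map_inj_uniq ?iota_uniq // => i j [] ; lia.
  rewrite size_map size_iota; split=> // p /mapP[i]; rewrite mem_iota add0n => /ltP ir ->.
  split=> /=; [lia | lia | lia | move=> [] ? ?; lia |].
  have := short (Z.of_nat i + 1); rewrite negbK => /(_ ltac:(lia)).
  by have -> : Z.of_nat i + 1 - 1 = Z.of_nat i by [lia];
     have -> : Z.of_nat i + 1 + 1 = Z.of_nat i + 2 by lia.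
have side' := chordfree_skip side short.
have [|s' us' [ss' hs']] := IH _ side'.
  move=> /(@tri_skip _ _ _ _ side).
  have -> : skip v 0 = 0 by rewrite /skip; case: Z.ltb_spec; lia.
  have -> : skip v (Z.of_nat k + 2) = Z.of_nat k.+1 + 2 by rewrite /skip; case: Z.ltb_spec; lia.
  exact: nt.
have [e [e1 e2 e3 e4 e5] ev] : exists2 e : Z * Z,
    [/\ 0 <= e.1, e.1 + 2 <= e.2, e.2 <= Z.of_nat k.+1 + 2,
                            e <> (0, Z.of_nat k.+1 + 2) & b e.1 e.2] & e.1 = v \/ e.2 = v.
  have [[y yr by_]|free1] := Zrange_dec (fun y => b y v) 0 (v - 1).
    by exists (y, v); [split=> //=; [lia|lia|lia|move=> []; lia] | right].
  have [[y yr by_]|free2] := Zrange_dec (fun y => b v y) (v + 2) (Z.of_nat k + 4).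
    by exists (v, y); [split=> //=; [lia|lia|lia|move=> []; lia] | left].
  case: nt; case: (Z.eq_dec v 1) => [v1|v1].
    apply: (@tri_cut _ _ v); [lia | by rewrite v1; apply: side | by apply: free2; lia
                             | by apply: tri_side'; lia |].
    apply: (@tri_fanl _ _ (v + 1)) => //; [exact: tri_side | lia | move=> y yr].
    by case: (Z.eq_dec y (v + 1)) => [->|?]; [apply: side | apply: free2; lia].
  have bv' : ~~ b v (Z.of_nat k.+1 + 2).
    case: (Z.eq_dec (Z.of_nat k.+1 + 2) (v + 1)) => [->|?]; first exact: side.
    by apply: free2; lia.
  apply: (@tri_cut _ _ v); [lia | by apply: free1; lia | exact: bv' | |].
    apply: (@tri_fanr _ _ (v - 1)) => //; [by apply: tri_side'; lia | lia | move=> y yr].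
    case: (Z.eq_dec y (v - 1)) => [->|?]; last by apply: free1; lia.
    by apply: chordfree_at => //; lia.
  apply: (@tri_fanl _ _ (v + 1)) => //; [exact: tri_side | lia | move=> y yr].
  by case: (Z.eq_dec y (v + 1)) => [->|?]; [apply: side | apply: free2; lia].
pose f (p : Z * Z) := (skip v p.1, skip v p.2).
have skipv x : skip v x <> v by rewrite /skip; case: Z.ltb_spec; lia.
exists (e :: map f s').
  rewrite /= map_inj_uniq ?us' ?andbT.
    by apply/mapP=> -[p _ def_e]; case: ev; rewrite def_e; apply: skipv.
  have skip_inj x y : skip v x = skip v y -> x = y.
    by rewrite /skip; case: Z.ltb_spec; case: Z.ltb_spec; lia.
  by move=> [x y] [x' y'] [/skip_inj-> /skip_inj->].
rewrite /= size_map ss'; split=> // p; rewrite inE => /orP[/eqP-> // |].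
case/mapP=> -[x y] /hs'[/= q1 q2 q3 q4 q5] ->; rewrite /f /=.
have xv := skip_spec v x; have yv := skip_spec v y.
split=> //=; [lia | lia | lia | move=> [E1 E2]; apply: q4; congr (_, _); lia].
Qed.

(** * Saturated blockers with n - 1 chords on the universal cover *)

Ltac pair_lia :=
  rewrite /= ?inE ?negb_or -?andbA; repeat (apply/andP; split=> //); apply/eqP; case; lia.

(** The triangle on a chord (u, v) of t, or on the side (u, u + n - 1), has its apex c between u and
    v. This closure property is all that is kept of a triangulation. *)
Definition apex_closed (n : Z) (t : Z -> Z -> bool) : Prop :=
  forall u v, u + 2 <= v < u + n -> t u v \/ v = u + n - 1 ->
  exists c, [/\ u < c < v, t u c \/ c = u + 1 & t c v \/ v = c + 1].

(* A saturated blocker with n - 1 chords, read on the universal cover of the polygon: the labels are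
   integers, x and x + n naming the same vertex, so that every arc is an interval. The field [sat]
   gives, for each chord of b, a triangulation t meeting b in this chord only. *)
Record crit (n : Z) (b : Z -> Z -> bool) : Prop := Crit {
  crit_n : 5 < n;
  crit_sym : forall x y, b x y = b y x;
  crit_per : forall x y, b (x + n) y = b x y;
  crit_side : chordfree b;
  crit_irr : forall x, ~~ b x x;
  crit_blocked : forall r, ~ tri b r (r + n - 1);
  crit_sat : forall x y, x < y < x + n -> b x y ->
    exists t, [/\ apex_closed n t, t x y &
      forall r u v, r <= x -> y < r + n -> r <= u < v -> v < r + n ->
        b u v -> t u v -> u = x /\ v = y];
  crit_card_le : forall (r : Z) (s : seq (Z * Z)), uniq s ->
    (forall p, p \in s -> [/\ r <= p.1, p.1 < p.2, p.2 < r + n & b p.1 p.2]) ->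
    Z.of_nat (size s) <= n - 1;
  crit_card_gt : forall (r : Z) (s : seq (Z * Z)), Z.of_nat (size s) <= n - 2 ->
    exists x y, [/\ r <= x, x < y, y < r + n, b x y & (x, y) \notin s]
}.

Definition mid (b : Z -> Z -> bool) (v : Z) : bool := b (v - 1) (v + 1).

Definition shift (r : Z) (b : Z -> Z -> bool) : Z -> Z -> bool :=
  fun x y => b (x + r) (y + r).

Lemma tri_shift (b : Z -> Z -> bool) (r x y : Z) :
  tri (shift r b) x y -> tri b (x + r) (y + r).
Proof.
elim=> {x y} [x|x c y xcy bxc bcy _ txc _ tcy]; first by apply: tri_side'; lia.
by apply: (@tri_cut _ _ (c + r)) => //; lia.
Qed.

Lemma crit_shift (n : Z) (b : Z -> Z -> bool) (r : Z) : crit n b -> crit n (shift r b).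
Proof.
case=> n5 sym per side irr blk sat le gt; split=> //.
- by move=> x y; apply: sym.
- by move=> x y; rewrite /shift -[RHS]per; congr (b _ _); lia.
- by move=> x; rewrite /shift; apply: (chordfree_at side); lia.
- by move=> x; apply: irr.
- move=> a /tri_shift; have -> : a + n - 1 + r = a + r + n - 1 by lia.
  exact: blk.
- move=> x y xy /sat[|t [tc txy tu]]; first lia.
  exists (shift r t); split=> // [u v uv tuv|a u v ? ? ? ? buv tuv].
    have [||c [? tc1 tc2]] := tc (u + r) (v + r); [lia | by case: tuv; [left | right; lia] |].
    exists (c - r); rewrite /shift !Z.sub_add; split; first by lia.
      by case: tc1; [left | right; lia].
    by case: tc2; [left | right; lia].
  have [] := tu (a + r) (u + r) (v + r); try lia; [exact: buv | exact: tuv].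
- move=> a s us hs.
  have := @le (a + r) [seq (p.1 + r, p.2 + r) | p <- s].
  rewrite size_map; apply.
    by rewrite map_inj_uniq // => -[x y] [x' y'] [] ? ?; congr (_, _); lia.
  by move=> p /mapP[[x y] /hs[/= ? ? ? ?] ->]; split=> //=; lia.
move=> a s ss.
have [|x [y [? ? ? bxy nxy]]] := @gt (a + r) [seq (p.1 + r, p.2 + r) | p <- s].
  by rewrite size_map.
exists (x - r), (y - r); rewrite /shift !Z.sub_add; split=> //; try lia.
apply: contra nxy => sxy; apply/mapP; exists (x - r, y - r) => //=.
by rewrite !Z.sub_add.
Qed.

Lemma crit_per2 (n : Z) (b : Z -> Z -> bool) (k l x y x' y' : Z) : crit n b ->
  x' = x + k * n -> y' = y + l * n -> b x' y' = b x y.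
Proof.
move=> P -> ->.
have per1 (i : nat) u v : b (u + Z.of_nat i * n) v = b u v.
  elim: i u => [|i IH] u; first by congr (b _ _); lia.
  by rewrite -(IH u) -[RHS](crit_per P) Nat2Z.inj_succ Z.mul_succ_l Z.add_assoc.
have per u v i : b (u + i * n) v = b u v.
  case: (Z_le_gt_dec 0 i) => ii.
    by rewrite -(per1 (Z.to_nat i) u) Z2Nat.id.
  rewrite -(per1 (Z.to_nat (- i))) Z2Nat.id; last by lia.
  by congr (b _ _); ring.
by rewrite per (crit_sym P) per (crit_sym P).
Qed.

(** Reads a chord from its other endpoint: x reappears to the right of y as x + n. *)
Lemma crit_wrap (n : Z) (b : Z -> Z -> bool) (x y : Z) : crit n b -> b x y = b y (x + n).
Proof. by move=> P; rewrite (crit_sym P) (@crit_per2 _ _ 0 1 y x y (x + n) P) //; lia. Qed.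

Lemma mid_per (n : Z) (b : Z -> Z -> bool) (k x y : Z) : crit n b ->
  y = x + k * n -> mid b y = mid b x.
Proof. by move=> P ?; apply: (@crit_per2 _ _ k k _ _ _ _ P); lia. Qed.

(** * Counting the chords at one or two deleted vertices *)

(** The map f selects k + 3 vertices of the polygon. If they are still blocked, they carry k + 1
    chords by [blocked_lower_bound], and the chords e with an endpoint outside the selection come on
    top. *)
Lemma sub_polygon_card (n : Z) (b : Z -> Z -> bool) (k : nat) (r : Z) (f : Z -> Z)
    (e : seq (Z * Z)) : crit n b ->
  (forall x y, x < y -> f x < f y) -> r <= f 0 -> f (Z.of_nat k + 2) < r + n ->
  chordfree (fun x y => b (f x) (f y)) ->
  ~ tri (fun x y => b (f x) (f y)) 0 (Z.of_nat k + 2) ->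
  uniq e ->
  (forall p, p \in e -> [/\ r <= p.1, p.1 < p.2, p.2 < r + n & b p.1 p.2]) ->
  (forall x y, 0 <= x -> y <= Z.of_nat k + 2 -> (f x, f y) \notin e) ->
  Z.of_nat k + 1 + Z.of_nat (size e) <= n - 1.
Proof.
move=> P finc f0 fk side nt ue he nfe.
have [s us [ss hs]] := blocked_lower_bound side nt.
have finj x y : f x = f y -> x = y.
  by move=> fxy; case: (Z.lt_total x y) => [/finc|[//|/finc]]; lia.
have fle x y : x <= y -> f x <= f y.
  by move=> xy; case: (Z.eq_dec x y) => [->|ne]; [lia | have /finc : x < y by lia]; lia.
have := @crit_card_le _ _ P r (e ++ [seq (f p.1, f p.2) | p <- s]).
rewrite size_cat size_map ss => le.
suff: Z.of_nat (size e + k.+1) <= n - 1 by rewrite -plusE; lia.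
apply: le.
  rewrite cat_uniq ue map_inj_uniq ?us ?andbT //=.
    apply/hasPn=> _ /mapP[[x y] /hs[/= ? ? ? _ _] ->]; apply: nfe; lia.
  by move=> [x y] [x' y'] [/finj-> /finj->].
move=> p; rewrite mem_cat => /orP[/he //|/mapP[[x y] /hs[/= ? ? ? _ bxy] ->]].
have /finc ? : x < y by lia.
have /fle ? : 0 <= x by lia.
have /fle ? : y <= Z.of_nat k + 2 by lia.
by split=> //=; lia.
Qed.

(** Deleting the ear v keeps n - 3 chords; with three more at v there would be n. *)
Lemma ear_degree (n : Z) (b : Z -> Z -> bool) (v y1 y2 y3 : Z) : crit n b ->
  ~~ mid b v -> v < y1 -> y1 < y2 -> y2 < y3 -> y3 < v + n ->
  b v y1 -> b v y2 -> b v y3 -> False.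
Proof.
move=> P ev v1 v2 v3 v4 b1 b2 b3; have n5 := crit_n P.
have bn y : b v y -> b y (v + n) by rewrite [b y _](crit_sym P) (crit_per P).
have [k def_k] : exists k : nat, Z.of_nat k = n - 4 by exists (Z.to_nat (n - 4)); lia.
suff: Z.of_nat k + 1 + Z.of_nat 3 <= n - 1 by lia.
apply: (@sub_polygon_card _ _ k (v + 1) (fun x => x + (v + 1))
          [:: (y1, v + n); (y2, v + n); (y3, v + n)] P); try lia.
- exact: crit_side (crit_shift (v + 1) P).
- move=> /(@tri_shift b (v + 1)).
  have -> : Z.of_nat k + 2 + (v + 1) = v + n - 1 by lia.
  have -> : 0 + (v + 1) = v + 1 by lia.
  move=> t1; apply: (@crit_blocked _ _ P (v + 1)).
  apply: (@tri_cut _ _ (v + n - 1)) => //; [lia | | | by apply: tri_side'; lia].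
    by rewrite (crit_sym P) (@crit_per2 _ _ 1 0 (v - 1) (v + 1) _ _ P) //; lia.
  by apply: (chordfree_at (crit_side P)); lia.
- by pair_lia.
- by move=> p; rewrite !inE => /or3P[] /eqP-> /=; split; try lia; apply: bn.
by move=> x y ? ?; pair_lia.
Qed.

(** Deleting both ears keeps n - 4 chords, and the four chords at i and j are distinct because (i,
    j) is not one of them. *)
Lemma two_ears_degree (n : Z) (b : Z -> Z -> bool) (i j x1 x2 y1 y2 : Z) : crit n b ->
  i + 2 <= j <= i + n - 2 -> ~~ mid b i -> ~~ mid b j -> ~~ b i j ->
  i < x1 < x2 -> x2 < i + n -> b i x1 -> b i x2 ->
  i < y1 < y2 -> y2 < i + n -> b j y1 -> b j y2 -> False.
Proof.
move=> P ij ei ej bij x12 xn bx1 bx2 y12 yn by1 by2; have n5 := crit_n P.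
have bn y : b i y -> b y (i + n) by rewrite [b y _](crit_sym P) (crit_per P).
have [k def_k] : exists k : nat, Z.of_nat k = n - 5 by exists (Z.to_nat (n - 5)); lia.
have x1j : x1 <> j by move=> E; move: bij; rewrite -E bx1.
have x2j : x2 <> j by move=> E; move: bij; rewrite -E bx2.
have y1j : y1 <> j by move=> E; move: (crit_irr P j); rewrite -{2}E by1.
have y2j : y2 <> j by move=> E; move: (crit_irr P j); rewrite -{2}E by2.
(* [g y] is the chord joining j and y with its smaller label first. *)
have [g gE] : exists g, forall y, y < j /\ g y = (y, j) \/ j <= y /\ g y = (j, y).
  exists (fun y => if y <? j then (y, j) else (j, y)) => y.
  by case: Z.ltb_spec; [left | right].
suff: Z.of_nat k + 1 + Z.of_nat 4 <= n - 1 by lia.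
have skE := skip_spec (j - i - 1).
have sidei := crit_side (crit_shift (i + 1) P).
apply: (@sub_polygon_card _ _ k (i + 1) (fun x => skip (j - i - 1) x + (i + 1))
          [:: (x1, i + n); (x2, i + n); g y1; g y2] P).
- by move=> x y /(@skip_lt (j - i - 1)); lia.
- by have := skE 0; lia.
- by have := skE (Z.of_nat k + 2); lia.
- apply: (chordfree_skip sidei); rewrite /shift.
  by move: ej; rewrite /mid; congr (~~ b _ _); lia.
- move=> /(tri_skip sidei) /(@tri_shift b (i + 1)).
  have -> : skip (j - i - 1) (Z.of_nat k + 2) + (i + 1) = i + n - 1.
    by have := skE (Z.of_nat k + 2); lia.
  have -> : skip (j - i - 1) 0 + (i + 1) = i + 1 by have := skE 0; lia.
  move=> t1; apply: (@crit_blocked _ _ P (i + 1)).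
  apply: (@tri_cut _ _ (i + n - 1)) => //; [lia | | | by apply: tri_side'; lia].
    by rewrite (crit_sym P) (@crit_per2 _ _ 1 0 (i - 1) (i + 1) _ _ P) //; lia.
  by apply: (chordfree_at (crit_side P)); lia.
- by case: (gE y1) => -[? ->]; case: (gE y2) => -[? ->]; pair_lia.
- move=> p; rewrite !inE => /or4P[] /eqP->.
  + by split=> /=; [lia | lia | lia | exact: bn].
  + by split=> /=; [lia | lia | lia | exact: bn].
  + by case: (gE y1) => -[? ->]; split=> //=; try lia; rewrite (crit_sym P).
  by case: (gE y2) => -[? ->]; split=> //=; try lia; rewrite (crit_sym P).
move=> x y ? ?; have {skE} [skx sky] := (skE x, skE y).
by case: (gE y1) => -[? ->]; case: (gE y2) => -[? ->]; pair_lia.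
Qed.

(** Here the absent chord (u - 1, u + 2) cuts off the quadrilateral u - 1, ..., u + 2, and it
    suffices that one of its two diagonals is absent. The remaining n - 2 vertices stay blocked, so
    n - 4 + 4 chords are again too many. *)
Lemma adjacent_ears_degree (n : Z) (b : Z -> Z -> bool) (u x1 x2 y1 y2 : Z) : crit n b ->
  ~~ b (u - 1) (u + 2) -> ~~ mid b u || ~~ mid b (u + 1) ->
  u < x1 < x2 -> x2 < u + n -> b u x1 -> b u x2 ->
  u + 1 < y1 < y2 -> y2 < u + n + 1 -> b (u + 1) y1 -> b (u + 1) y2 -> False.
Proof.
move=> P bu ears x12 xn bx1 bx2 y12 yn by1 by2; have n5 := crit_n P.
have bn y : b u y -> b y (u + n) by rewrite [b y _](crit_sym P) (crit_per P).
have bn1 y : b (u + 1) y -> b y (u + n + 1).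
  by rewrite [b y _](crit_sym P) (@crit_per2 _ _ 1 0 (u + 1) y _ _ P) //; lia.
have x1j : x1 <> u + 1 by move=> E; have := crit_side P u; rewrite -E bx1.
have x2j : x2 <> u + 1 by lia.
have y2j : y2 <> u + n.
  move=> E; have := crit_side P u; rewrite -(crit_per P) (crit_sym P) -E.
  by rewrite by2.
have [k def_k] : exists k : nat, Z.of_nat k = n - 5 by exists (Z.to_nat (n - 5)); lia.
suff: Z.of_nat k + 1 + Z.of_nat 4 <= n - 1 by lia.
apply: (@sub_polygon_card _ _ k (u + 2) (fun x => x + (u + 2))
          [:: (x1, u + n); (x2, u + n); (y1, u + n + 1); (y2, u + n + 1)] P); try lia.
- exact: crit_side (crit_shift (u + 2) P).
- move=> /(@tri_shift b (u + 2)).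
  have -> : Z.of_nat k + 2 + (u + 2) = u + n - 1 by lia.
  have -> : 0 + (u + 2) = u + 2 by lia.
  move=> t1; apply: (@crit_blocked _ _ P (u + 2)).
  have bu' : ~~ b (u + 2) (u + n - 1).
    by rewrite (crit_sym P) (@crit_per2 _ _ 1 0 (u - 1) (u + 2) _ _ P) //; lia.
  (* The quadrilateral is split by (u - 1, u + 1) if u is an ear, and by (u, u + 2) if u + 1 is
     one. *)
  case/orP: ears => ear.
    apply: (@tri_cut _ _ (u + n - 1)) => //; [lia | |].
      by rewrite (@crit_per2 _ _ 1 1 (u - 1) (u + 1) _ _ P) //; lia.
    by apply: (tri_ear (crit_side P)); lia.
  apply: (@tri_cut _ _ (u + n)) => //; [lia | | | | by apply: tri_side'; lia].
  - rewrite (crit_sym P) (@crit_per2 _ _ 1 0 u (u + 2) _ _ P) //; try lia.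
    by move: ear; rewrite /mid; congr (~~ b _ _); lia.
  - by apply: (chordfree_at (crit_side P)); lia.
  apply: (@tri_cut _ _ (u + n - 1)) => //; [lia | | by apply: tri_side'; lia].
  by apply: (chordfree_at (crit_side P)); lia.
- by pair_lia.
- by move=> p; rewrite !inE => /or4P[] /eqP-> /=; split; try lia; auto.
by move=> x y ? ?; pair_lia.
Qed.

(** * Fans *)

(** The fan at q over c, ..., q and the fan at c over q, ..., c + n - 1 glue along (c, q) to a
    triangulation avoiding b. *)
Lemma double_fan_right (n : Z) (b : Z -> Z -> bool) (c q : Z) : crit n b -> c < q < c + n ->
  (forall y, q <= y < c + n -> ~~ b c y) -> (forall x, c <= x < q -> ~~ b x q) -> False.
Proof.
move=> P cq bc bq; have side := crit_side P; apply: (@crit_blocked _ _ P c).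
apply: (@tri_fanl _ _ q) => //; [| lia | by move=> y ?; apply: bc; lia].
apply: (@tri_fanr _ _ (q - 1)) => //; [by apply: tri_side'; lia | lia |].
by move=> x ?; apply: bq; lia.
Qed.

(** The mirror image: the fan at c covers c, ..., q and the fan at q covers q, ..., c + n. *)
Lemma double_fan_left (n : Z) (b : Z -> Z -> bool) (c q : Z) : crit n b -> c < q < c + n ->
  (forall y, c < y <= q -> ~~ b c y) -> (forall y, q < y <= c + n -> ~~ b q y) -> False.
Proof.
move=> P cq bc bq; have side := crit_side P; apply: (@crit_blocked _ _ P c).
(* If q is the polygon neighbour of c on the left, the fan at c alone is a triangulation. *)
case: (Z.eq_dec q (c + n - 1)) => qn.
  apply: (@tri_fanl _ _ (c + 1)) => //; [exact: tri_side | lia | by move=> y ?; apply: bc; lia].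
apply: (@tri_cut _ _ q); [lia | by apply: bc; lia | by apply: bq; lia | |].
  apply: (@tri_fanl _ _ (c + 1)) => //; [exact: tri_side | lia | by move=> y ?; apply: bc; lia].
apply: (@tri_fanl _ _ (q + 1)) => //; [exact: tri_side | lia | by move=> y ?; apply: bq; lia].
Qed.

Lemma vertex_meets (n : Z) (b : Z -> Z -> bool) (v : Z) : crit n b ->
  exists2 y, v + 2 <= y < v + n - 1 & b v y.
Proof.
move=> P; have n5 := crit_n P; have side := crit_side P.
have [//|free] := Zrange_dec (fun y => b v y) (v + 2) (v + n - 1).
case: (@crit_blocked _ _ P v); apply: (@tri_fanl _ _ (v + 1)) => //.
- exact: tri_side.
- lia.
move=> y ?; case: (Z.eq_dec y (v + 1)) => [->|?]; [exact: side | apply: free; lia].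
Qed.

Lemma chord_range (n : Z) (b : Z -> Z -> bool) (v y : Z) : crit n b ->
  v < y < v + n -> b v y -> v + 2 <= y <= v + n - 2.
Proof.
move=> P yr bvy; have side := crit_side P.
have y1 : y <> v + 1 by move=> E; have := side v; rewrite -E bvy.
suff : y <> v + n - 1 by lia.
move=> E; have := side (v - 1); have -> : v - 1 + 1 = v by lia.
rewrite (crit_sym P) -(@crit_per2 _ _ 0 1 v (v - 1) v y P) ?bvy //; lia.
Qed.

(** The triangles (v, y - 1, y + 1) and (y - 1, y, y + 1) pass the ear y without the spoke (v,
    y). *)
Lemma tri_fan_jump (b : Z -> Z -> bool) (v y : Z) : chordfree b -> v + 1 < y ->
  tri b v (y - 1) -> ~~ b v (y - 1) -> ~~ mid b y -> tri b v (y + 1).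
Proof.
move=> side vy t1 b1 ear; apply: (@tri_cut _ _ (y - 1)) => //; first by lia.
by apply: tri_ear => //; lia.
Qed.

(* In the fan at v, replace each missing spoke (v, y) by the short diagonal cutting off y. *)
Lemma two_spokes (n : Z) (b : Z -> Z -> bool) (v y1 y2 : Z) : crit n b ->
  v + 2 <= y1 -> y1 + 2 <= y2 -> y2 <= v + n - 2 ->
  (forall y, v < y < v + n -> b v y -> y = y1 \/ y = y2) -> mid b y1 \/ mid b y2.
Proof.
move=> P v1 v2 v3 bv; have n5 := crit_n P; have side := crit_side P.
case m1: (mid b y1); first by left.
case m2: (mid b y2); [by right | exfalso].
have free y : v < y < v + n -> y <> y1 -> y <> y2 -> ~~ b v y.
  by move=> yr ? ?; apply/negP=> /bv; case/(_ yr).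
have t1 : tri b v (y1 - 1).
  by apply: (@tri_fanl _ _ (v + 1)) => //; [exact: tri_side | lia | move=> y ?; apply: free; lia].
have t2 : tri b v (y1 + 1).
  by apply: tri_fan_jump => //; [lia | apply: free; lia | rewrite m1].
have t3 : tri b v (y2 - 1).
  by apply: (@tri_fanl _ _ (y1 + 1)) => //; [lia | move=> y ?; apply: free; lia].
have t4 : tri b v (y2 + 1).
  by apply: tri_fan_jump => //; [lia | apply: free; lia | rewrite m2].
apply: (@crit_blocked _ _ P v).
by apply: (@tri_fanl _ _ (y2 + 1)) => //; [lia | move=> y ?; apply: free; lia].
Qed.

(** The same modified fan with a single replaced spoke: a vertex of degree one is joined to a
    middle. *)
Lemma one_spoke (n : Z) (b : Z -> Z -> bool) (v y1 : Z) : crit n b ->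
  v + 2 <= y1 <= v + n - 2 ->
  (forall y, v < y < v + n -> b v y -> y = y1) -> mid b y1.
Proof.
move=> P v1 bv; have n5 := crit_n P; have side := crit_side P.
apply/negPn/negP => m1.
have free y : v < y < v + n -> y <> y1 -> ~~ b v y.
  by move=> yr ?; apply/negP=> /bv; move/(_ yr).
have t1 : tri b v (y1 - 1).
  by apply: (@tri_fanl _ _ (v + 1)) => //; [exact: tri_side | lia | move=> y ?; apply: free; lia].
have t2 : tri b v (y1 + 1) by apply: tri_fan_jump => //; [lia | apply: free; lia].
apply: (@crit_blocked _ _ P v).
by apply: (@tri_fanl _ _ (y1 + 1)) => //; [lia | move=> y ?; apply: free; lia].
Qed.

(** * Triangulations meeting the blocker in one chord *)

(** Passing from a chord to an edge of its triangle that is not a side shortens it, until a triangle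
    with two sides is reached. *)
Lemma apex_ear (n : Z) (t : Z -> Z -> bool) (u v : Z) : apex_closed n t ->
  u + 2 <= v < u + n -> t u v -> exists2 w, u < w < v & t (w - 1) (w + 1).
Proof.
move=> tc uv; have [d def_d] : exists d : nat, v - u <= Z.of_nat d by exists (Z.to_nat (v - u)); lia.
elim: d u v def_d uv => [|d IH] u v def_d uv tuv; first lia.
have [|c [cr tuc tcv]] := tc u v uv; first by left.
case: (Z_le_gt_dec (u + 2) c) => uc.
  case: tuc => [tuc|]; last by lia.
  by have [||w ? tw] := IH u c _ _ tuc; [lia | lia | exists w => //; lia].
case: (Z_le_gt_dec (c + 2) v) => cv.
  case: tcv => [tcv|]; last by lia.
  by have [||w ? tw] := IH c v _ _ tcv; [lia | lia | exists w => //; lia].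
exists c => //; have -> : c - 1 = u by [lia]; have -> : c + 1 = v by lia.
exact: tuv.
Qed.

(* A triangulation containing such a chord has an ear strictly between its endpoints. *)
Lemma no_chord_over_mids (n : Z) (b : Z -> Z -> bool) (x y : Z) : crit n b ->
  x + 3 <= y < x + n -> (forall v, x < v < y -> mid b v) -> ~~ b x y.
Proof.
move=> P xy mids; apply/negP=> bxy; have n5 := crit_n P.
have [|t [tc txy tu]] := crit_sat P (x := x) (y := y) _ bxy; first by lia.
have [|w wr tw] := apex_ear tc (u := x) (v := y) _ txy; first by lia.
have := tu x (w - 1) (w + 1) _ _ _ _ (mids w wr) tw; lia.
Qed.

(* The n - 2 chords (v - 1, v + 1) and (I j, j) already form a blocker: walking through the triangles of a
   triangulation avoiding them, the current edge (v, j) always satisfies v < I j. *)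
Lemma no_minimum_inside (n : Z) (b : Z -> Z -> bool) (m : Z) (I : Z -> Z) : crit n b ->
  0 <= m <= n - 3 -> (forall v, 1 <= v <= m + 1 -> mid b v) ->
  (forall j, m + 3 <= j < n -> 1 <= I j <= m + 1 /\ b (I j) j) ->
  (forall j1 j2, m + 3 <= j1 < j2 -> j2 < n -> I j2 <= I j1 + 1) -> False.
Proof.
move=> P mr mids bI dec; have n5 := crit_n P.
pose s1 := [seq (Z.of_nat i, Z.of_nat i + 2) | i <- iota 0 (Z.to_nat (m + 1))].
pose s2 := [seq (I (m + 3 + Z.of_nat i), m + 3 + Z.of_nat i) | i <- iota 0 (Z.to_nat (n - 3 - m))].
(* The lists have n - 2 entries, so b has a further chord (x, y); a triangulation t meeting b only
   there avoids both lists. *)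
have [|x [y [x0 xy yn bxy]]] := crit_card_gt P 0 (s := s1 ++ s2).
  by rewrite size_cat !size_map !size_iota -plusE; lia.
rewrite mem_cat negb_or => /andP[nx1 nx2].
have [|t [tc txy tu]] := crit_sat P (x := x) (y := y) _ bxy; first by lia.
have tmid v : 1 <= v <= m + 1 -> ~~ t (v - 1) (v + 1).
  move=> vr; apply/negP=> tv.
  have [v1 v2] : v - 1 = x /\ v + 1 = y by apply: (tu 0) => //; try lia; apply: mids.
  case/mapP: nx1; exists (Z.to_nat (v - 1)); last by congr (_, _); lia.
  by rewrite mem_iota add0n; apply/andP; split=> //; apply/ltP; lia.
have tI v j : m + 3 <= j < n -> 0 <= v < j -> t v j -> v <> I j.
  move=> jr vr tvj E; have [Ir bIj] := bI j jr.
  have [v1 v2] : v = x /\ j = y by apply: (tu 0) => //; try lia; rewrite E.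
  case/mapP: nx2; exists (Z.to_nat (j - m - 3)).
    by rewrite mem_iota add0n; apply/andP; split=> //; apply/ltP; lia.
  by rewrite Z2Nat.id; [congr (_, _); [rewrite -v1 E; congr I|] | ]; lia.
(* A longer chord among 0, ..., m + 2 would have an ear of t below it, at a middle. *)
have tlow u v : 0 <= u < v -> v <= m + 2 -> t u v -> v = u + 1.
  move=> u0 vm tuv; case: (Z.eq_dec v (u + 1)) => // uv; exfalso.
  have [|w wr tw] := apex_ear tc (u := u) (v := v) _ tuv; first by lia.
  by have := tmid w; rewrite tw => /(_ ltac:(lia)).
(* Let c be the apex over (v, j). If c <= m + 2, then c = v + 1, which differs from I j and so stays
   below it. Otherwise I j <= I c + 1 gives v <= I c, and equality is excluded because t avoids (I
   c, c). *)
have walk (d : nat) v j : j - v <= Z.of_nat d -> 0 <= v <= m + 2 -> m + 3 <= j < n ->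
    t v j \/ v = 0 /\ j = n - 1 -> v < I j -> False.
  elim: d v j => [|d IH] v j dr vr jr tvj vI; first lia.
  have [Ir _] := bI j jr.
  have [||c [cr tvc tcj]] := tc v j; [lia | by case: tvj; [left | right; lia] |].
  case: (Z_le_gt_dec c (m + 2)) => cm.
    have cv : c = v + 1 by case: tvc => // tvc; apply: tlow; [lia | lia |].
    case: tcj => [tcj|jc]; last by lia.
    have ? := tI c j jr ltac:(lia) tcj.
    by apply: (IH c j); [lia | lia | lia | left | lia].
  have cj : m + 3 <= c < n by lia.
  case: tvc => [tvc|?]; last by lia.
  have ? := tI v c cj ltac:(lia) tvc.
  have := dec c j ltac:(lia) ltac:(lia).
  by move=> ?; apply: (IH v c); [lia | lia | lia | left | lia].
(* With no label above m + 2, the triangle on the side (0, n - 1) would be 0, 1, 2, giving n = 3. *)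
case: (Z.eq_dec n (m + 3)) => [nm|nm].
  have [||c [cr t0c tcn]] := tc 0 (n - 1); [lia | by right; lia |].
  have c1 : c = 0 + 1 by case: t0c => // t0c; apply: tlow; [lia | lia |].
  have cn : n - 1 = c + 1 by case: tcn => // tcn; apply: tlow; [lia | lia |].
  lia.
have [Ir _] := bI (n - 1) ltac:(lia).
by apply: (walk (Z.to_nat n) 0 (n - 1)); [lia | lia | lia | right | lia].
Qed.

Lemma tri_free_fanl (b : Z -> Z -> bool) (u w : Z) : chordfree b -> u < w ->
  (forall y, u + 2 <= y < w -> ~~ b u y) -> tri b u w.
Proof.
move=> side uw free; apply: (@tri_fanl _ _ (u + 1)) => //; [exact: tri_side | lia |].
by move=> y ?; case: (Z.eq_dec y (u + 1)) => [->|?]; [apply: side | apply: free; lia].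
Qed.

Lemma tri_free_fanr (b : Z -> Z -> bool) (u w : Z) : chordfree b -> u < w ->
  (forall x, u < x <= w - 2 -> ~~ b x w) -> tri b u w.
Proof.
move=> side uw free; apply: (@tri_fanr _ _ (w - 1)) => //; [by apply: tri_side'; lia | lia |].
move=> x ?; case: (Z.eq_dec x (w - 1)) => ?; last by apply: free; lia.
by apply: (chordfree_at side); lia.
Qed.

(** Triangles with apex j extend the interval down to 0, and the fan at 0 completes it up to n -
    1. *)
Lemma tri_close (n : Z) (b : Z -> Z -> bool) (v j : Z) : crit n b ->
  tri b v j -> 0 <= v -> j < n -> (forall x, 0 < x <= v -> ~~ b x j) ->
  (forall y, j <= y < n - 1 -> ~~ b 0 y) -> False.
Proof.
move=> P tvj v0 jn bj b0; apply: (@crit_blocked _ _ P 0); have side := crit_side P.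
apply: (@tri_fanl _ _ j) => //; [exact: tri_fanr tvj v0 bj | lia].
Qed.

(* Sweeping j upwards, I j is the first obstacle met when the triangulation built so far is extended
   by triangles with apex j. *)
Lemma not_one_gap (n : Z) (b : Z -> Z -> bool) (m : Z) : crit n b ->
  0 <= m <= n - 3 -> (forall v, 1 <= v <= m + 1 -> mid b v) ->
  (forall u w, m + 2 <= u < w -> w <= n -> ~~ b u w) -> False.
Proof.
move=> P mr mids free; have n5 := crit_n P; have side := crit_side P.
have free0 y : m + 2 <= y < n -> ~~ b 0 y.
  move=> yr; rewrite (crit_sym P) -(@crit_per2 _ _ 0 1 y 0 y n P); [|lia|lia].
  by apply: free; lia.
have tU u w : m + 2 <= u < w -> w <= n -> tri b u w.
  by move=> uw wn; apply: tri_free_fanl => //; [lia | move=> y ?; apply: free; lia].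
have [I [w [wr bI dec reach]]] : exists I w, [/\ 1 <= w <= m + 1,
    forall j, m + 3 <= j < n -> 1 <= I j <= m + 1 /\ b (I j) j,
    forall j1 j2, m + 3 <= j1 < j2 -> j2 < n -> I j2 <= I j1 + 1 & True]; last first.
  exact: (no_minimum_inside P mr mids bI dec).
(* [w] bounds from below the values found so far, and the last clause says that w + 1 can serve as
   the lower end of a triangulated interval. Each new value is at most w + 1, which keeps the bound
   I j2 <= I j1 + 1. *)
suff: forall k : nat, m + 3 + Z.of_nat k <= n -> exists I w, [/\ 1 <= w <= m + 1,
    forall j, m + 3 <= j < m + 3 + Z.of_nat k -> w <= I j <= m + 1 /\ b (I j) j,
    forall j1 j2, m + 3 <= j1 < j2 -> j2 < m + 3 + Z.of_nat k -> I j2 <= I j1 + 1 &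
    forall j, m + 3 + Z.of_nat k <= j < n -> ~~ b (w + 1) j -> tri b (w + 1) j].
  move=> /(_ (Z.to_nat (n - m - 3)) ltac:(lia)) [I [w [wr bI dec _]]].
  exists I, w; split=> // [j jr|j1 j2 ? ?]; last by apply: dec; lia.
  by have [|? ?] := bI j; [lia | split=> //; lia].
elim=> [|k IH] kn.
  exists (fun=> 0), (m + 1); split=> [|j|j1 j2|j jr _]; try lia.
  by apply: tU; lia.
have [|I [w [wr bI dec reach]]] := IH; first lia.
set j0 := m + 3 + Z.of_nat k in bI dec reach.
(* The new value v is w + 1 if that label is joined to j0, and w is kept. Otherwise v is the
   greatest smaller label joined to j0, which exists since [tri_close] would apply without it; w
   drops to v, and the triangle (v + 1, j0, j) renews the last clause. *)
have [v [w' [vr w'r bv reach']]] : exists v w', [/\ w' <= v <= w + 1, 1 <= w' <= w /\ v <= m + 1,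
    b v j0 & forall j, j0 + 1 <= j < n -> ~~ b (w' + 1) j -> tri b (w' + 1) j].
  case bw: (b (w + 1) j0).
    have ? : w <> m + 1.
      by move=> E; have := free (m + 2) j0; rewrite -[m + 2]/(m + (1 + 1)) Z.add_assoc -E bw => /(_ ltac:(lia) ltac:(lia)).
    by exists (w + 1), w; split=> // [||j jr]; [lia | lia | apply: reach; lia].
  have t1 : tri b (w + 1) j0 by apply: reach; [lia | rewrite bw].
  have [[v0 v0r bv0]|none] := Zrange_dec (fun x => b x j0) 1 (w + 1); last first.
    case: (tri_close P t1); [lia | lia | | by move=> y ?; apply: free0; lia].
    by move=> x ?; case: (Z.eq_dec x (w + 1)) => [->|?]; [rewrite bw | apply: none; lia].
  have [||v vr [bv last_v]] := @Zlast (fun x => b x j0) v0 w; [lia | exact: bv0 |].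
  have free_v x : v < x <= w + 1 -> ~~ b x j0.
    by move=> ?; case: (Z.eq_dec x (w + 1)) => [->|?]; [rewrite bw | apply: last_v; lia].
  exists v, v; split=> // [||j jr bvj]; [lia | lia |].
  apply: (@tri_cut _ _ j0) => //; [lia | by apply: free_v; lia | by apply: free; lia | | by apply: tU; lia].
  by apply: (@tri_fanr _ _ (w + 1)) => //; [lia | move=> x ?; apply: free_v; lia].
exists (fun j => if j =? j0 then v else I j), w'; split=> [|j jr|j1 j2 j12 j2r|j jr].
- lia.
- case: Z.eqb_spec => [->|ne]; first by split=> //; lia.
  by have [|? ?] := bI j; [lia | split=> //; lia].
- case: Z.eqb_spec => ?; case: Z.eqb_spec => ?; try lia.
    by have [|? ?] := bI j1; lia.
  by apply: dec; lia.
by apply: reach'; lia.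
Qed.

(** * Bouquets *)

Lemma crit_wrap0 (n : Z) (b : Z -> Z -> bool) (y : Z) : crit n b -> b 0 y = b y n.
Proof. exact: crit_wrap 0 y. Qed.

(** When all values lie below all arguments, the chords (I j1, j1) and (I j2, j2) with j1 < j2 cross
    exactly if I j1 < I j2. So this is the condition that chords with values at distance at least 2
    do not cross. *)
Definition falling (I : Z -> Z) (P : Z -> Prop) : Prop :=
  forall j1 j2, P j1 -> P j2 -> j1 < j2 -> I j2 <= I j1 + 1.

(** Type 1 with its short diagonals merged: among those around 1, ..., m + 1 only the one around l
    is missing. *)
Definition chords1 (n : Z) (b : Z -> Z -> bool) : Prop :=
  exists r m l I,
  [/\ 4 <= m <= n - 3, 2 < l < m,
      forall j, m + 3 <= j < n -> 1 <= I j <= m + 1 /\ I j <> l,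
      falling I (fun j => m + 3 <= j < n) &
      forall x y, 0 <= x < y -> y < n -> shift r b x y <->
        (y = x + 2 /\ (x <= l - 2 \/ l <= x <= m)) \/ (x = l - 2 /\ y = l + 1) \/
        (x = l - 1 /\ y = l + 2) \/ (m + 3 <= y /\ x = I y)].

(** Type 2 in the same form; the missing short diagonals are those around l and l + 1. *)
Definition chords2 (n : Z) (b : Z -> Z -> bool) : Prop :=
  exists r m l I,
  [/\ 5 <= m <= n - 3, 2 < l < m - 1,
      forall j, m + 3 <= j < n -> 1 <= I j <= l - 1 \/ l + 2 <= I j <= m + 1,
      falling I (fun j => m + 3 <= j < n) &
      forall x y, 0 <= x < y -> y < n -> shift r b x y <->
        (y = x + 2 /\ (x <= l - 2 \/ l + 1 <= x <= m)) \/ (x = l - 2 /\ y = l + 1) \/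
        (x = l - 1 /\ y = l + 2) \/ (x = l /\ y = l + 3) \/ (m + 3 <= y /\ x = I y)].

(** Type 3 with I extended to all labels from m + 3 on: the values l - 1, l, ..., l, l + 1 on k,
    ..., k + t encode the bouquet except for its chord (k, k + t). *)
Definition chords3 (n : Z) (b : Z -> Z -> bool) : Prop :=
  exists r l m k t I,
  [/\ [/\ 0 < l < m + 2, m + 2 < k & k + 1 < k + t <= n - 1],
      [/\ I k = l - 1, I (k + t) = l + 1 & forall j, k < j < k + t -> I j = l],
      (forall j, m + 3 <= j < k -> l <= I j <= m + 1) /\ (forall j, k + t < j < n -> 1 <= I j <= l),
      falling I (fun j => m + 3 <= j < k) /\ falling I (fun j => k + t < j < n) &
      forall x y, 0 <= x < y -> y < n -> shift r b x y <->
        (y = x + 2 /\ x <= m) \/ (x = k /\ y = k + t) \/ (m + 3 <= y /\ x = I y)].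

(** Among 0, ..., m + 2 nothing has to be assumed beyond the middles, as [no_chord_over_mids] leaves
    only short diagonals. *)
Lemma chords3_intro (n : Z) (b : Z -> Z -> bool) (l m k t : Z) (I : Z -> Z) : crit n b ->
  (forall v, 1 <= v <= m + 1 -> mid b v) ->
  0 < l < m + 2 -> m + 2 < k -> k + 1 < k + t <= n - 1 ->
  I k = l - 1 -> I (k + t) = l + 1 -> (forall j, k < j < k + t -> I j = l) ->
  (forall j, m + 3 <= j < k -> l <= I j <= m + 1) ->
  (forall j, k + t < j < n -> 1 <= I j <= l) ->
  falling I (fun j => m + 3 <= j < k) -> falling I (fun j => k + t < j < n) ->
  (forall x j, 0 <= x <= m + 2 -> m + 3 <= j < n -> b x j <-> x = I j) ->
  (forall u w, m + 3 <= u < w -> w < n -> b u w <-> u = k /\ w = k + t) ->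
  chords3 n b.
Proof.
move=> P mids lr kr tr Ik Ikt Im IL IR fL fR low up.
exists 0, l, m, k, t, I; split=> // x y xy yn; rewrite /shift !Z.add_0_r.
have Ir j : m + 3 <= j < n -> 0 <= I j <= m + 2.
  move=> jr; case: (Z.lt_total j k) => [?|[->|?]]; [by have := IL j; lia | lia |].
  case: (Z.lt_total j (k + t)) => [?|[->|?]]; [by have := Im j; lia | lia |].
  by have := IR j; lia.
case: (Z_le_gt_dec y (m + 2)) => ym; last case: (Z_le_gt_dec x (m + 2)) => xm.
- case: (Z.eq_dec y (x + 2)) => yx.
    have : mid b (x + 1) by apply: mids; lia.
    rewrite /mid; have -> : x + 1 - 1 = x by [lia]; have -> : x + 1 + 1 = y by lia.
    by move=> bxy; split=> // _; left; lia.
  suff: ~~ b x y by move/negP=> nb; split=> //; lia.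
  case: (Z.eq_dec y (x + 1)) => [->|?]; first exact: crit_side P _.
  by apply: (no_chord_over_mids P); [lia | move=> v ?; apply: mids; lia].
- have [||lxy lyx] := low x y; [lia | lia |].
  by split=> [/lxy ?|?]; [lia | apply: lyx; lia].
have [||uxy uyx] := up x y; [lia | lia |].
by split=> [/uxy ?|?]; [lia | apply: uyx; have := Ir y; lia].
Qed.

(** Zigzag triangulations show that I can jump up by two or more only from p to q, and by
    [no_minimum_inside] such a jump does occur. Any label strictly between I p and I q must then be
    the value of I at every j strictly between p and q. Such j exist, so there is exactly one such
    label, which is l. *)
Lemma bouquet_of_link (n : Z) (b : Z -> Z -> bool) (m p q : Z) (I : Z -> Z) : crit n b ->
  0 <= m -> (forall v, 1 <= v <= m + 1 -> mid b v) -> ~~ mid b 0 -> ~~ mid b (m + 2) ->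
  m + 2 <= p -> p + 2 <= q <= n -> b p q ->
  (forall u w, b u w -> m + 2 <= u < w -> w <= n -> u = p /\ w = q) ->
  (forall j, m + 3 <= j < n -> 1 <= I j <= m + 1 /\
     forall x, 1 <= x <= m + 1 -> b x j <-> x = I j) ->
  chords3 n b.
Proof.
move=> P m0 mids ear0 earm pm pq bpq ufree bI; have n5 := crit_n P; have side := crit_side P.
have free u w : m + 2 <= u < w -> w <= n -> u <> p \/ w <> q -> ~~ b u w.
  move=> uw wn ne; apply/negP=> /ufree; lia.
have low x j : 1 <= x <= m + 1 -> m + 3 <= j < n -> x <> I j -> ~~ b x j.
  by move=> xr jr ne; apply/negP; case: (bI j jr) => _ /(_ x xr); tauto.
have b0 y : b 0 y = b y n by exact: (crit_wrap0 y P).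
have tU u w : m + 2 <= u < w -> w <= n -> tri b u w.
  move=> uw wn; case: (Z.eq_dec u p) => up.
    by apply: tri_free_fanr => //; [lia | move=> x ?; apply: free; lia].
  by apply: tri_free_fanl => //; [lia | move=> y ?; apply: free; lia].
have lowtri j v : m + 3 <= j < n -> I j < v <= m + 1 -> tri b v j.
  move=> jr vr; have [Ij _] := bI j jr.
  case: (Z.eq_dec q j) => [qj|qj]; [case: (Z.eq_dec p (m + 2)) => [pE|pE] |].
  (* Here m + 2 is joined to j by a chord of b; being an ear, it is cut off by (m + 1, m + 3). *)
  - have t1 : tri b (m + 1) (m + 3) by apply: tri_ear => //; lia.
    have bm : ~~ b (m + 1) (m + 3) by move: earm; rewrite /mid; congr (~~ b _ _); lia.
    apply: (@tri_fanr _ _ (m + 1)) => //; [| lia | by move=> x ?; apply: low; lia].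
    by apply: (@tri_cut _ _ (m + 3)) => //; [lia | apply: free; lia | apply: tU; lia].
  - apply: (@tri_fanr _ _ (m + 2)) => //; [by apply: tU; lia | lia |].
    by move=> x ?; case: (Z.eq_dec x (m + 2)) => ?; [apply: free; lia | apply: low; lia].
  apply: (@tri_fanr _ _ (m + 2)) => //; [by apply: tU; lia | lia |].
  by move=> x ?; case: (Z.eq_dec x (m + 2)) => ?; [apply: free; lia | apply: low; lia].
have close j v : m + 3 <= j < n -> 2 <= v < I j -> tri b v j -> False.
  move=> jr vr tvj; have [Ij _] := bI j jr.
  case: (Z.eq_dec q n) => [qn|qn]; last first.
    apply: (tri_close P tvj); [lia | lia | by move=> x ?; apply: low; lia |].
    by move=> y ?; rewrite b0; apply: free; lia.
  have bn1 : ~~ b 1 (n - 1).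
    by rewrite (crit_sym P) (@crit_per2 _ _ 1 0 (0 - 1) (0 + 1) _ _ P) //; lia.
  case: (Z.eq_dec j (n - 1)) => [jn|jn].
    by apply: (tri_close P tvj); [lia | lia | by move=> x ?; apply: low; lia | lia].
  have t1 : tri b 1 (n - 1).
    apply: (@tri_cut _ _ j) => //; [lia | by apply: low; lia | by apply: free; lia | | by apply: tU; lia].
    by apply: (tri_fanr side tvj); [lia | move=> x ?; apply: low; lia].
  by apply: (tri_close P t1); [lia | lia | move=> x ?; have -> : x = 1 by [lia] | lia].
(* Otherwise (j1, j2) is not a chord of b, and the triangle (I j1 + 1, j1, j2) extends to a
   triangulation avoiding b. *)
have bad j1 j2 : m + 3 <= j1 < j2 -> j2 < n -> I j1 + 2 <= I j2 -> p = j1 /\ q = j2.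
  move=> jr j2n I12; have [I1 _] := bI j1 ltac:(lia); have [I2 _] := bI j2 ltac:(lia).
  case: (Z.eq_dec p j1) => pj; [case: (Z.eq_dec q j2) => // qj | ].
    exfalso; apply: (@close j2 (I j1 + 1)); [lia | lia |].
    apply: (@tri_cut _ _ j1) => //; [lia | by apply: low; lia | by apply: free; lia | | by apply: tU; lia].
    by apply: lowtri; lia.
  exfalso; apply: (@close j2 (I j1 + 1)); [lia | lia |].
  apply: (@tri_cut _ _ j1) => //; [lia | by apply: low; lia | by apply: free; lia | | by apply: tU; lia].
  by apply: lowtri; lia.
have [[pJ qJ] Ipq] : (m + 3 <= p /\ q < n) /\ I p + 2 <= I q.
  have [[j1 j1r bad1]|good] := Zrange_dec (fun j1 => ~~ [forall j2 : 'I_(Z.to_nat n),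
      (j1 <? Z.of_nat j2) ==> (I (Z.of_nat j2) <=? I j1 + 1)]) (m + 3) n.
    move: bad1; rewrite negb_forall => /existsP[j2].
    rewrite negb_imply => /andP[/Z.ltb_spec0 j12 /Z.leb_spec0 I12].
    have j2n : (Z.of_nat j2 < n) by move/ltP: (ltn_ord j2); lia.
    by have [||p1 q1] := @bad j1 (Z.of_nat j2) _ j2n; [lia | lia | rewrite p1 q1; lia].
  exfalso; apply: (@no_minimum_inside n b m I P) => //; [lia | |].
    by move=> j jr; have [Ir /(_ (I j) Ir) bIj] := bI j jr; split=> //; apply/bIj.
  move=> j1 j2 j12 j2n; have := good j1 ltac:(lia); rewrite negbK => /forallP.
  have j2o : (Z.to_nat j2 < Z.to_nat n)%nat by apply/ltP; lia.
  move=> /(_ (Ordinal j2o)) /=; rewrite Z2Nat.id; last lia.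
  by move=> /implyP H; apply/Z.leb_spec0/H/Z.ltb_spec0; lia.
have [Ip _] := bI p ltac:(lia); have [Iq _] := bI q ltac:(lia).
have Ibetween j v : p < j < q -> I p < v < I q -> v = I j.
  move=> jr vr; case: (Z.eq_dec v (I j)) => // ne; exfalso.
  have [Ij _] := bI j ltac:(lia).
  apply: (@close q v); [lia | lia |].
  apply: (@tri_cut _ _ j) => //; [lia | by apply: low; lia | by apply: free; lia | | by apply: tU; lia].
  apply: (@tri_cut _ _ p) => //; [lia | by apply: low; lia | by apply: free; lia | | by apply: tU; lia].
  by apply: lowtri; lia.
(* If I q were larger, I p + 1 and I p + 2 would both equal I (p + 1). *)
have Iq2 : I q = I p + 2.
  by have := Ibetween (p + 1) (I p + 1); have := Ibetween (p + 1) (I p + 2); lia.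
apply: (@chords3_intro n b (I p + 1) m p (q - p) I P) => //; try lia.
- by rewrite Zplus_minus; lia.
- by move=> j jr; have := Ibetween j (I p + 1); lia.
- move=> j jr; have [Ij _] := bI j ltac:(lia).
  case: (Z_le_gt_dec (I p + 1) (I j)) => ?; first by lia.
  by have [|||? ?] := @bad j q; lia.
- move=> j jr; have [Ij _] := bI j ltac:(lia).
  case: (Z_le_gt_dec (I j) (I p + 1)) => ?; first by lia.
  by have [|||? ?] := @bad p j; lia.
- move=> j1 j2 r1 r2 j12; case: (Z_le_gt_dec (I j2) (I j1 + 1)) => // ?.
  by have [|||? ?] := @bad j1 j2; lia.
- move=> j1 j2 r1 r2 j12; case: (Z_le_gt_dec (I j2) (I j1 + 1)) => // ?.
  by have [|||? ?] := @bad j1 j2; lia.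
- move=> x j xr jr; have [Ij bIj] := bI j jr.
  case: (Z.eq_dec x 0) => [->|?].
    by rewrite b0; split; [move/ufree; lia | lia].
  case: (Z.eq_dec x (m + 2)) => [->|?]; first by split; [move/ufree; lia | lia].
  by apply: bIj; lia.
by move=> u w uw wn; split; [move/ufree; lia | case=> -> ->; have -> : p + (q - p) = q by lia].
Qed.

(** The bouquet with l = m + 1, k = m + 3 and k + t = r: its chord (k + t, l + 1) ends at the ear m
    + 2, so r is joined to two consecutive vertices outside the run and to no middle of it. *)
Lemma bouquet_at_right_end (n : Z) (b : Z -> Z -> bool) (m r : Z) (I : Z -> Z) : crit n b ->
  0 <= m -> (forall v, 1 <= v <= m + 1 -> mid b v) -> ~~ mid b (m + 2) ->
  m + 5 <= r < n -> b (m + 2) r -> b (m + 3) r ->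
  (forall u w, b u w -> m + 2 <= u < w -> w <= n -> (u = m + 2 \/ u = m + 3) /\ w = r) ->
  (forall x, 1 <= x <= m + 1 -> ~~ b x r) ->
  (forall j, m + 3 <= j < n -> j <> r -> 1 <= I j <= m + 1 /\
     forall x, 1 <= x <= m + 1 -> b x j <-> x = I j) ->
  chords3 n b.
Proof.
move=> P m0 mids earm rr br2 br3 ufree br bI; have n5 := crit_n P; have side := crit_side P.
have free u w : m + 2 <= u < w -> w <= n -> u > m + 3 \/ w <> r -> ~~ b u w.
  by move=> uw wn ne; apply/negP=> /ufree; lia.
have low x j : 1 <= x <= m + 1 -> m + 3 <= j < n -> j = r \/ x <> I j -> ~~ b x j.
  move=> xr jr; case: (Z.eq_dec j r) => [-> _|jnr [//|ne]]; first exact: br.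
  by apply/negP; case: (bI j jr jnr) => _ /(_ x xr); tauto.
have b0 y : b 0 y = b y n by exact: (crit_wrap0 y P).
have tU u w : m + 2 <= u < w -> w <= n -> tri b u w.
  move=> uw wn; case: (Z.eq_dec w r) => wr.
    by apply: tri_free_fanl => //; [lia | move=> y ?; apply: free; lia].
  by apply: tri_free_fanr => //; [lia | move=> x ?; apply: free; lia].
have close j v : m + 3 <= j < n -> 0 <= v <= m + 1 -> j = r \/ v < I j -> tri b v j -> False.
  move=> jr vr vI tvj; apply: (tri_close P tvj); [lia | lia | by move=> x ?; apply: low; lia |].
  by move=> y ?; rewrite b0; apply: free; lia.
have bm3 : ~~ b (m + 1) (m + 3) by move: earm; rewrite /mid; congr (~~ b _ _); lia.
have lowtri j v : m + 3 <= j < n -> j <> r -> I j < v <= m + 1 -> tri b v j.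
  move=> jr jnr vr; have [Ij _] := bI j jr jnr.
  apply: (@tri_fanr _ _ (m + 2)) => //; [by apply: tU; lia | lia |].
  by move=> x ?; case: (Z.eq_dec x (m + 2)) => ?; [apply: free; lia | apply: low; lia].
have Imid j : m + 3 < j < r -> I j = m + 1.
  move=> jr; have [Ij _] := bI j ltac:(lia) ltac:(lia).
  case: (Z.eq_dec (I j) (m + 1)) => // ne; exfalso.
  apply: (@close r (m + 1)); [lia | lia | lia |].
  apply: (@tri_cut _ _ j) => //; [lia | by apply: low; lia | by apply: free; lia | | by apply: tU; lia].
  by apply: lowtri; lia.
have Im3 : I (m + 3) = m.
  have [Ij bIj] := bI (m + 3) ltac:(lia) ltac:(lia).
  have ? : I (m + 3) <> m + 1.
    by move=> E; move/negP: bm3; apply; apply/bIj; lia.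
  case: (Z.eq_dec (I (m + 3)) m) => // ne; exfalso.
  have t1 : tri b m (m + 4).
    apply: (@tri_cut _ _ (m + 3)); [lia | by apply: low; lia | by apply: free; lia | |].
      by apply: lowtri; lia.
    by apply: tU; lia.
  have := Imid (m + 4) ltac:(lia) => ?.
  apply: (@close r m); [lia | lia | lia |].
  by apply: (@tri_cut _ _ (m + 4)) => //; [lia | by apply: low; lia | by apply: free; lia | by apply: tU; lia].
(* Since r has no neighbour in the run, the value l + 1 that the bouquet requires at r is
   inserted. *)
have [I' I'r I'I] : exists2 I' : Z -> Z, I' r = m + 2 & forall j, j <> r -> I' j = I j.
  exists (fun j => if j =? r then m + 2 else I j); first by rewrite Z.eqb_refl.
  by move=> j; case: Z.eqb_spec.
have dec j1 j2 : r < j1 < j2 -> j2 < n -> I j2 <= I j1 + 1.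
  move=> r1 r2; case: (Z_le_gt_dec (I j2) (I j1 + 1)) => // ?; exfalso.
  have [I1 _] := bI j1 ltac:(lia) ltac:(lia); have [I2 _] := bI j2 ltac:(lia) ltac:(lia).
  apply: (@close j2 (I j1 + 1)); [lia | lia | lia |].
  apply: (@tri_cut _ _ j1) => //; [lia | by apply: low; lia | by apply: free; lia | | by apply: tU; lia].
  by apply: lowtri; lia.
apply: (@chords3_intro n b (m + 1) m (m + 3) (r - m - 3) I' P) => //; try lia.
- by rewrite I'I; lia.
- by have -> : m + 3 + (r - m - 3) = r by [lia]; lia.
- by move=> j jr; rewrite I'I ?Imid //; lia.
- by move=> j jr; have := bI j; rewrite I'I; lia.
- by move=> j1 j2; lia.
- by move=> j1 j2 ? ? ?; rewrite !I'I; [apply: dec | |]; lia.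
- move=> x j xr jr; case: (Z.eq_dec j r) => [->|jnr].
    rewrite I'r; case: (Z.eq_dec x (m + 2)) => [->|?]; first by split.
    split; last by lia.
    case: (Z.eq_dec x 0) => [->|?]; first by rewrite b0 => /ufree; lia.
    by have /negP := br x ltac:(lia).
  rewrite I'I //; have [Ij bIj] := bI j jr jnr.
  case: (Z.eq_dec x 0) => [->|?]; first by rewrite b0; split; [move/ufree; lia | lia].
  case: (Z.eq_dec x (m + 2)) => [->|?]; first by split; [move/ufree; lia | lia].
  by apply: bIj; lia.
by move=> u w uw wn; split; [move/ufree; lia | case=> -> ->; have -> : m + 3 + (r - m - 3) = r by lia].
Qed.

(** The mirror image, with l = 1, k = r and k + t = n - 1: the chord (k, l - 1) ends at the ear 0,
    here read as n. *)
Lemma bouquet_at_left_end (n : Z) (b : Z -> Z -> bool) (m r : Z) (I : Z -> Z) : crit n b ->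
  0 <= m -> (forall v, 1 <= v <= m + 1 -> mid b v) -> ~~ mid b 0 ->
  m + 3 <= r <= n - 3 -> b r n -> b r (n - 1) ->
  (forall u w, b u w -> m + 2 <= u < w -> w <= n -> u = r /\ (w = n \/ w = n - 1)) ->
  (forall x, 1 <= x <= m + 1 -> ~~ b x r) ->
  (forall j, m + 3 <= j < n -> j <> r -> 1 <= I j <= m + 1 /\
     forall x, 1 <= x <= m + 1 -> b x j <-> x = I j) ->
  chords3 n b.
Proof.
move=> P m0 mids ear0 rr brn brn1 ufree br bI; have n5 := crit_n P; have side := crit_side P.
have free u w : m + 2 <= u < w -> w <= n -> u <> r \/ w < n - 1 -> ~~ b u w.
  by move=> uw wn ne; apply/negP=> /ufree; lia.
have low x j : 1 <= x <= m + 1 -> m + 3 <= j < n -> j = r \/ x <> I j -> ~~ b x j.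
  move=> xr jr; case: (Z.eq_dec j r) => [-> _|jnr [//|ne]]; first exact: br.
  by apply/negP; case: (bI j jr jnr) => _ /(_ x xr); tauto.
have b0 y : b 0 y = b y n by exact: (crit_wrap0 y P).
have tU u w : m + 2 <= u < w -> w <= n -> tri b u w.
  move=> uw wn; case: (Z.eq_dec u r) => ur.
    by apply: tri_free_fanr => //; [lia | move=> x ?; apply: free; lia].
  by apply: tri_free_fanl => //; [lia | move=> y ?; apply: free; lia].
have close j v : m + 3 <= j < n -> j <> r -> 0 <= v < I j -> tri b v j -> False.
  move=> jr jnr vI tvj; have [Ij _] := bI j jr jnr.
  case: (Z.eq_dec j (n - 1)) => jn1.
    by apply: (tri_close P tvj); [lia | lia | by move=> x ?; apply: low; lia | lia].
  have t0 : tri b 0 j by apply: (tri_fanr side tvj); [lia | move=> x ?; apply: low; lia].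
  apply: (@crit_blocked _ _ P 0).
  apply: (@tri_cut _ _ j) => //; [lia | by rewrite b0; apply: free; lia | by apply: free; lia |].
  by apply: tU; lia.
have lowtri j v : m + 3 <= j < n -> j = r \/ I j < v -> 1 <= v <= m + 1 -> tri b v j.
  move=> jr jnr vr; apply: (@tri_fanr _ _ (m + 2)) => //; [by apply: tU; lia | lia |].
  by move=> x ?; case: (Z.eq_dec x (m + 2)) => ?; [apply: free; lia | apply: low; lia].
have Imid j : r < j < n - 1 -> I j = 1.
  move=> jr; have [Ij _] := bI j ltac:(lia) ltac:(lia).
  case: (Z.eq_dec (I j) 1) => // ne; exfalso.
  apply: (@close j 1); [lia | lia | lia |].
  apply: (@tri_cut _ _ r) => //; [lia | by apply: low; lia | by apply: free; lia | | by apply: tU; lia].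
  by apply: lowtri; lia.
have In1 : I (n - 1) = 2.
  have [Ij bIj] := bI (n - 1) ltac:(lia) ltac:(lia).
  have ? : I (n - 1) <> 1.
    move=> E; move/negP: ear0; apply; rewrite /mid (crit_sym P).
    by rewrite -(@crit_per2 _ _ 0 1 (0 + 1) (0 - 1) 1 (n - 1) P); [apply/bIj | |]; lia.
  case: (Z.eq_dec (I (n - 1)) 2) => // ne; exfalso.
  have I2 := Imid (n - 2) ltac:(lia).
  apply: (@close (n - 1) 2); [lia | lia | lia |].
  apply: (@tri_cut _ _ (n - 2)) => //; [lia | by apply: low; lia | by apply: free; lia | | by apply: tU; lia].
  apply: (@tri_cut _ _ r) => //; [lia | by apply: low; lia | by apply: free; lia | | by apply: tU; lia].
  by apply: lowtri; lia.
have [I' I'r I'I] : exists2 I' : Z -> Z, I' r = 0 & forall j, j <> r -> I' j = I j.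
  exists (fun j => if j =? r then 0 else I j); first by rewrite Z.eqb_refl.
  by move=> j; case: Z.eqb_spec.
have dec j1 j2 : m + 3 <= j1 < j2 -> j2 < r -> I j2 <= I j1 + 1.
  move=> r1 r2; case: (Z_le_gt_dec (I j2) (I j1 + 1)) => // ?; exfalso.
  have [I1 _] := bI j1 ltac:(lia) ltac:(lia); have [I2 _] := bI j2 ltac:(lia) ltac:(lia).
  apply: (@close j2 (I j1 + 1)); [lia | lia | lia |].
  apply: (@tri_cut _ _ j1) => //; [lia | by apply: low; lia | by apply: free; lia | | by apply: tU; lia].
  by apply: lowtri; lia.
apply: (@chords3_intro n b 1 m r (n - 1 - r) I' P) => //; try lia.
- by have -> : r + (n - 1 - r) = n - 1 by [lia]; rewrite I'I; lia.
- by move=> j jr; rewrite I'I ?Imid //; lia.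
- by move=> j jr; have := bI j; rewrite I'I; lia.
- by move=> j1 j2 ? ? ?; rewrite !I'I; [apply: dec | |]; lia.
- by move=> j1 j2; lia.
- move=> x j xr jr; case: (Z.eq_dec j r) => [->|jnr].
    rewrite I'r; case: (Z.eq_dec x 0) => [->|?]; first by rewrite b0 brn.
    split; last by lia.
    case: (Z.eq_dec x (m + 2)) => [->|?]; first by move=> /ufree; lia.
    by have /negP := br x ltac:(lia).
  rewrite I'I //; have [Ij bIj] := bI j jr jnr.
  case: (Z.eq_dec x 0) => [->|?]; first by rewrite b0; split; [move/ufree; lia | lia].
  case: (Z.eq_dec x (m + 2)) => [->|?]; first by split; [move/ufree; lia | lia].
  by apply: bIj; lia.
by move=> u w uw wn; split; [move/ufree; lia | case=> -> ->; have -> : r + (n - 1 - r) = n - 1 by lia].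
Qed.

(** * Two pairs of consecutive vertices, completely joined *)

Definition nbrs2 (n : Z) (b : Z -> Z -> bool) (v y1 y2 : Z) : Prop :=
  [/\ v < y1 < y2, y2 < v + n, b v y1, b v y2 &
      forall y, b v y -> v < y < v + n -> y = y1 \/ y = y2].

Lemma chords3_shift (n : Z) (b : Z -> Z -> bool) (r : Z) :
  chords3 n (shift r b) -> chords3 n b.
Proof.
case=> r' [l [m [k [t [I [H1 H2 H3 H4 bE]]]]]]; exists (r' + r), l, m, k, t, I; split=> // x y xy yn.
by rewrite -bE // /shift !Z.add_assoc.
Qed.

Lemma nbrs2_left (n : Z) (b : Z -> Z -> bool) (v y1 y2 x : Z) : crit n b ->
  nbrs2 n b v y1 y2 -> b x v -> v - n < x < v -> x + n = y1 \/ x + n = y2.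
Proof.
move=> P [_ _ _ _ bv]; rewrite (crit_sym P) => bx xr; apply: bv; last by lia.
by rewrite (crit_sym P) (crit_per P) (crit_sym P).
Qed.

Lemma nbrs2_shift (n : Z) (b : Z -> Z -> bool) (r k v y1 y2 v' y1' y2' : Z) : crit n b ->
  nbrs2 n b v y1 y2 -> v' = v - r + k * n -> y1' = y1 - r + k * n -> y2' = y2 - r + k * n ->
  nbrs2 n (shift r b) v' y1' y2'.
Proof.
move=> P [v12 v2n b1 b2 bv] -> -> ->.
have bE y : shift r b (v - r + k * n) (y - r + k * n) = b v y.
  by rewrite /shift; apply: (@crit_per2 _ _ k k _ _ _ _ P); lia.
split; rewrite ?bE //; try lia.
move=> y; have Ey : y = (y + r - k * n) - r + k * n by lia.
by rewrite {1}Ey bE => /bv; lia.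
Qed.

(** The bouquet has l = 1, m = 0, k = 3 and k + t = n - 1, with centre 1. It remains to exclude
    chords among 4, ..., n - 2: one starting at an ear there would make it a second ear of degree
    two not joined to the ear 2. *)
Lemma bouquet_of_square2 (n : Z) (b : Z -> Z -> bool) : crit n b ->
  nbrs2 n b 0 2 3 -> nbrs2 n b 2 (n - 1) n -> nbrs2 n b 3 (n - 1) n ->
  nbrs2 n b (n - 1) (n + 2) (n + 3) -> (forall c, 4 <= c <= n - 2 -> b 1 c) ->
  chords3 n b.
Proof.
move=> P [_ _ b02 b03 N0] [_ _ b2n1 b2n N2] H3 Hn b1c; have [_ _ b3n1 b3n N3] := H3.
have n5 := crit_n P; have side := crit_side P.
have nn1 x : 1 <= x < n - 1 -> b x (n - 1) -> x = 2 \/ x = 3.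
  by move=> xr /(nbrs2_left P Hn); lia.
have noY u w : 4 <= u < w -> w <= n - 2 -> ~~ b u w.
  have noear u' w' : 4 <= u' < w' -> w' <= n - 2 -> ~~ mid b u' -> ~~ b u' w'.
    move=> uw wn earu; apply/negP=> buw.
    apply: (@two_ears_degree n b 2 u' (n - 1) n w' (n + 1) P) => //; try lia.
    - by apply/negP=> b13; have := nbrs2_left P H3 b13; lia.
    - by apply/negP=> /N2; lia.
    rewrite (crit_sym P) (@crit_per2 _ _ 1 0 1 u' _ _ P); [by apply: b1c; lia | lia | lia].
  have ears v : 4 <= v <= n - 2 -> 5 < n - 1 -> ~~ mid b v.
    move=> vr n6; apply/negP=> mv.
    have [|v0 v0r [mv0 fst]] := @Zfirst (mid b) 4 v _ mv; first lia.
    case: (Z.eq_dec v0 4) => v04.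
      by move: mv0; rewrite v04 /mid => /N3; lia.
    case: (Z.eq_dec v0 (n - 2)) => v0n.
      move: mv0; rewrite /mid v0n => bb; have := nn1 (n - 2 - 1) ltac:(lia).
      have E : n - 2 + 1 = n - 1 by lia.
      by rewrite E in bb => /(_ bb); lia.
    have := noear (v0 - 1) (v0 + 1) ltac:(lia) ltac:(lia) (fst (v0 - 1) ltac:(lia)).
    by move: mv0; rewrite /mid => ->.
  by move=> uw wn; apply: (noear u w uw wn); apply: (ears u); lia.
pose I j := if j =? 3 then 0 else if j =? n - 1 then 2 else 1.
have IE j : (j = 3 /\ I j = 0) \/ (j = n - 1 /\ j <> 3 /\ I j = 2) \/ (j <> 3 /\ j <> n - 1 /\ I j = 1).
  by rewrite /I; repeat case: Z.eqb_spec; lia.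
apply: (@chords3_intro n b 1 0 3 (n - 4) I P); try lia.
- move=> v vr; have -> : v = 1 by [lia]; exact: b02.
- by have := IE 3; lia.
- by have := IE (3 + (n - 4)); lia.
- by move=> j jr; have := IE j; lia.
- by move=> j1 j2; lia.
- by move=> j1 j2; lia.
- move=> x j xr jr; have := IE j; have [->|[->|->]] : x = 0 \/ x = 1 \/ x = 2 by lia.
  + case: (Z.eq_dec j 3) => [->|j3]; first by rewrite b03; split=> //; lia.
    by split; [move/N0; lia | lia].
  + move=> Ij; split=> [bb|?]; last by apply: b1c; lia.
    suff : j <> 3 /\ j <> n - 1 by lia.
    split=> E; rewrite E in bb; last by have := nn1 1 ltac:(lia) bb; lia.
    by have := nbrs2_left P H3 bb; lia.
  case: (Z.eq_dec j (n - 1)) => [->|jn]; first by rewrite b2n1; split=> //; lia.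
  by split; [move/N2; lia | lia].
move=> u w uw wn; have -> : 3 + (n - 4) = n - 1 by lia.
split=> [bb|[-> ->] //].
case: (Z.eq_dec u 3) => [E|u3]; first by move: bb; rewrite E => /N3; lia.
case: (Z.eq_dec w (n - 1)) => [E|wn1]; first by rewrite E in bb; have := nn1 u ltac:(lia) bb; lia.
by have := noY u w ltac:(lia) ltac:(lia); rewrite bb.
Qed.

(** The two arcs 1, ..., p - 1 and p + 2, ..., n - 2 are completely joined, as a missing chord (a,
    c) would allow a triangulation with the triangles (0, a, c) and (a, p, p + 1). If both arcs had
    two or more vertices, 1 and p would be ears of degree two that are not joined. *)
Lemma bouquet_of_square (n : Z) (b : Z -> Z -> bool) (p : Z) : crit n b -> 2 <= p <= n - 4 ->
  nbrs2 n b 0 p (p + 1) -> nbrs2 n b p (n - 1) n -> nbrs2 n b (p + 1) (n - 1) n ->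
  nbrs2 n b (n - 1) (n + p) (n + p + 1) -> chords3 n b.
Proof.
move=> P pr H0 Hp Hp1 Hn; have n5 := crit_n P; have side := crit_side P.
have [_ _ b0p b0p1 N0] := H0; have [_ _ bpn1 bpn Np] := Hp.
have [_ _ bp1n1 bp1n Np1] := Hp1.
have nn1 x : 1 <= x < n - 1 -> b x (n - 1) -> x = p \/ x = p + 1.
  by move=> xr /(nbrs2_left P Hn); lia.
have np x : 1 <= x < p -> ~~ b x p.
  by move=> xr; apply/negP=> /(nbrs2_left P Hp); lia.
have np1 x : 1 <= x < p -> ~~ b x (p + 1).
  by move=> xr; apply/negP=> /(nbrs2_left P Hp1); lia.
have grid a c : 1 <= a < p -> p + 1 < c < n - 1 -> b a c.
  move=> ar cr; apply/negPn/negP=> nac; apply: (@crit_blocked _ _ P 0).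
  have tap : tri b a p by apply: tri_free_fanr => //; [lia | move=> x ?; apply: np; lia].
  have tap1 : tri b a (p + 1).
    apply: (@tri_cut _ _ p) => //; [lia | by apply: np; lia | exact: tri_side].
  have tac : tri b a c.
    apply: (@tri_cut _ _ (p + 1)) => //; [lia | by apply: np1; lia | by apply/negP=> /Np1; lia |].
    by apply: tri_free_fanl => //; [lia | move=> y ?; apply/negP=> /Np1; lia].
  have t0c : tri b 0 c.
    apply: (@tri_cut _ _ a) => //; [lia | by apply/negP=> /N0; lia |].
    by apply: tri_free_fanl => //; [lia | move=> y ?; apply/negP=> /N0; lia].
  apply: (@tri_cut _ _ c) => //; [lia | by apply/negP=> /N0; lia | by apply/negP=> /nn1; lia |].
  by apply: tri_free_fanr => //; [lia | move=> y ?; apply/negP=> /nn1; lia].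
case: (Z.eq_dec p 2) => [p2|p2].
  subst p; apply: (bouquet_of_square2 P H0 Hp Hp1) => [|c cr]; last by apply: grid; lia.
  by rewrite (_ : n + 3 = n + 2 + 1); [exact: Hn | lia].
case: (Z.eq_dec p (n - 4)) => [pn|pn].
  apply: (@chords3_shift n b (p + 1)).
  apply: bouquet_of_square2 (crit_shift (p + 1) P) _ _ _ _ _.
  - by apply: (nbrs2_shift (k := 0) P Hp1); lia.
  - by apply: (nbrs2_shift (k := 0) P Hn); lia.
  - by apply: (nbrs2_shift (k := 1) P H0); lia.
  - by apply: (nbrs2_shift (k := 1) P Hp); lia.
  move=> c cr; rewrite /shift (crit_sym P) (@crit_per2 _ _ 1 0 (c + p + 1 - n) (p + 2) _ _ P); try lia.
  by apply: grid; lia.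
exfalso; apply: (@two_ears_degree n b 1 p (p + 2) (p + 3) (n - 1) n P) => //; try lia.
- by apply/negP=> /N0; lia.
- by apply: np1; lia.
- by apply: np; lia.
- by apply: grid; lia.
by apply: grid; lia.
Qed.

(** * Ears of degree one and two *)

Definition nbrs1 (n : Z) (b : Z -> Z -> bool) (v y1 : Z) : Prop :=
  [/\ v < y1 < v + n, b v y1 & forall y, b v y -> v < y < v + n -> y = y1].

Lemma nbrs1_left (n : Z) (b : Z -> Z -> bool) (v y1 x : Z) : crit n b ->
  nbrs1 n b v y1 -> b x v -> v - n < x < v -> x + n = y1.
Proof.
move=> P [_ _ bv]; rewrite (crit_sym P) => bx xr; apply: bv; last by lia.
by rewrite (crit_sym P) (crit_per P) (crit_sym P).
Qed.

Lemma nbrs1_shift (n : Z) (b : Z -> Z -> bool) (r k v y1 v' y1' : Z) : crit n b ->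
  nbrs1 n b v y1 -> v' = v - r + k * n -> y1' = y1 - r + k * n ->
  nbrs1 n (shift r b) v' y1'.
Proof.
move=> P [v12 b1 bv] -> ->.
have bE y : shift r b (v - r + k * n) (y - r + k * n) = b v y.
  by rewrite /shift; apply: (@crit_per2 _ _ k k _ _ _ _ P); lia.
split; rewrite ?bE //; try lia.
move=> y; have Ey : y = (y + r - k * n) - r + k * n by lia.
by rewrite {1}Ey bE => /bv; lia.
Qed.

Lemma nbrs1_mid (n : Z) (b : Z -> Z -> bool) (v y1 : Z) : crit n b ->
  nbrs1 n b v y1 -> mid b y1.
Proof.
move=> P [v12 b1 bv]; apply: (@one_spoke n b v y1 P).
  exact: (chord_range P v12 b1).
by move=> y yr /bv; lia.
Qed.

Lemma ear_cases (n : Z) (b : Z -> Z -> bool) (v : Z) : crit n b -> ~~ mid b v ->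
  (exists y1, nbrs1 n b v y1) \/ (exists y1 y2, nbrs2 n b v y1 y2).
Proof.
move=> P ear; have [y yr bvy] := vertex_meets v P.
have [|y1 y1r [b1 fst1]] := @Zfirst (b v) (v + 1) y _ bvy; first lia.
have least z : b v z -> v < z -> y1 <= z.
  move=> bz vz; case: (Z_le_gt_dec y1 z) => // ?.
  by have := fst1 z ltac:(lia); rewrite bz.
have [[y2 y2r b2]|none] := Zrange_dec (b v) (y1 + 1) (v + n); last first.
  left; exists y1; split=> // [|z bz zr]; first lia.
  have := least z bz ltac:(lia); case: (Z.eq_dec z y1) => // ? ?.
  by have := none z ltac:(lia); rewrite bz.
right; exists y1, y2; split=> //; try lia.
move=> z bz zr; have ? := least z bz ltac:(lia).
case: (Z.lt_total z y2) => [z2|[->|z2]]; [|by right|].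
  case: (Z.eq_dec z y1) => [->|?]; first by left.
  by case: (@ear_degree n b v y1 z y2 P ear) => //; lia.
by case: (@ear_degree n b v y1 y2 z P ear) => //; lia.
Qed.

(** This is [two_ears_degree] once the neighbours of w are moved into the window between u and u +
    n. *)
Lemma degree_two_ears_linked (n : Z) (b : Z -> Z -> bool) (u w x1 x2 y1 y2 : Z) : crit n b ->
  ~~ mid b u -> ~~ mid b w -> u + 2 <= w <= u + n - 2 ->
  nbrs2 n b u x1 x2 -> nbrs2 n b w y1 y2 -> b u w.
Proof.
move=> P eu ew uw [x12 xn bx1 bx2 _] [y12 yn by1 by2 _].
apply/negPn/negP=> nb.
have bw y : b w (y - n) = b w y by apply: (@crit_per2 _ _ 0 (-1) _ _ _ _ P); lia.
have nyu y : b w y -> y <> u + n.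
  by move=> bwy E; case/negP: nb; rewrite (crit_sym P) -(@crit_per2 _ _ 0 1 w u w y P) //; lia.
have n1 := nyu _ by1; have n2 := nyu _ by2.
case: (Z_le_gt_dec y1 (u + n)) => h1; case: (Z_le_gt_dec y2 (u + n)) => h2; try lia.
- by apply: (@two_ears_degree n b u w x1 x2 y1 y2 P) => //; lia.
- by apply: (@two_ears_degree n b u w x1 x2 (y2 - n) y1 P) => //; rewrite ?bw //; lia.
by apply: (@two_ears_degree n b u w x1 x2 (y1 - n) (y2 - n) P) => //; rewrite ?bw //; lia.
Qed.

(** When no label fits, [find] yields an index out of range; nothing is claimed for such j. *)
Lemma label_function (n : Z) (Q : Z -> Z -> bool) : exists I : Z -> Z, forall j x : Z,
  0 <= x < n -> Q x j -> 0 <= I j < n /\ Q (I j) j.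
Proof.
exists (fun j => Z.of_nat (find (fun i => Q (Z.of_nat i) j) (iota 0 (Z.to_nat n)))) => j x xn Qx.
set q := fun i : nat => _; set s := iota _ _.
have hq : has q s.
  apply/hasP; exists (Z.to_nat x); last by rewrite /q Z2Nat.id //; lia.
  by rewrite mem_iota add0n; apply/andP; split=> //; apply/ltP; lia.
have := nth_find 0%N hq; move: hq; rewrite has_find size_iota => /ltP lt.
rewrite nth_iota ?add0n; last by apply/ltP.
by split=> //; lia.
Qed.

(** A jump of two or more from j1 to j2 would allow the zigzag through the triangle (I j1 + 1, j1,
    j2). *)
Lemma falling_of_independent (n : Z) (b : Z -> Z -> bool) (m : Z) (I : Z -> Z) : crit n b ->
  0 <= m -> (forall u w, m + 2 <= u < w -> w <= n -> ~~ b u w) ->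
  (forall j, m + 3 <= j < n -> 1 <= I j <= m + 1) ->
  (forall x j, 1 <= x <= m + 1 -> m + 3 <= j < n -> b x j -> x = I j) ->
  falling I (fun j => m + 3 <= j < n).
Proof.
move=> P m0 free Ir bI j1 j2 r1 r2 j12; have side := crit_side P.
case: (Z_le_gt_dec (I j2) (I j1 + 1)) => // I12; exfalso.
have low x j : 1 <= x <= m + 1 -> m + 3 <= j < n -> x <> I j -> ~~ b x j.
  by move=> xr jr ne; apply/negP=> /(bI x j xr jr).
have tU u w : m + 2 <= u < w -> w <= n -> tri b u w.
  by move=> uw wn; apply: tri_free_fanl => //; [lia | move=> y ?; apply: free; lia].
have I1 := Ir j1 r1; have I2 := Ir j2 r2.
have t1 : tri b (I j1 + 1) j1.
  apply: (@tri_fanr _ _ (m + 2)) => //; [by apply: tU; lia | lia |].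
  by move=> x ?; case: (Z.eq_dec x (m + 2)) => ?; [apply: free; lia | apply: low; lia].
have t2 : tri b (I j1 + 1) j2.
  by apply: (@tri_cut _ _ j1) => //; [lia | apply: low; lia | apply: free; lia | apply: tU; lia].
apply: (tri_close P t2); [lia | lia | by move=> x ?; apply: low; lia |].
by move=> y ?; rewrite (crit_wrap0 y P); apply: free; lia.
Qed.

(** * Chords passing over one or two ears *)

(** If p is the only ear of t below (u, w), the chords of t there are nested around p, so the one
    just outside (p - 1, p + 1) has length three. *)
Lemma apex_ear_near (n : Z) (t : Z -> Z -> bool) (p u w : Z) : apex_closed n t ->
  u < p < w -> u + 4 <= w < u + n -> t u w ->
  [\/ exists v, [/\ u < v < w, v <> p & t (v - 1) (v + 1)],
     [/\ u <= p - 2, p + 1 <= w & t (p - 2) (p + 1)] |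
     [/\ u <= p - 1, p + 2 <= w & t (p - 1) (p + 2)]].
Proof.
move=> tc; have [d def_d] : exists d : nat, w - u <= Z.of_nat d by exists (Z.to_nat (w - u)); lia.
elim: d u w def_d => [|d IH] u w def_d pr uw tuw; first lia.
have [||c [cr tuc tcw]] := tc u w; [lia | by left |].
have ear x y : u <= x -> y <= w -> x + 2 <= y -> (x < p < y -> False) -> t x y ->
    exists v, [/\ u < v < w, v <> p & t (v - 1) (v + 1)].
  move=> ux yw xy np txy; have [|v vr tv] := apex_ear tc (u := x) (v := y) _ txy; first by lia.
  by exists v; split=> //; [lia | move=> E; apply: np; lia].
have tl : u + 2 <= c -> t u c by case: tuc => // ?; lia.
have tr : c + 2 <= w -> t c w by case: tcw => // ?; lia.
case: (Z.lt_total c p) => [cp|[cp|cp]].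
- case: (Z_le_gt_dec (u + 2) c) => uc; first by apply: Or31; apply: (ear u c) (tl uc); lia.
  have {}tr : t c w by apply: tr; lia.
  case: (Z_le_gt_dec (c + 4) w) => cw.
    have [[v [? ? ?]]|[? ? ?]|[? ? ?]] := IH c w ltac:(lia) ltac:(lia) ltac:(lia) tr.
    + by apply: Or31; exists v; split=> //; lia.
    + by apply: Or32; split=> //; lia.
    by apply: Or33; split=> //; lia.
  case: (Z.eq_dec c (p - 2)) => cE.
    by apply: Or32; split; [lia | lia | have <- : c = p - 2 by [lia]; have <- : w = p + 1 by lia].
  by apply: Or33; split; [lia | lia | have <- : c = p - 1 by [lia]; have <- : w = p + 2 by lia].
- apply: Or31; case: (Z_le_gt_dec (u + 2) c) => uc.
    by apply: (ear u c) (tl uc); lia.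
  by apply: (ear c w); [lia | lia | lia | lia | apply: tr; lia].
case: (Z_le_gt_dec (c + 2) w) => cw; first by apply: Or31; apply: (ear c w) (tr cw); lia.
have {}tl : t u c by apply: tl; lia.
case: (Z_le_gt_dec (u + 4) c) => uc.
  have [[v [? ? ?]]|[? ? ?]|[? ? ?]] := IH u c ltac:(lia) ltac:(lia) ltac:(lia) tl.
  + by apply: Or31; exists v; split=> //; lia.
  + by apply: Or32; split=> //; lia.
  by apply: Or33; split=> //; lia.
case: (Z.eq_dec c (p + 2)) => cE.
  by apply: Or33; split; [lia | lia | have <- : u = p - 1 by [lia]; have <- : c = p + 2 by lia].
by apply: Or32; split; [lia | lia | have <- : u = p - 2 by [lia]; have <- : c = p + 1 by lia].
Qed.

(** Any triangulation containing (x, y) has below it the short diagonal of a middle or a chord of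
    length three around p, a second chord of b. *)
Lemma no_chord_over_one_ear (n : Z) (b : Z -> Z -> bool) (x p y : Z) : crit n b ->
  x < p < y -> x + 4 <= y < x + n -> (forall v, x < v < y -> v <> p -> mid b v) ->
  b (p - 2) (p + 1) -> b (p - 1) (p + 2) -> ~~ b x y.
Proof.
move=> P pr xy mids b1 b2; apply/negP=> bxy.
have [|t [tc txy tu]] := crit_sat P (x := x) (y := y) _ bxy; first by lia.
have no u v : x <= u < v -> v <= y -> v < u + 4 -> b u v -> t u v -> False.
  by move=> ? ? ? buv tuv; have [] := tu x u v _ _ _ _ buv tuv; lia.
have [[v [vr vp tv]]|[? ? tp]|[? ? tp]] := apex_ear_near tc pr xy txy.
- by apply: (no (v - 1) (v + 1)) (mids v vr vp) tv; lia.
- by apply: (no (p - 2) (p + 1)) b1 tp; lia.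
by apply: (no (p - 1) (p + 2)) b2 tp; lia.
Qed.

(** Descending through the triangles below (x, y) ends at the short diagonal of a middle or at one
    of the three given chords of length three. *)
Lemma no_chord_over_two_ears (n : Z) (b : Z -> Z -> bool) (x p y : Z) : crit n b ->
  x <= p - 1 -> p + 2 <= y -> x + 4 <= y < x + n ->
  (forall v, x < v < y -> v <> p -> v <> p + 1 -> mid b v) ->
  b (p - 2) (p + 1) -> b (p - 1) (p + 2) -> b p (p + 3) -> ~~ b x y.
Proof.
move=> P xp py xy mids b1 b2 b3; apply/negP=> bxy.
have [|t [tc txy tu]] := crit_sat P (x := x) (y := y) _ bxy; first by lia.
have no u v u' v' : u = u' -> v = v' -> x <= u < v -> v <= y -> v < u + 4 -> b u v -> t u' v' -> False.
  by move=> <- <- ? ? ? buv tuv; have [] := tu x u v _ _ _ _ buv tuv; lia.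
have noear u v : x <= u -> v <= y -> u + 2 <= v -> v <= p \/ p + 1 <= u -> t u v -> False.
  move=> ? ? uv pr tuv; have [|w wr tw] := apex_ear tc (u := u) (v := v) _ tuv; first by lia.
  by apply: (no (w - 1) (w + 1)) (mids w _ _ _) tw; lia.
(* [p + p + 1 - q] is the other of the two ears; it is not below (u, w), so the case of one ear
   applies. *)
have near1 q u w : q = p \/ q = p + 1 -> x <= u < q -> q < w <= y -> u + 4 <= w ->
    (u < p + p + 1 - q < w -> False) -> t u w -> False.
  move=> qE ur wr uw other tuw.
  have [[v [vr vq tv]]|[? ? tq]|[? ? tq]] := apex_ear_near tc (p := q) (u := u) (w := w)
      ltac:(lia) ltac:(lia) tuw.
  - by apply: (no (v - 1) (v + 1)) (mids v _ _ _) tv; lia.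
  - by case: qE => qE; [apply: no b1 tq | apply: no b2 tq]; lia.
  by case: qE => qE; [apply: no b2 tq | apply: no b3 tq]; lia.
have main (d : nat) u w : w - u <= Z.of_nat d -> x <= u <= p - 1 -> p + 2 <= w <= y ->
    u + 4 <= w -> t u w -> False.
  elim: d u w => [|d IH] u w def_d ur wr uw tuw; first lia.
  have [||c [cr tuc tcw]] := tc u w; [lia | by left |].
  have tl : u + 2 <= c -> t u c by case: tuc => // ?; lia.
  have tr : c + 2 <= w -> t c w by case: tcw => // ?; lia.
  case: (Z_le_gt_dec c (p - 1)) => c1.
    case: (Z_le_gt_dec (u + 2) c) => uc; first by apply: (noear u c) (tl uc); lia.
    have {}tr : t c w by apply: tr; lia.
    case: (Z_le_gt_dec (c + 4) w) => cw; first by apply: (IH c w) tr; lia.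
    by apply: (no (p - 1) (p + 2)) b2 tr; lia.
  case: (Z_le_gt_dec (p + 2) c) => c2.
    case: (Z_le_gt_dec (c + 2) w) => cw; first by apply: (noear c w) (tr cw); lia.
    have {}tl : t u c by apply: tl; lia.
    case: (Z_le_gt_dec (u + 4) c) => uc; first by apply: (IH u c) tl; lia.
    by apply: (no (p - 1) (p + 2)) b2 tl; lia.
  case: (Z.eq_dec c p) => cp.
    case: (Z_le_gt_dec (u + 2) c) => uc; first by apply: (noear u c) (tl uc); lia.
    have {}tr : t c w by apply: tr; lia.
    case: (Z_le_gt_dec (c + 4) w) => cw; first by apply: (near1 (p + 1) c w) tr; lia.
    by apply: (no p (p + 3)) b3 tr; lia.
  case: (Z_le_gt_dec (c + 2) w) => cw; first by apply: (noear c w) (tr cw); lia.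
  have {}tl : t u c by apply: tl; lia.
  case: (Z_le_gt_dec (u + 4) c) => uc; first by apply: (near1 p u c) tl; lia.
  by apply: (no (p - 2) (p + 1)) b1 tl; lia.
by apply: (main (Z.to_nat n) x y) txy; lia.
Qed.

(** * Blockers without joined ears *)

Definition unlinked (n : Z) (b : Z -> Z -> bool) : Prop :=
  forall u w, u < w < u + n -> b u w -> mid b u \/ mid b w.

Lemma mid_at (b : Z -> Z -> bool) (x v y : Z) : x = v - 1 -> y = v + 1 -> mid b v = b x y.
Proof. by move=> -> ->. Qed.

(** If (p - 2, p + 1) is absent, the count for the adjacent vertices p - 1 and p leaves p - 1 only
    the neighbour p - 3, and the fans at p - 1 and e form a triangulation. For (p - 1, p + 2) the
    fans at p + 1 and 0 do the same. *)
Lemma two_runs_one_ear (n : Z) (b : Z -> Z -> bool) (p e : Z) (I : Z -> Z) : crit n b ->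
  3 <= p -> p + 3 <= e <= n - 1 -> ~~ mid b p ->
  (forall v, 1 <= v < e -> v <> p -> mid b v) ->
  nbrs1 n b 0 2 -> nbrs1 n b e (e - 2 + n) -> nbrs2 n b p (p + 2) (p - 2 + n) ->
  (forall u w, e <= u < w -> w <= n -> ~~ b u w) ->
  (forall x j, 1 <= x <= e - 1 -> e + 1 <= j < n -> b x j <-> x = I j) ->
  (forall j, e + 1 <= j < n -> 1 <= I j <= e - 1 /\ I j <> p) ->
  chords1 n b.
Proof.
move=> P p3 er earp mids N0 Ne Np free bI Ir; have n5 := crit_n P; have side := crit_side P.
have [_ b02 n0] := N0; have [_ be ne] := Ne; have [_ _ bp1 bp2 np] := Np.
have sidep : ~~ b (p - 1) (p + 1) by exact: earp.
have wrap x y := crit_wrap x y P.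
have b1 : b (p - 2) (p + 1).
  apply/negPn/negP=> nb.
  have bm : b (p - 1) (p - 3 + n).
    by rewrite -wrap -(@mid_at _ _ (p - 2)); [apply: mids | |]; lia.
  have free1 z : p <= z < p - 3 + n -> ~~ b (p - 1) z.
    move=> zr; apply/negP=> bz.
    have zp : z <> p by move=> E; move: bz; rewrite E; apply/negP/(chordfree_at side); lia.
    apply: (@adjacent_ears_degree n b (p - 1) z (p - 3 + n) (p + 2) (p - 2 + n) P) => //; try lia.
    + by move: nb; congr (~~ b _ _); lia.
    + by apply/orP; right; rewrite Z.sub_add.
    + by rewrite Z.sub_add.
    by rewrite Z.sub_add.
  apply: (@crit_blocked _ _ P (p - 1)).
  have t1 : tri b (p - 1) (p + 1) by apply: tri_ear => //; lia.
  have t2 : tri b (p - 1) e by apply: (tri_fanl side t1); [lia | move=> z ?; apply: free1; lia].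
  apply: (@tri_cut _ _ e) => //; [lia | by apply: free1; lia | by apply/negP=> /ne; lia |].
  by apply: tri_free_fanl => //; [lia | move=> z ?; apply/negP=> /ne; lia].
have b2 : b (p - 1) (p + 2).
  apply/negPn/negP=> nb.
  have bm : b (p + 1) (p + 3) by rewrite -(@mid_at _ _ (p + 2)); [apply: mids | |]; lia.
  have free1 z : p + 3 < z < p + 1 + n -> ~~ b (p + 1) z.
    move=> zr; apply/negP=> bz.
    apply: (@adjacent_ears_degree n b p (p + 2) (p - 2 + n) (p + 3) z P) => //; try lia.
    by apply/orP; left.
  have t1 : tri b (p - 1) (p + 1) by apply: tri_ear => //; lia.
  have t0 : tri b 0 (p + 1).
    by apply: (tri_fanr side t1); [lia | move=> x ?; rewrite wrap; apply: free1; lia].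
  by apply: (tri_close P t0); [lia | lia | lia | move=> y ?; apply/negP=> /n0; lia].
exists 0, (e - 2), p, I; split; try lia.
- by move=> j jr; have := Ir j; lia.
- apply: (@falling_of_independent n b (e - 2) I P); try lia.
  + by move=> u w ? ?; apply: free; lia.
  + by move=> j jr; have := Ir j; lia.
  by move=> x j xr jr bxj; apply/bI => //; lia.
move=> x y xy yn; rewrite /shift !Z.add_0_r.
have shorts v : 0 <= v -> v + 1 < e -> v + 1 <> p -> b v (v + 2).
  by move=> ? ? ?; have := mids (v + 1) ltac:(lia) ltac:(lia); rewrite (@mid_at _ v _ (v + 2)) //; lia.
split=> [bxy|].
  case: (Z_le_gt_dec y e) => ye; last first.
    have xe : x < e.
      by case: (Z_lt_ge_dec x e) => // ?; have := free x y ltac:(lia) ltac:(lia); rewrite bxy.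
    have x0 : x <> 0 by move=> E; move: bxy; rewrite E => /n0; lia.
    by have [/(_ bxy)] := bI x y ltac:(lia) ltac:(lia); lia.
  have xy1 : y <> x + 1 by move=> E; have := side x; rewrite -E bxy.
  case: (Z.eq_dec x 0) => [x0|x0]; first by move: bxy; rewrite x0 => /n0; lia.
  case: (Z.eq_dec y e) => [E|ne']; first by rewrite E in bxy; have := nbrs1_left P Ne bxy; lia.
  case: (Z.eq_dec x p) => [E|xp]; first by move: bxy; rewrite E => /np; lia.
  case: (Z.eq_dec y p) => [E|yp]; first by rewrite E in bxy; have := nbrs2_left P Np bxy; lia.
  case: (Z.eq_dec y (x + 2)) => [E|xy2].
    suff : x <> p - 1 by lia.
    by move=> E'; move: sidep; have <- : y = p + 1 by [lia]; rewrite -E' bxy.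
  have pin : x < p < y.
    case: (Z_le_gt_dec p x) => ?; [|case: (Z_le_gt_dec y p) => ?; last by lia];
    by have := @no_chord_over_mids n b x y P; rewrite bxy; move=> H; exfalso;
       have : ~~ true by [apply: H; [lia | move=> v ?; apply: mids; lia]].
  case: (Z_le_gt_dec (x + 4) y) => xy4; last by lia.
  by have := no_chord_over_one_ear P pin ltac:(lia) (fun v vr => mids v ltac:(lia)) b1 b2; rewrite bxy.
case=> [[-> [?|?]]|[[-> ->]|[[-> ->]|[? ->]]]] //.
- by apply: shorts; lia.
- case: (Z.eq_dec x p) => [->|?]; first by [].
  by apply: shorts; lia.
by apply/bI => //; [have := Ir y; lia | lia].
Qed.

(** The three chords of length three follow from counting alone: (p - 1, p + 2) from the two ears,
    and then the other two because p - 1 and p + 2 now have two chords each. *)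
Lemma two_runs_two_ears (n : Z) (b : Z -> Z -> bool) (p e x1 x2 y1 y2 : Z) (I : Z -> Z) : crit n b ->
  3 <= p -> p + 4 <= e <= n - 1 -> ~~ mid b p -> ~~ mid b (p + 1) ->
  (forall v, 1 <= v < e -> v <> p -> v <> p + 1 -> mid b v) ->
  nbrs1 n b 0 2 -> nbrs1 n b e (e - 2 + n) ->
  nbrs2 n b p x1 x2 -> nbrs2 n b (p + 1) y1 y2 ->
  (forall u w, e <= u < w -> w <= n -> ~~ b u w) ->
  (forall x j, 1 <= x <= e - 1 -> e + 1 <= j < n -> b x j <-> x = I j) ->
  (forall j, e + 1 <= j < n -> 1 <= I j <= e - 1 /\ I j <> p /\ I j <> p + 1) ->
  chords2 n b.
Proof.
move=> P p3 er earp earq mids N0 Ne Np Nq free bI Ir; have n5 := crit_n P; have side := crit_side P.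
have [_ b02 n0] := N0; have [_ be ne] := Ne.
have [x12 x2n bx1 bx2 np] := Np; have [y12 y2n by1 by2 nq] := Nq.
have wrap x y := crit_wrap x y P.
have mid1 v : 1 <= v < e -> v <> p -> v <> p + 1 -> b (v - 1) (v + 1) by exact: mids.
have mid2 v w : v = w - 2 -> 0 <= v -> w <= e -> w <> p + 1 -> w <> p + 2 -> b v w.
  by move=> E ? ? ? ?; have := mid1 (v + 1) ltac:(lia) ltac:(lia) ltac:(lia); congr (b _ _); lia.
have b2 : b (p - 1) (p + 2).
  apply/negPn/negP=> nb.
  by apply: (@adjacent_ears_degree n b p x1 x2 y1 y2 P) => //; try lia; apply/orP; left.
have b1 : b (p - 2) (p + 1).
  apply/negPn/negP=> nb.
  apply: (@adjacent_ears_degree n b (p - 1) (p + 2) (p - 3 + n) x1 x2 P) => //; rewrite ?Z.sub_add //; try lia.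
  - by move: nb; congr (~~ b _ _); lia.
  - by apply/orP; right.
  by rewrite -wrap; apply: mid2; lia.
have b3 : b p (p + 3).
  apply/negPn/negP=> nb.
  apply: (@adjacent_ears_degree n b (p + 1) y1 y2 (p + 4) (p - 1 + n) P) => //; try lia.
  - by move: nb; congr (~~ b _ _); lia.
  - by apply/orP; left.
  - by apply: mid2; lia.
  by rewrite -wrap; move: b2; congr (b _ _); lia.
have np' y : b p y -> p < y < p + n -> y = p + 3 \/ y = p - 2 + n.
  have H3 := np _ b3 ltac:(lia).
  have H2 : p - 2 + n = x1 \/ p - 2 + n = x2 by apply: np; [rewrite -wrap; apply: mid2; lia | lia].
  by move=> /np; lia.
have nq' y : b (p + 1) y -> p + 1 < y < p + 1 + n -> y = p + 3 \/ y = p - 2 + n.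
  have H3 : p + 3 = y1 \/ p + 3 = y2 by apply: nq; [apply: mid2; lia | lia].
  have H2 : p - 2 + n = y1 \/ p - 2 + n = y2 by apply: nq; [rewrite -wrap | lia].
  by move=> /nq; lia.
exists 0, (e - 2), p, I; split; try lia.
- by move=> j jr; have := Ir j; lia.
- apply: (@falling_of_independent n b (e - 2) I P); try lia.
  + by move=> u w ? ?; apply: free; lia.
  + by move=> j jr; have := Ir j; lia.
  by move=> x j xr jr bxj; apply/bI => //; lia.
move=> x y xy yn; rewrite /shift !Z.add_0_r.
split=> [bxy|].
  case: (Z_le_gt_dec y e) => ye; last first.
    have xe : x < e.
      by case: (Z_lt_ge_dec x e) => // ?; have := free x y ltac:(lia) ltac:(lia); rewrite bxy.
    have x0 : x <> 0 by move=> E; move: bxy; rewrite E => /n0; lia.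
    by have [/(_ bxy)] := bI x y ltac:(lia) ltac:(lia); lia.
  have xy1 : y <> x + 1 by move=> E; have := side x; rewrite -E bxy.
  case: (Z.eq_dec x 0) => [x0|x0]; first by move: bxy; rewrite x0 => /n0; lia.
  case: (Z.eq_dec y e) => [E|ne']; first by rewrite E in bxy; have := nbrs1_left P Ne bxy; lia.
  case: (Z.eq_dec x p) => [E|xp]; first by move: bxy; rewrite E => /np'; lia.
  case: (Z.eq_dec x (p + 1)) => [E|xq]; first by move: bxy; rewrite E => /nq'; lia.
  case: (Z.eq_dec y p) => [E|yp]; first by move: bxy; rewrite wrap E => /np'; lia.
  case: (Z.eq_dec y (p + 1)) => [E|yq]; first by move: bxy; rewrite wrap E => /nq'; lia.
  case: (Z.eq_dec y (x + 2)) => [E|xy2]; first by lia.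
  have pin : x <= p - 1 /\ p + 2 <= y.
    case: (Z_le_gt_dec p x) => ?; [|case: (Z_le_gt_dec y p) => ?; last by lia];
    by have := @no_chord_over_mids n b x y P; rewrite bxy; move=> H; exfalso;
       have : ~~ true by [apply: H; [lia | move=> v ?; apply: mids; lia]].
  case: (Z_le_gt_dec (x + 4) y) => xy4; last by lia.
  have := @no_chord_over_two_ears n b x p y P; rewrite bxy => H; exfalso.
  by have : ~~ true by [apply: H => //; try lia; move=> v ? ? ?; apply: mids; lia].
case=> [[-> [?|?]]|[[-> ->]|[[-> ->]|[[-> ->]|[? ->]]]]] //.
- by apply: mid2; lia.
- case: (Z.eq_dec x (p + 1)) => [->|?]; first by apply: mid2; lia.
  by apply: mid2; lia.
by apply/bI => //; [have := Ir y; lia | lia].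
Qed.

(** As 0 precedes a run and has degree one, every other ear preceding a run has degree two. Two of
    these would be joined, so exactly one further run exists, from q + 1 to e - 1. The ear e has
    degree one, hence the end e1 of the first run has degree two; not being joined to q, it is q or
    q - 1. *)
Lemma two_runs (n : Z) (b : Z -> Z -> bool) : crit n b -> unlinked n b ->
  ~~ mid b 0 -> mid b 1 -> nbrs1 n b 0 2 -> chords1 n b \/ chords2 n b.
Proof.
move=> P unl ear0 mid1 N0; have n5 := crit_n P; have side := crit_side P.
have [_ b02 n0] := N0.
have wrap x y := crit_wrap x y P.
have midn k v : mid b (v + k * n) = mid b v by apply: (mid_per P).
have earn : ~~ mid b n by rewrite -(midn 1 0) in ear0; rewrite -[n]Z.mul_1_l.
have link u w : ~~ mid b u -> ~~ mid b w -> u < w < u + n -> ~~ b u w.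
  by move=> /negP ? /negP ? uw; apply/negP=> /(unl u w uw); tauto.
(* The short diagonal of a middle between two ears would join these ears, so every run has length at
   least two. *)
have singleton v : mid b v -> ~~ mid b (v - 1) -> mid b (v + 1).
  move=> mv e1; apply/negPn/negP=> e2; have := link _ _ e1 e2 ltac:(lia).
  by move: mv; rewrite /mid => ->.
have Zfirst_ear a : a <= n -> exists2 k, a <= k <= n & ~~ mid b k /\ forall j, a <= j < k -> mid b j.
  move=> an; have [k kr [ek kmin]] := @Zfirst (fun v => ~~ mid b v) a n an earn.
  by exists k => //; split=> // j /kmin /negPn.
(* A run ending at n gives the chord (0, n - 2), while 2 is the only neighbour of 0; then n = 4. *)
have not_end e : 1 < e -> mid b (e - 1) -> e <> n.
  move=> e1 me E; have : b 0 (e - 2).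
    by rewrite (crit_wrap0 _ P) -(@mid_at _ _ (e - 1)) //; lia.
  by move=> /n0 ?; have e4 : e = 4 by [lia]; lia.
have left_end_degree q : 2 < q < n - 1 -> ~~ mid b q -> mid b (q + 1) -> exists y1 y2, nbrs2 n b q y1 y2.
  move=> qr eq mq; have [[y Nq]|//] := ear_cases P eq.
  have bq : b q (q + 2) by rewrite -(@mid_at _ _ (q + 1)) //; lia.
  have [_ _ nq] := Nq; have yE := nq _ bq ltac:(lia).
  have q2 : q + 2 <> n by move=> E; have := link q n eq earn ltac:(lia); rewrite -E bq.
  exfalso; apply: (@double_fan_right n b 0 q P); [lia | move=> z zr; apply/negP=> /n0; lia |].
  by move=> x xr; apply/negP=> /(nbrs1_left P Nq); lia.
have [|e1 e1r [ear1 run1]] := Zfirst_ear 1; first lia.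
have e1_3 : 3 <= e1.
  have ? : e1 <> 1 by move=> E; rewrite E mid1 in ear1.
  have m2 : mid b 2 := singleton 1 mid1 ear0.
  have ? : e1 <> 2 by move=> E; rewrite E m2 in ear1.
  lia.
have e1n : e1 <> n by apply: not_end; [lia | apply: run1; lia].
have next a : ~~ mid b a -> a < n -> (forall j, a <= j <= n -> ~~ mid b j) \/
    exists q, [/\ a <= q < n - 1, mid b (q + 1) & forall j, a <= j <= q -> ~~ mid b j].
  move=> ea an; have [[v vr mv]|none] := Zrange_dec (mid b) a n; last first.
    by left=> j jr; case: (Z.eq_dec j n) => [->|?] //; apply: none; lia.
  have [|q1 q1r [mq q1min]] := @Zfirst (mid b) a v _ mv; first lia.
  have q1a : q1 <> a by move=> E; rewrite E (negbTE ea) in mq.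
  by right; exists (q1 - 1); rewrite Z.sub_add; split=> // [|j jr]; [lia | apply: q1min; lia].
case: (next e1) => // [|none|[q [qr mq earq]]]; first lia.
  exfalso; apply: (@not_one_gap n b (e1 - 2) P); [lia | move=> v ?; apply: run1; lia |].
  by move=> u w ? ?; apply: link; [apply: none | apply: none |]; lia.
have eq : ~~ mid b q by apply: earq; lia.
have [|x1 [x2 Nq]] := left_end_degree q _ eq mq; first lia.
have [|e er [eare run2]] := Zfirst_ear (q + 1); first lia.
have e3 : q + 3 <= e.
  have ? : e <> q + 1 by move=> E; rewrite E mq in eare.
  have m2 : mid b (q + 1 + 1) by apply: singleton => //; rewrite Z.add_simpl_r.
  have ? : e <> q + 1 + 1 by move=> E; rewrite E m2 in eare.
  lia.
have en : e <> n by apply: not_end; [lia | apply: run2; lia].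
have far_degree v y1 y2 : q + 2 <= v <= n -> ~~ mid b v -> nbrs2 n b v y1 y2 -> False.
  move=> vr ev Nv; have bqv := degree_two_ears_linked P eq ev ltac:(lia) Nq Nv.
  by have := link q v eq ev ltac:(lia); rewrite bqv.
case: (next e) => // [|earU|[c [cr mc earc]]]; first lia; last first.
  have ec : ~~ mid b c by apply: earc; lia.
  have [|y1 [y2 Nc]] := left_end_degree c _ ec mc; first lia.
  by case: (far_degree c y1 y2); [lia | |].
have Ne : nbrs1 n b e (e - 2 + n).
  have [[y Ne]|[y1 [y2 Ne]]] := ear_cases P eare; last by case: (far_degree e y1 y2); [lia | |].
  have be : b (e - 2) e by rewrite -(@mid_at _ _ (e - 1)); [apply: run2 | |]; lia.
  by rewrite (nbrs1_left P Ne be); [|lia].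
have [e1q [y1 [y2 Ne1]]] : (q = e1 \/ q = e1 + 1) /\ exists y1 y2, nbrs2 n b e1 y1 y2.
  have [[y Ne1]|[y1 [y2 Ne1]]] := ear_cases P ear1.
    have be : b (e1 - 2) e1 by rewrite -(@mid_at _ _ (e1 - 1)); [apply: run1 | |]; lia.
    have yE := nbrs1_left P Ne1 be ltac:(lia).
    have [_ _ ne1] := Ne1; have [_ _ ne] := Ne.
    exfalso; apply: (@double_fan_left n b e1 e P); first by lia.
      by move=> z zr; apply/negP=> /ne1; lia.
    by move=> z zr; apply/negP=> /ne; lia.
  split; last by exists y1, y2.
  case: (Z_le_gt_dec (e1 + 2) q) => ?; last by lia.
  have bb := degree_two_ears_linked P ear1 eq ltac:(lia) Ne1 Nq.
  by have := link e1 q ear1 eq ltac:(lia); rewrite bb.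
have [I IP] := label_function n (fun x j => [&& 0 <? x, x <? j & b x j]).
have lowI j : e + 1 <= j < n -> [/\ 1 <= I j <= e - 1, mid b (I j) &
    forall x, 1 <= x <= e - 1 -> b x j <-> x = I j].
  move=> jr; have ej : ~~ mid b j by apply: earU; lia.
  have [[y Nj]|[z1 [z2 Nj]]] := ear_cases P ej; last by case: (far_degree j z1 z2); [lia | |].
  have my := nbrs1_mid P Nj; have [yr bjy nj] := Nj.
  have yn : n < y.
    by case: (Z_lt_ge_dec n y) => // ?; move: my; rewrite (negbTE (earU y _)) //; lia.
  have mx : mid b (y - n) by rewrite (@mid_per n b (-1) y) //; lia.
  have xe : y - n < e.
    by case: (Z_lt_ge_dec (y - n) e) => // ?; move: mx; rewrite (negbTE (earU (y - n) _)) //; lia.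
  have bxj : b (y - n) j by rewrite wrap Z.sub_add.
  have uniq x : 0 < x < j -> b x j -> x = y - n.
    by move=> xr /(nbrs1_left P Nj); lia.
  have [||Ir] := IP j (y - n); first by lia.
    by rewrite bxj andbT; apply/andP; split; apply/Z.ltb_spec0; lia.
  case/and3P=> /Z.ltb_spec0 I0 /Z.ltb_spec0 Ij bIj.
  have IE := uniq (I j) ltac:(lia) bIj.
  split; [lia | by rewrite IE | move=> x xr; split=> [bx|->] //].
  by rewrite IE; apply: uniq => //; lia.
have freeU u w : e <= u < w -> w <= n -> ~~ b u w.
  by move=> ? ?; apply: link; [apply: earU | apply: earU |]; lia.
case: e1q => qE.
  left; subst q; apply: (@two_runs_one_ear n b e1 e I) => //; try lia.
  - move=> v vr ve; case: (Z_lt_ge_dec v e1) => ?; first by apply: run1; lia.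
    by apply: run2; lia.
  - have be1 : b (e1 - 2) e1 by rewrite -(@mid_at _ _ (e1 - 1)); [apply: run1 | |]; lia.
    have be2 : b e1 (e1 + 2) by rewrite -(@mid_at _ _ (e1 + 1)) //; lia.
    have [_ _ _ _ n1] := Ne1.
    have E2 := n1 _ be2 ltac:(lia); have E1 := nbrs2_left P Ne1 be1 ltac:(lia).
    have [? ? ? ? _] := Ne1.
    by split; rewrite -?wrap //; [lia | lia | move=> y /n1; lia].
  - by move=> x j xr jr; have [_ _ H] := lowI j jr; apply: H.
  by move=> j jr; have [? mI _] := lowI j jr; split=> // E; rewrite E (negbTE ear1) in mI.
right; subst q; apply: (@two_runs_two_ears n b e1 e y1 y2 x1 x2 I) => //; try lia.
- move=> v vr ve ve1; case: (Z_lt_ge_dec v e1) => ?; first by apply: run1; lia.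
  by apply: run2; lia.
- by move=> x j xr jr; have [_ _ H] := lowI j jr; apply: H.
move=> j jr; have [? mI _] := lowI j jr; split=> //.
by split=> E; [rewrite E (negbTE ear1) in mI | rewrite E (negbTE eq) in mI].
Qed.

Lemma chords1_shift (n : Z) (b : Z -> Z -> bool) (r : Z) :
  chords1 n (shift r b) -> chords1 n b.
Proof.
case=> r' [m [l [I [H1 H2 H3 H4 bE]]]]; exists (r' + r), m, l, I; split=> // x y xy yn.
by rewrite -bE // /shift !Z.add_assoc.
Qed.

Lemma chords2_shift (n : Z) (b : Z -> Z -> bool) (r : Z) :
  chords2 n (shift r b) -> chords2 n b.
Proof.
case=> r' [m [l [I [H1 H2 H3 H4 bE]]]]; exists (r' + r), m, l, I; split=> // x y xy yn.
by rewrite -bE // /shift !Z.add_assoc.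
Qed.

Lemma mid_shift (b : Z -> Z -> bool) (r v w : Z) : w = v + r -> mid (shift r b) v = mid b w.
Proof. by move=> ->; rewrite /mid /shift; congr (b _ _); lia. Qed.

(** Without ears, the short diagonals around n - 2 consecutive vertices would already form a
    blocker. *)
Lemma exists_ear (n : Z) (b : Z -> Z -> bool) (a : Z) : crit n b ->
  exists2 v, a <= v < a + n & ~~ mid b v.
Proof.
move=> P; have n5 := crit_n P.
have [//|none] := Zrange_dec (fun v => ~~ mid b v) a (a + n).
exfalso; apply: (@no_minimum_inside n (shift a b) (n - 3) id (crit_shift a P)); try lia.
by move=> v vr; rewrite (@mid_shift _ _ _ (v + a)) //; apply/negPn/none; lia.
Qed.

Lemma left_end_after (n : Z) (b : Z -> Z -> bool) (a : Z) : crit n b -> ~~ mid b a ->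
  (exists v, mid b v) -> exists2 q, a <= q < a + n - 1 & ~~ mid b q /\ mid b (q + 1).
Proof.
move=> P ea [v mv]; have n5 := crit_n P.
have [v' v'r mv'] : exists2 v', a <= v' < a + n & mid b v'.
  exists (a + (v - a) mod n); first by have := Z.mod_pos_bound (v - a) n; lia.
  rewrite (@mid_per n b (- ((v - a) / n)) v) //.
  by have := Z.div_mod (v - a) n; lia.
have [|q1 q1r [mq q1min]] := @Zfirst (mid b) a v' _ mv'; first lia.
have q1a : q1 <> a by move=> E; rewrite E (negbTE ea) in mq.
by exists (q1 - 1); [lia | rewrite Z.sub_add; split=> //; apply: q1min; lia].
Qed.

(** Of two ears preceding different runs at least one has degree one, since two of degree two would
    be joined; the labels are rotated to start there. *)
Lemma unlinked_case (n : Z) (b : Z -> Z -> bool) : crit n b -> unlinked n b ->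
  chords1 n b \/ chords2 n b.
Proof.
move=> P unl; have n5 := crit_n P.
have link u w : ~~ mid b u -> ~~ mid b w -> u < w < u + n -> ~~ b u w.
  by move=> /negP ? /negP ? uw; apply/negP=> /(unl u w uw); tauto.
have [e0 _ ee0] := exists_ear 0 P.
have exm : exists v, mid b v.
  have [y yr by_] := vertex_meets e0 P.
  by case: (unl e0 y _ by_) => // [|m1|m1]; [lia | exists e0 | exists y].
have from c : ~~ mid b c -> mid b (c + 1) -> (exists y, nbrs1 n b c y) -> chords1 n b \/ chords2 n b.
  move=> ec mc [y Nc]; have [_ _ nc] := Nc.
  have yE : y = c + 2.
    symmetry; apply: nc; last by lia.
    by rewrite -(@mid_at _ _ (c + 1)) //; lia.
  have [||||H|H] := @two_runs n (shift c b) (crit_shift c P).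
  - move=> u w uw; rewrite /shift (@mid_shift _ _ _ (u + c)) // (@mid_shift _ _ _ (w + c)) //.
    by move=> /unl; apply; lia.
  - by rewrite (@mid_shift _ _ _ c).
  - by rewrite (@mid_shift _ _ _ (c + 1)) //; lia.
  - by apply: (nbrs1_shift (k := 0) P Nc); lia.
  - by left; apply: chords1_shift H.
  by right; apply: chords2_shift H.
have [c cr [ec mc]] := left_end_after P ee0 exm.
have [N1|[x1 [x2 Nc]]] := ear_cases P ec; first exact: from ec mc N1.
have ecn : ~~ mid b (c + n) by rewrite (@mid_per n b 1 c) //; lia.
have [e er [ee emin]] := @Zfirst (fun v => ~~ mid b v) (c + 1) (c + n) ltac:(lia) ecn.
have ec1 : e <> c + 1 by move=> E; rewrite E mc in ee.
have [[v vr mv]|none] := Zrange_dec (mid b) e (c + n); last first.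
  case: (Z.eq_dec e (c + n)) => ecn1.
    exfalso; apply: (@no_minimum_inside n (shift c b) (n - 3) id (crit_shift c P)); try lia.
    by move=> w wr; rewrite (@mid_shift _ _ _ (w + c)) //; apply/negPn/emin; lia.
  exfalso; apply: (@not_one_gap n (shift c b) (e - c - 2) (crit_shift c P)); first lia.
  - move=> w wr; rewrite (@mid_shift _ _ _ (w + c)) //; apply/negPn/emin; lia.
  have earU w : e <= w <= c + n -> ~~ mid b w.
    by move=> wr; case: (Z.eq_dec w (c + n)) => [->|?] //; apply: none; lia.
  by move=> u w ? ?; rewrite /shift; apply: link; [apply: earU | apply: earU |]; lia.
have [|q1 q1r [mq q1min]] := @Zfirst (mid b) e v _ mv; first lia.
have qe1 : q1 <> e by move=> E; rewrite E (negbTE ee) in mq.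
have eq : ~~ mid b (q1 - 1) by apply: q1min; lia.
have [N1|[y1 [y2 Nq]]] := ear_cases P eq; first by apply: from eq _ N1; rewrite Z.sub_add.
have bb := degree_two_ears_linked P ec eq ltac:(lia) Nc Nq.
by have := link c (q1 - 1) ec eq ltac:(lia); rewrite bb.
Qed.

(** * Linked ears *)

Lemma linked_ears_nbrs2 (n : Z) (b : Z -> Z -> bool) (u w : Z) : crit n b ->
  ~~ mid b u -> ~~ mid b w -> u < w < u + n -> b u w -> exists y1 y2, nbrs2 n b u y1 y2.
Proof.
move=> P eu ew uw buw; have [[y N1]|//] := ear_cases P eu.
have m1 := nbrs1_mid P N1; have [_ _ n1] := N1.
by move: m1; rewrite -(n1 w buw uw) (negbTE ew).
Qed.

Lemma nbrs2_known (n : Z) (b : Z -> Z -> bool) (v y1 y2 a c : Z) :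
  nbrs2 n b v y1 y2 -> v < a < c -> c < v + n -> b v a -> b v c -> nbrs2 n b v a c.
Proof.
move=> [v12 v2n b1 b2 bv] vac cn ba bc.
have Ha := bv _ ba ltac:(lia); have Hc := bv _ bc ltac:(lia).
by split=> // y by_ yr; have := bv _ by_ yr; lia.
Qed.

(** Ears are allowed as further neighbours, so that joined ears of degree two are included. *)
Definition attached (n : Z) (b : Z -> Z -> bool) (j : Z) : Prop :=
  exists y, [/\ j < y < j + n, b j y, mid b y &
    forall y', b j y' -> j < y' < j + n -> mid b y' -> y' = y].

Lemma nbrs1_attached (n : Z) (b : Z -> Z -> bool) (j y : Z) : crit n b ->
  nbrs1 n b j y -> attached n b j.
Proof.
move=> P N; have my := nbrs1_mid P N; have [? ? nj] := N.
by exists y; split=> // y' ? ? _; apply: nj.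
Qed.

(** The predicate Q makes it possible to exempt an ear that is joined to two ears and hence to no
    middle. *)
Lemma attachment_function (n : Z) (b : Z -> Z -> bool) (e : Z) (Q : Z -> Prop) : crit n b ->
  1 <= e < n -> (forall v, 1 <= v < e -> mid b v) ->
  (forall j, e < j < n -> Q j -> attached n b j) ->
  (forall j v, e < j < n -> Q j -> e <= v <= n -> mid b v -> ~~ b v j) ->
  exists I, forall j, e < j < n -> Q j ->
    1 <= I j <= e - 1 /\ forall x, 1 <= x <= e - 1 -> b x j <-> x = I j.
Proof.
move=> P en mids Qatt far; have wrap := fun x y => crit_wrap x y P.
have [I IP] := label_function n (fun x j => [&& 0 <? x, x <? e & b x j]).
exists I => j jr Qj; have [y [yr bjy my nj]] := Qatt j jr Qj.
have yn : n < y.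
  case: (Z_lt_ge_dec n y) => // ?.
  by have := far j y jr Qj ltac:(lia) my; rewrite (crit_sym P) bjy.
have myn : mid b (y - n) by rewrite (@mid_per n b (-1) y) //; lia.
have byn : b (y - n) j by rewrite wrap Z.sub_add.
have xe : y - n < e.
  case: (Z_lt_ge_dec (y - n) e) => // ?.
  by have := far j (y - n) jr Qj ltac:(lia) myn; rewrite byn.
have uniq x : 0 < x < e -> b x j -> x = y - n.
  move=> xr; rewrite wrap => bx.
  have : mid b (x + n) by rewrite (@mid_per n b 1 x) //; [apply: mids; lia | lia].
  by move/(nj _ bx ltac:(lia)); lia.
have [||Ir] := IP j (y - n); first by lia.
  by rewrite byn andbT; apply/andP; split; apply/Z.ltb_spec0; lia.
case/and3P=> /Z.ltb_spec0 I0 /Z.ltb_spec0 Ie bIj.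
split; [lia | move=> x xr; split=> [bx|-> //]].
by have -> := uniq (I j) ltac:(lia) bIj; apply: uniq; [lia |].
Qed.

(** The fan at q passes the ear c by means of its short diagonal, and the fan at e completes the
    triangulation. *)
Lemma linked_run_ends (n : Z) (b : Z -> Z -> bool) (c e q : Z) : crit n b ->
  ~~ mid b c -> c + 2 <= e -> e + 2 <= q <= c + n - 2 ->
  nbrs1 n b e (e - 2 + n) -> nbrs2 n b q (c + n) (q - 2 + n) -> False.
Proof.
move=> P ec ce eq [_ _ ne] [_ _ _ _ nq]; have n5 := crit_n P; have side := crit_side P.
have freeq y : q < y < q - 2 + n -> y <> c + n -> ~~ b q y by move=> ? ?; apply/negP=> /nq; lia.
have t1 : tri b q (c + n - 1).
  by apply: tri_free_fanl => //; [lia | move=> y ?; apply: freeq; lia].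
have t2 : tri b q (c + n + 1).
  apply: tri_fan_jump => //; [lia | apply: freeq; lia |].
  by rewrite (@mid_per n b 1 c) //; lia.
have t3 : tri b q (e + n - 1) by apply: (tri_fanl side t2); [lia | move=> y ?; apply: freeq; lia].
apply: (@crit_blocked _ _ P e).
apply: (@tri_cut _ _ q) => //; [lia | by apply/negP=> /ne; lia | by apply: freeq; lia |].
by apply: tri_free_fanl => //; [lia | move=> y ?; apply/negP=> /ne; lia].
Qed.

Lemma run_bounds (n : Z) (b : Z -> Z -> bool) (e v : Z) : crit n b ->
  ~~ mid b 0 -> ~~ mid b e -> e < v < n -> mid b v ->
  exists c d, [/\ e <= c < v, v < d <= n, ~~ mid b c, ~~ mid b d & forall w, c < w < d -> mid b w].
Proof.
move=> P e0 ee vr mv; have en : ~~ mid b n by rewrite (@mid_per n b 1 0) //; lia.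
have [c cr [ec cmax]] := @Zlast (fun v => ~~ mid b v) e v ltac:(lia) ee.
have [d dr [ed dmin]] := @Zfirst (fun v => ~~ mid b v) v n ltac:(lia) en.
have cv : c <> v by move=> E; rewrite E mv in ec.
have dv : d <> v by move=> E; rewrite E mv in ed.
exists c, d; split=> //; try lia.
move=> w wr; case: (Z_le_gt_dec w v) => ?; apply/negPn; [apply: cmax | apply: dmin]; lia.
Qed.

Lemma nbrs2_per (n : Z) (b : Z -> Z -> bool) (k v y1 y2 v' y1' y2' : Z) : crit n b ->
  nbrs2 n b v y1 y2 -> v' = v + k * n -> y1' = y1 + k * n -> y2' = y2 + k * n ->
  nbrs2 n b v' y1' y2'.
Proof.
move=> P [v12 v2n b1 b2 bv] -> -> ->.
have bE y : b (v + k * n) (y + k * n) = b v y by apply: (@crit_per2 _ _ k k _ _ _ _ P); lia.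
split; rewrite ?bE //; try lia.
move=> y; have Ey : y = (y - k * n) + k * n by lia.
by rewrite {1}Ey bE => /bv; lia.
Qed.

Lemma linked_ear_attached (n : Z) (b : Z -> Z -> bool) (v z : Z) : crit n b ->
  ~~ mid b v -> ~~ mid b z -> v < z < v + n -> b v z ->
  (forall y, b v y -> v < y < v + n -> y = z \/ mid b y) ->
  (exists y1 y2, nbrs2 n b v y1 y2) /\ attached n b v.
Proof.
move=> P ev ez vz bvz only; have [y1 [y2 Nv]] := linked_ears_nbrs2 P ev ez vz bvz.
split; first by exists y1, y2.
have [v12 v2n b1 b2 bv] := Nv.
have o1 := only _ b1 ltac:(lia); have o2 := only _ b2 ltac:(lia).
have nz y : mid b y -> y <> z by move=> my E; rewrite -E my in ez.
case: (bv z bvz vz) => zE.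
  exists y2; split=> //; [lia | by case: o2 => // ?; lia |].
  by move=> y /bv H yr my; have := nz y my; have := H yr; lia.
exists y1; split=> //; [lia | by case: o1 => // ?; lia |].
by move=> y /bv H yr my; have := nz y my; have := H yr; lia.
Qed.

(** Another ear of degree two from e to n would be adjacent on the polygon to both p and q, hence a
    middle since (p, q) is a chord. So p and q are the only ones, which rules out a second run of
    length at least two; a further middle can only be the single vertex between p and q, and
    [bouquet_of_link] applies. *)
Lemma linked_ears_case (n : Z) (b : Z -> Z -> bool) (e p q : Z) : crit n b ->
  ~~ mid b 0 -> ~~ mid b e -> (forall v, 1 <= v < e -> mid b v) ->
  e <= p -> p + 2 <= q <= n -> ~~ mid b p -> ~~ mid b q -> b p q ->
  (forall y, b p y -> p < y < p + n -> y = q \/ mid b y) ->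
  (forall y, b q y -> q < y < q + n -> y = p + n \/ mid b y) ->
  (exists2 x, 1 <= x < e & b x p || b x q) ->
  chords3 n b.
Proof.
move=> P ear0 eare mids ep pq earp earq bpq np nq [x0 x0r bx0].
have n5 := crit_n P; have side := crit_side P.
have wrap x y := crit_wrap x y P.
have earn : ~~ mid b n by rewrite (@mid_per n b 1 0) //; lia.
have bqp : b q (p + n) by rewrite -wrap.
have [[p1 [p2 Np]] attp] := linked_ear_attached P earp earq ltac:(lia) bpq np.
have earpn : ~~ mid b (p + n) by rewrite (@mid_per n b 1 p) //; lia.
have [[q1 [q2 Nq]] attq] := linked_ear_attached P earq earpn ltac:(lia) bqp nq.
have two_p y y' : b p y -> p < y < p + n -> mid b y -> b p y' -> p < y' < p + n -> mid b y' -> y = y'.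
  by case: attp => z [_ _ _ uz] b1 r1 m1 b2 r2 m2; rewrite (uz y) // (uz y').
have two_q y y' : b q y -> q < y < q + n -> mid b y -> b q y' -> q < y' < q + n -> mid b y' -> y = y'.
  by case: attq => z [_ _ _ uz] b1 r1 m1 b2 r2 m2; rewrite (uz y) // (uz y').
have deg2 w y1 y2 : e <= w <= n -> ~~ mid b w -> nbrs2 n b w y1 y2 -> w = p \/ w = q.
  move=> wr ew Nw.
  case: (Z.eq_dec w p) => [->|wp]; first by left.
  case: (Z.eq_dec w q) => [->|wq]; [by right | exfalso].
  have notp : w = p - 1 \/ w = p + 1.
    case: (Z_le_gt_dec (w + 2) p) => wp2.
      have bb : b p (w + n) by rewrite -wrap; apply: (degree_two_ears_linked P ew earp _ Nw Np); lia.
      have [?|] := np _ bb ltac:(lia); first by lia.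
      by rewrite (@mid_per n b 1 w) ?(negbTE ew) //; lia.
    case: (Z_le_gt_dec (p + 2) w) => pw2; last by lia.
    have bb : b p w by apply: (degree_two_ears_linked P earp ew _ Np Nw); lia.
    by have [?|] := np _ bb ltac:(lia); [lia | rewrite (negbTE ew)].
  have notq : w = q - 1 \/ w = q + 1.
    case: (Z_le_gt_dec (w + 2) q) => wp2.
      have bb : b q (w + n) by rewrite -wrap; apply: (degree_two_ears_linked P ew earq _ Nw Nq); lia.
      have [?|] := nq _ bb ltac:(lia); first by lia.
      by rewrite (@mid_per n b 1 w) ?(negbTE ew) //; lia.
    case: (Z_le_gt_dec (q + 2) w) => pw2; last by lia.
    have bb : b q w by apply: (degree_two_ears_linked P earq ew _ Nq Nw); lia.
    by have [?|] := nq _ bb ltac:(lia); [lia | rewrite (negbTE ew)].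
  by move: ew; rewrite (@mid_at b p w q) ?bpq //; lia.
have link u w : e <= u < w -> w <= n -> ~~ mid b u -> ~~ mid b w -> b u w -> u = p /\ w = q.
  move=> uw wn eu ew buw.
  have [y1 [y2 Nu]] := linked_ears_nbrs2 P eu ew ltac:(lia) buw.
  have [z1 [z2 Nw]] : exists y1 y2, nbrs2 n b w y1 y2.
    apply: (linked_ears_nbrs2 P ew (w := u + n)); [| lia | by rewrite -wrap].
    by rewrite (@mid_per n b 1 u) //; lia.
  by have := deg2 u _ _ ltac:(lia) eu Nu; have := deg2 w _ _ ltac:(lia) ew Nw; lia.
(* A run consisting of 1 alone joins the ears 2 and n, which are then p and q; but 1 is a polygon
   neighbour of both, contrary to the chord at x0. *)
have e3 : 3 <= e.
  have e2 : e <> 2.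
    move=> E; have m1 : mid b 1 by apply: mids; lia.
    have b2n : b 2 n by rewrite -(crit_wrap0 2 P).
    have [pE qE] := link 2 n ltac:(lia) ltac:(lia) ltac:(by rewrite -E) earn b2n.
    have x1 : x0 = 1 by lia.
    case/orP: bx0; rewrite x1 -?pE -?qE; first by apply/negP/(chordfree_at side).
    by rewrite -(crit_wrap0 1 P); apply/negP/(chordfree_at side).
  lia.
have right_end d : e <= d <= n -> ~~ mid b d -> mid b (d - 1) ->
    b d (d - 2 + n) /\ (nbrs1 n b d (d - 2 + n) \/ d = p \/ d = q).
  move=> dr ed md; have bd : b (d - 2) d by rewrite -(@mid_at _ _ (d - 1)) //; lia.
  split; first by rewrite -wrap.
  have [[y N1]|[y1 [y2 N2]]] := ear_cases P ed; [left | right; exact: (deg2 d y1 y2)].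
  by rewrite (nbrs1_left P N1 bd); [|lia].
have left_end c : e <= c <= n -> ~~ mid b c -> mid b (c + 1) ->
    b c (c + 2) /\ (nbrs1 n b c (c + 2) \/ c = p \/ c = q).
  move=> cr ec mc; have bc : b c (c + 2) by rewrite -(@mid_at _ _ (c + 1)) //; lia.
  split=> //; have [[y N1]|[y1 [y2 N2]]] := ear_cases P ec; [left | right; exact: (deg2 c y1 y2)].
  by have [_ _ n1] := N1; rewrite (n1 _ bc); [|lia].
have second c d : e <= c -> c + 2 <= d <= n -> ~~ mid b c -> ~~ mid b d ->
    (forall v, c < v < d -> mid b v) -> c = p /\ d = q /\ d = c + 2.
  move=> ec cd earc eard mcd.
  case: (Z.eq_dec d (c + 2)) => [dE|dne].
    have bcd : b c d by rewrite -(@mid_at _ _ (c + 1)); [apply: mcd | |]; lia.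
    by have := link c d ltac:(lia) ltac:(lia) earc eard bcd; lia.
  exfalso.
  have mn1 : mid b (n + 1) by rewrite (@mid_per n b 1 1); [apply: mids; lia | | lia].
  have [bn Ln] := left_end n ltac:(lia) earn mn1.
  have [bc Lc] := left_end c ltac:(lia) earc (mcd (c + 1) ltac:(lia)).
  have [be Re] := right_end e ltac:(lia) eare (mids (e - 1) ltac:(lia)).
  have [bd Rd] := right_end d ltac:(lia) eard (mcd (d - 1) ltac:(lia)).
  have mper v w : w = v + n -> mid b v -> mid b w.
    by move=> E mv; rewrite (@mid_per n b 1 v) //; lia.
  (* The ears n and c preceding the two runs cannot both have degree one, so one of them is p or q;
     the same holds for the ears e and d following them. *)
  have Lq : q = n \/ c = p \/ c = q.
    case: Ln => [N1|[?|?]]; [|lia|by left]; case: Lc => [N2|?]; [|by right]; exfalso.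
    have [_ _ n2] := N2; apply: (@double_fan_right n b c n P); first by lia.
      by move=> y yr; apply/negP=> /n2; lia.
    by move=> x xr; apply/negP=> /(nbrs1_left P N1); lia.
  have Rp : p = e \/ d = p \/ d = q.
    case: Re => [N1|[?|?]]; [|by left|lia]; case: Rd => [N2|?]; [|by right]; exfalso.
    have [_ _ n1] := N1; have [_ _ n2] := N2; apply: (@double_fan_left n b e d P); first by lia.
      by move=> y yr; apply/negP=> /n1; lia.
    by move=> y yr; apply/negP=> /n2; lia.
  have mc2 : mid b (c + 2) by apply: mcd; lia.
  have md2 : mid b (d - 2 + n) by apply: (mper (d - 2)); [lia | apply: mcd; lia].
  have me2 : mid b (e - 2 + n) by apply: (mper (e - 2)); [lia | apply: mids; lia].
  have mn2 : mid b (n + 2) by apply: (mper 2); [lia | apply: mids; lia].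
  have chord_free x y : x + 3 <= y < x + n -> (forall v, x < v < y -> mid b v) -> b x y -> False.
    by move=> ? mxy; apply/negP/(no_chord_over_mids P).
  case: (Z.eq_dec q n) => qn.
    case: Rp => [pe|[dp|dq]].
    - apply: (chord_free 0 e) => //; [lia | move=> v ?; apply: mids; lia |].
      by rewrite (crit_wrap0 _ P) -pe -qn.
    - have N1 : nbrs1 n b e (e - 2 + n) by case: Re => // ?; lia.
      apply: (linked_run_ends (c := 0) (q := d) P ear0 _ _ N1); [lia | lia |].
      rewrite dp; apply: (nbrs2_known Np); [lia | lia | by rewrite -qn | by rewrite -dp].
    have bn' : b q (n + 2) by rewrite qn.
    have bd' : b q (d - 2 + n) by rewrite -dq.
    have := two_q (n + 2) (d - 2 + n) bn' ltac:(lia) mn2 bd' ltac:(lia) md2; lia.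
  case: Lq => [//|[cp|cq]].
    case: Rp => [pe|[?|dq]]; [|lia|].
      have bc' : b p (c + 2) by rewrite -{1}cp.
      have be' : b p (e - 2 + n) by rewrite {1}pe.
      have := two_p (c + 2) (e - 2 + n) bc' ltac:(lia) mc2 be' ltac:(lia) me2; lia.
    apply: (chord_free c d) => //; [lia | by rewrite cp dq].
  have pe : p = e by lia.
  have N1 : nbrs1 n b d (d - 2 + n) by case: Rd => // ?; lia.
  apply: (linked_run_ends (c := q) (q := e + n) P earq _ _ N1); [lia | lia |].
  have Ne : nbrs2 n b p q (p - 2 + n).
    by apply: (nbrs2_known Np) => //; [lia | lia | rewrite pe].
  by apply: (nbrs2_per (k := 1) P Ne); lia.
have far v : e <= v <= n -> mid b v -> p = v - 1 /\ q = v + 1.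
  move=> vr mv; have ve : v <> e by move=> E; rewrite E (negbTE eare) in mv.
  have vn : v <> n by move=> E; rewrite E (negbTE earn) in mv.
  have [|c [d [? ? earc eard mcd]]] := run_bounds P ear0 eare _ mv; first lia.
  by have := second c d ltac:(lia) ltac:(lia) earc eard mcd; lia.
(* If v = p + 1 had two chords, counting with p and with q would give the chords (p - 1, q) and (p,
   q + 1). These force p = e and q = n, and p would have the two middle neighbours e - 2 and 1. *)
have far1 v : e <= v <= n -> mid b v -> exists2 y, nbrs1 n b v y & mid b y.
  move=> vr mv; have [pE qE] := far v vr mv.
  suff one : forall y1 y2, v < y1 < y2 -> y2 < v + n -> b v y1 -> b v y2 -> False.
    have [y yr bvy] := vertex_meets v P.
    have N : nbrs1 n b v y.
      split=> //; first lia.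
      move=> z bvz zr; case: (Z.lt_total z y) => [zy|[//|zy]]; exfalso.
        by apply: (one z y) => //; lia.
      by apply: (one y z) => //; lia.
    by exists y => //; apply: nbrs1_mid P N.
  move=> y1 y2 y12 yn by1 by2.
  have [p12 p2n bp1 bp2 _] := Np; have [q12 q2n bq1 bq2 _] := Nq.
  have bpq1 : b (p - 1) q.
    apply/negPn/negP=> nb.
    apply: (@adjacent_ears_degree n b p p1 p2 y1 y2 P) => //; try lia.
    - by have -> : p + 2 = q by lia.
    - by apply/orP; left.
    - by have -> : p + 1 = v by lia.
    by have -> : p + 1 = v by lia.
  have bpq2 : b p (q + 1).
    apply/negPn/negP=> nb.
    apply: (@adjacent_ears_degree n b v y1 y2 q1 q2 P) => //; try lia.
    - by have -> : v - 1 = p by [lia]; have -> : v + 2 = q + 1 by lia.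
    - by apply/orP; right; have -> : v + 1 = q by lia.
    - by have -> : v + 1 = q by lia.
    by have -> : v + 1 = q by lia.
  have mp : mid b (p - 1).
    have bb : b q (p - 1 + n) by rewrite -wrap.
    case: (nq _ bb ltac:(lia)) => [?|]; first by lia.
    by rewrite (@mid_per n b 1 (p - 1)) //; lia.
  have mq : mid b (q + 1) by case: (np _ bpq2 ltac:(lia)) => // ?; lia.
  have pe : p = e.
    case: (Z.eq_dec p e) => // ?; have := far (p - 1) ltac:(lia) mp; lia.
  have qn : q = n.
    case: (Z.eq_dec q n) => // ?.
    by have := far (q + 1) ltac:(lia) mq; lia.
  have be : b p (e - 2 + n).
    by rewrite pe -wrap -(@mid_at _ _ (e - 1)); [apply: mids | |]; lia.
  have me : mid b (e - 2 + n) by rewrite (@mid_per n b 1 (e - 2)) //; [apply: mids; lia | lia].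
  have := two_p _ _ bpq2 ltac:(lia) mq be ltac:(lia) me; lia.
have [|||I HI] := @attachment_function n b e (fun _ => True) P _ mids; first by lia.
- move=> j jr _; case mj: (mid b j).
    have [y N _] := far1 j ltac:(lia) mj; exact: nbrs1_attached N.
  have [[y N]|[y1 [y2 N]]] := ear_cases P (negbT mj); first exact: nbrs1_attached N.
  by case: (deg2 j y1 y2 ltac:(lia) (negbT mj) N) => ->.
- move=> j v jr _ vr mv; apply/negP=> bvj.
  have [y [_ _ nv] my] := far1 v ltac:(lia) mv.
  have [pE qE] := far v ltac:(lia) mv.
  have mj : mid b j.
    case: (Z.lt_total v j) => [vj|[vj|vj]].
    - by rewrite (nv j bvj) //; lia.
    - by rewrite vj (negbTE (crit_irr P j)) in bvj.
    have bjv : b v (j + n) by rewrite -wrap (crit_sym P).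
    by rewrite -(@mid_per n b 1 j (j + n) P); [rewrite (nv _ bjv) //; lia | lia].
  have [? ?] := far j ltac:(lia) mj.
  by move: bvj; have -> : v = j by [lia]; apply/negP/(crit_irr P).
apply: (@bouquet_of_link n b (e - 2) p q I P) => //; try lia.
- by move=> v vr; apply: mids; lia.
- by have -> : e - 2 + 2 = e by lia.
- move=> u w buw uw wn.
  case mu: (mid b u).
    have [y [_ _ nu] my] := far1 u ltac:(lia) mu.
    have [? ?] := far u ltac:(lia) mu.
    have wy := nu w buw ltac:(lia); rewrite -wy in my.
    have [? ?] := far w ltac:(lia) my; lia.
  case mw: (mid b w); last by apply: link => //; [lia | rewrite mu | rewrite mw].
  have [y [_ _ nw] my] := far1 w ltac:(lia) mw.
  have uy : u + n = y by apply: nw; [rewrite -wrap | lia].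
  by move: my; rewrite -uy (@mid_per n b 1 u) ?mu //; lia.
move=> j jr; have [Ir bI] := HI j ltac:(lia) Logic.I.
by split; [lia | move=> x xr; apply: bI; lia].
Qed.

(** If p and p + 1 were both different from e and n, fans at e, r and 0 would form a triangulation.
    So p = e or p + 1 = n, the two bouquets at the ends of the run. The label s is the copy of r to
    the right of p. *)
Lemma ear_linked_to_side_case (n : Z) (b : Z -> Z -> bool) (e p r s : Z) : crit n b ->
  3 <= e -> ~~ mid b 0 -> ~~ mid b e -> (forall v, 1 <= v < e -> mid b v) ->
  e <= p < n -> ~~ mid b p -> ~~ mid b (p + 1) ->
  e <= r <= n -> ~~ mid b r -> s = r \/ s = r + n -> p + 3 <= s <= p + n - 2 ->
  b p s -> b (p + 1) s ->
  (forall y, b p y -> p < y < p + n -> y = s \/ mid b y) ->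
  (forall y, b (p + 1) y -> p + 1 < y < p + 1 + n -> y = s \/ mid b y) ->
  (forall y, b s y -> s < y < s + n -> y = p + n \/ y = p + n + 1) ->
  chords3 n b.
Proof.
move=> P e3 ear0 eare mids ep earp earq er earr sE sr bps bqs np nq ns.
have n5 := crit_n P; have side := crit_side P.
have wrap x y := crit_wrap x y P.
have mper k v w : w = v + k * n -> mid b w = mid b v by apply: mid_per P.
have earn : ~~ mid b n by rewrite (mper 1 0) //; lia.
have ears : ~~ mid b s by case: sE => ->; rewrite ?(mper 1 r (r + n)) //; lia.
have [[p1 [p2 Np]] attp] := linked_ear_attached P earp ears ltac:(lia) bps np.
have [[q1 [q2 Nq]] attq] := linked_ear_attached P earq ears ltac:(lia) bqs nq.
have bsp : b s (p + n) by rewrite -wrap.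
have bsq : b s (p + n + 1) by rewrite (_ : p + n + 1 = p + 1 + n); [rewrite -wrap | lia].
have Ns : nbrs2 n b s (p + n) (p + n + 1) by split=> //; lia.
have Nr : nbrs2 n b r (p + n + r - s) (p + n + 1 + r - s).
  case: sE => sE; first by apply: (nbrs2_per (k := 0) P Ns); lia.
  by apply: (nbrs2_per (k := -1) P Ns); lia.
have brs v : b v s = b v r.
  by case: sE => -> //; apply: (@crit_per2 _ _ 0 1 _ _ _ _ P); lia.
have rnbr v : e <= v <= n -> b v r -> v = p \/ v = p + 1.
  rewrite -brs => vr bs.
  case: (Z.lt_total v s) => [vs|[vs|vs]].
  - case: (Z_lt_ge_dec (s - n) v) => sv; first by have := nbrs2_left P Ns bs ltac:(lia); lia.
    rewrite -(crit_per P) in bs; case: (Z.eq_dec s (v + n)) => [E|ne].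
      by rewrite -E (negbTE (crit_irr P s)) in bs.
    by have := nbrs2_left P Ns bs ltac:(lia); lia.
  - by rewrite vs (negbTE (crit_irr P s)) in bs.
  by rewrite (crit_sym P) in bs; have := ns _ bs ltac:(lia); lia.
have rlow x : 1 <= x < e -> ~~ b x r.
  move=> xr; apply/negP; rewrite -brs => bs; case: (Z_lt_ge_dec s (x + n)) => sx.
    by have := nbrs2_left P Ns bs ltac:(lia); lia.
  rewrite -(crit_per P) in bs; case: (Z.eq_dec s (x + n)) => [E|ne].
    by rewrite -E (negbTE (crit_irr P s)) in bs.
  by have := nbrs2_left P Ns bs ltac:(lia); lia.
have bpr : b p r by rewrite -brs.
have bqr : b (p + 1) r by rewrite -brs.
have re : r <> e.
  move=> E; have : b (e - 2) e by rewrite -(@mid_at _ _ (e - 1)); [apply: mids | |]; lia.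
  by rewrite -{2}E; apply/negP/rlow; lia.
have rn : r <> n.
  move=> E; have : b 0 2 by rewrite -(@mid_at _ _ 1) //; apply: mids; lia.
  by rewrite (crit_wrap0 2 P) -E; apply/negP/rlow; lia.
have rpq : r <= p - 2 \/ p + 3 <= r by lia.
have two_p y y' : b p y -> p < y < p + n -> mid b y -> b p y' -> p < y' < p + n -> mid b y' -> y = y'.
  by case: attp => z [_ _ _ uz] b1 r1 m1 b2 r2 m2; rewrite (uz y) // (uz y').
have deg2 w y1 y2 : e <= w <= n -> ~~ mid b w -> nbrs2 n b w y1 y2 -> [\/ w = p, w = p + 1 | w = r].
  move=> wr ew Nw.
  case: (Z.eq_dec w p) => [->|wp]; first by apply: Or31.
  case: (Z.eq_dec w (p + 1)) => [->|wq]; first by apply: Or32.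
  case: (Z.eq_dec w r) => [->|wr']; first by apply: Or33.
  exfalso; have ewn : ~~ mid b (w + n) by rewrite (mper 1 w) //; lia.
  case: (Z_le_gt_dec (w + 2) p) => wp2.
    have bb : b p (w + n) by rewrite -wrap; apply: (degree_two_ears_linked P ew earp _ Nw Np); lia.
    by have [?|] := np _ bb ltac:(lia); [lia | rewrite (negbTE ewn)].
  case: (Z_le_gt_dec (p + 2) w) => pw2.
    have bb : b p w by apply: (degree_two_ears_linked P earp ew _ Np Nw); lia.
    by have [?|] := np _ bb ltac:(lia); [lia | rewrite (negbTE ew)].
  have bb : b (p + 1) (w + n) by rewrite -wrap; apply: (degree_two_ears_linked P ew earq _ Nw Nq); lia.
  by have [?|] := nq _ bb ltac:(lia); [lia | rewrite (negbTE ewn)].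
have link u w : e <= u < w -> w <= n -> ~~ mid b u -> ~~ mid b w -> b u w ->
    (u = r /\ (w = p \/ w = p + 1)) \/ (w = r /\ (u = p \/ u = p + 1)).
  move=> uw wn eu ew buw.
  have [y1 [y2 Nu]] := linked_ears_nbrs2 P eu ew ltac:(lia) buw.
  have [z1 [z2 Nw]] : exists y1 y2, nbrs2 n b w y1 y2.
    apply: (linked_ears_nbrs2 P ew (w := u + n)); [| lia | by rewrite -wrap].
    by rewrite (mper 1 u) //; lia.
  have bne : w <> u + 1 by move=> E; move: buw; rewrite E; apply/negP/side.
  have := deg2 w _ _ ltac:(lia) ew Nw.
  by case: (deg2 u _ _ ltac:(lia) eu Nu) => ?; case=> ?; lia.
have right_end d : e <= d <= n -> ~~ mid b d -> mid b (d - 1) ->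
    b d (d - 2 + n) /\ (nbrs1 n b d (d - 2 + n) \/ [\/ d = p, d = p + 1 | d = r]).
  move=> dr ed md; have bd : b (d - 2) d by rewrite -(@mid_at _ _ (d - 1)) //; lia.
  split; first by rewrite -wrap.
  have [[y N1]|[y1 [y2 N2]]] := ear_cases P ed; [left | right; exact: (deg2 d y1 y2)].
  by rewrite (nbrs1_left P N1 bd); [|lia].
have left_end c : e <= c <= n -> ~~ mid b c -> mid b (c + 1) ->
    b c (c + 2) /\ (nbrs1 n b c (c + 2) \/ [\/ c = p, c = p + 1 | c = r]).
  move=> cr ec mc; have bc : b c (c + 2) by rewrite -(@mid_at _ _ (c + 1)) //; lia.
  split=> //; have [[y N1]|[y1 [y2 N2]]] := ear_cases P ec; [left | right; exact: (deg2 c y1 y2)].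
  by have [_ _ n1] := N1; rewrite (n1 _ bc); [|lia].
have notmid v w : mid b v -> ~~ mid b w -> v <> w by move=> mv ew E; rewrite -E mv in ew.
have second c d : e <= c -> c + 2 <= d <= n -> ~~ mid b c -> ~~ mid b d ->
    (forall v, c < v < d -> mid b v) ->
    d = c + 2 /\ ((c = r /\ d = p) \/ (c = p + 1 /\ d = r)).
  move=> ec cd earc eard mcd.
  have m1 := notmid _ _ (mcd (c + 1) ltac:(lia)) earq.
  have m2 := notmid _ _ (mcd (d - 1) ltac:(lia)) earp.
  case: (Z.eq_dec d (c + 2)) => [dE|dne].
    have bcd : b c d by rewrite -(@mid_at _ _ (c + 1)); [apply: mcd | |]; lia.
    by have := link c d ltac:(lia) ltac:(lia) earc eard bcd; lia.
  exfalso.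
  have mn1 : mid b (n + 1) by rewrite (mper 1 1); [apply: mids; lia | lia].
  have [bn Ln] := left_end n ltac:(lia) earn mn1.
  have [bc Lc] := left_end c ltac:(lia) earc (mcd (c + 1) ltac:(lia)).
  have [be Re] := right_end e ltac:(lia) eare (mids (e - 1) ltac:(lia)).
  have [bd Rd] := right_end d ltac:(lia) eard (mcd (d - 1) ltac:(lia)).
  have mc2 : mid b (c + 2) by apply: mcd; lia.
  have mc2p := notmid _ _ mc2 earp; have mc2q := notmid _ _ mc2 earq.
  have md2 : mid b (d - 2) by apply: mcd; lia.
  have md2p := notmid _ _ md2 earp; have md2q := notmid _ _ md2 earq.
  have me1 := notmid _ _ (mids (e - 1) ltac:(lia)) earp.
  have cr : c <> r.
    by move=> E; have := rnbr (c + 2) ltac:(lia); rewrite -E (crit_sym P) bc => /(_ isT); lia.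
  have dr : d <> r.
    by move=> E; move: bd; rewrite -wrap E => /rnbr; lia.
  (* Only p, p + 1 and r can have degree two among the ears from e to n, and r is none of the ends
     of the two runs; the double fans then leave these alternatives. *)
  have Lq : p + 1 = n \/ c = p + 1.
    case: Ln => [N1|[]]; [|lia|by left|lia]; case: Lc => [N2|[]]; [|lia|by right|lia]; exfalso.
    have [_ _ n2] := N2; apply: (@double_fan_right n b c n P); first by lia.
      by move=> y yr; apply/negP=> /n2; lia.
    by move=> x xr; apply/negP=> /(nbrs1_left P N1); lia.
  have Rp : p = e \/ d = p.
    case: Re => [N1|[]]; [|by left|lia|lia]; case: Rd => [N2|[]]; [|by right|lia|lia]; exfalso.
    have [_ _ n1] := N1; have [_ _ n2] := N2; apply: (@double_fan_left n b e d P); first by lia.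
      by move=> y yr; apply/negP=> /n1; lia.
    by move=> y yr; apply/negP=> /n2; lia.
  have me2 : mid b (e - 2 + n) by rewrite (mper 1 (e - 2)); [apply: mids; lia | lia].
  have md2n : mid b (d - 2 + n) by rewrite (mper 1 (d - 2)) //; lia.
  have [pe|pe] : p = e /\ c = p + 1 \/ d = p /\ p + 1 = n by lia.
    have be' : b p (e - 2 + n) by rewrite (proj1 pe).
    have [rd|rd] : d < r \/ (c < r < d) by lia.
      have N1 : nbrs1 n b d (d - 2 + n) by case: Rd => // -[]; lia.
      have [_ _ n1] := N1; apply: (@double_fan_left n b p d P); first by lia.
        move=> y yr; apply/negP=> bpy; have [?|my] := np y bpy ltac:(lia); first by lia.
        by have := two_p _ _ bpy ltac:(lia) my be' ltac:(lia) me2; lia.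
      by move=> y yr; apply/negP=> /n1; lia.
    by rewrite (mcd r rd) in earr.
  have bd' : b p (d - 2 + n) by rewrite -{1}(proj1 pe).
  have N1 : nbrs1 n b e (e - 2 + n) by case: Re => // -[]; lia.
  have [_ _ n1] := N1; apply: (@double_fan_left n b e p P); first by lia.
    by move=> y yr; apply/negP=> /n1; lia.
  move=> y yr; apply/negP=> bpy; have [?|my] := np y bpy ltac:(lia); first by lia.
  by have := two_p _ _ bpy ltac:(lia) my bd' ltac:(lia) md2n; lia.
have far v : e <= v <= n -> mid b v -> (v = r + 1 /\ p = v + 1) \/ (v = p + 2 /\ r = v + 1).
  move=> vr mv; have ve := notmid _ _ mv eare; have vn := notmid _ _ mv earn.
  have [|c [d [? ? earc eard mcd]]] := run_bounds P ear0 eare _ mv; first lia.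
  by have := second c d ltac:(lia) ltac:(lia) earc eard mcd; lia.
have [r12 rn2 br1 br2 _] := Nr; have [p12 pn2 bp1 bp2 _] := Np.
have far1 v : e <= v <= n -> mid b v -> exists2 y, nbrs1 n b v y & mid b y.
  move=> vr mv; have fv := far v vr mv.
  suff one : forall y1 y2, v < y1 < y2 -> y2 < v + n -> b v y1 -> b v y2 -> False.
    have [y yr bvy] := vertex_meets v P.
    have N : nbrs1 n b v y.
      split=> //; first lia.
      move=> z bvz zr; case: (Z.lt_total z y) => [zy|[//|zy]]; exfalso.
        by apply: (one z y) => //; lia.
      by apply: (one y z) => //; lia.
    by exists y => //; apply: nbrs1_mid P N.
  move=> y1 y2 y12 yn by1 by2; case: fv => -[vE rE].
    have bb : b p (r - 1 + n).
      rewrite -wrap; apply/negPn/negP=> nb.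
      apply: (@adjacent_ears_degree n b r _ _ y1 y2 P _ _ r12 rn2 br1 br2) => //; try lia.
      - by have -> : r + 2 = p by lia.
      - by apply/orP; left.
      - by have -> : r + 1 = v by lia.
      by have -> : r + 1 = v by lia.
    have m1 : mid b (r - 1).
      have [?|m1] := np _ bb ltac:(lia); first by lia.
      by rewrite -(mper 1 _ (r - 1 + n)) //; lia.
    have := notmid _ _ m1 eare => ?.
    by have := far (r - 1) ltac:(lia) m1; lia.
  have bb : b (p + 1) (r + 1).
    apply/negPn/negP=> nb.
    apply: (@adjacent_ears_degree n b v y1 y2 (p + n + r - s) (p + n + 1 + r - s) P) => //; try lia.
    - by have -> : v - 1 = p + 1 by [lia]; have -> : v + 2 = r + 1 by lia.
    - by apply/orP; right; have -> : v + 1 = r by lia.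
    - by have -> : v + 1 = r by lia.
    by have -> : v + 1 = r by lia.
  have m1 : mid b (r + 1) by have [?|] := nq _ bb ltac:(lia); [lia |].
  have := notmid _ _ m1 earn => ?.
  by have := far (r + 1) ltac:(lia) m1; lia.
have farfree v j : e <= v <= n -> e <= j <= n -> mid b v -> ~~ b v j.
  move=> vr jr mv; apply/negP=> bvj; have [y [_ _ nv] my] := far1 v vr mv.
  have mj : mid b j.
    case: (Z.lt_total v j) => [vj|[vj|vj]].
    - by rewrite (nv j bvj) //; lia.
    - by rewrite -vj.
    have bjv : b v (j + n) by rewrite -wrap (crit_sym P).
    by rewrite -(mper 1 j (j + n)); [rewrite (nv _ bjv) //; lia | lia].
  have fv := far v vr mv; have fj := far j jr mj.
  by move: bvj; have -> : v = j by [lia]; apply/negP/(crit_irr P).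
have ufree u w : b u w -> e <= u < w -> w <= n ->
    (u = r /\ (w = p \/ w = p + 1)) \/ (w = r /\ (u = p \/ u = p + 1)).
  move=> buw uw wn; apply: link => //; apply/negP => m1.
    by have := farfree u w ltac:(lia) ltac:(lia) m1; rewrite buw.
  by have := farfree w u ltac:(lia) ltac:(lia) m1; rewrite (crit_sym P) buw.
have [|||I HI] := @attachment_function n b e (fun j => j <> r) P _ mids; first by lia.
- move=> j jr jnr; case mj: (mid b j).
    have [y N _] := far1 j ltac:(lia) mj; exact: nbrs1_attached N.
  have [[y N]|[y1 [y2 N]]] := ear_cases P (negbT mj); first exact: nbrs1_attached N.
  by case: (deg2 j y1 y2 ltac:(lia) (negbT mj) N) => // ->.
- by move=> j v jr _ vr mv; apply: farfree => //; lia.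
have HI' j : e - 2 + 3 <= j < n -> j <> r -> 1 <= I j <= e - 2 + 1 /\
    forall x, 1 <= x <= e - 2 + 1 -> b x j <-> x = I j.
  move=> jr jnr; have [Ir bI] := HI j ltac:(lia) jnr.
  by split; [lia | move=> x xr; apply: bI; lia].
case: (Z.eq_dec p e) => [pe|pe].
  apply: (@bouquet_at_right_end n b (e - 2) r I P) => //; try lia.
  - by move=> v vr; apply: mids; lia.
  - by have -> : e - 2 + 2 = e by lia.
  - by have -> : e - 2 + 2 = p by lia.
  - by have -> : e - 2 + 3 = p + 1 by lia.
  - by move=> u w /ufree; lia.
  by move=> x xr; apply: rlow; lia.
case: (Z.eq_dec (p + 1) n) => [qn|qn].
  apply: (@bouquet_at_left_end n b (e - 2) r I P) => //; try lia.
  - by move=> v vr; apply: mids; lia.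
  - by rewrite (crit_sym P) -qn.
  - by rewrite (crit_sym P); have -> : n - 1 = p by lia.
  - by move=> u w /ufree; lia.
  by move=> x xr; apply: rlow; lia.
exfalso.
have ter : tri b e r.
  by apply: tri_free_fanl => //; [lia | move=> y yr; apply/negP=> /ufree; lia].
have t0 : tri b 0 r.
  apply: (tri_fanr side ter); first by lia.
  move=> x xr; case: (Z.eq_dec x e) => [->|?]; last by apply: rlow; lia.
  by apply/negP=> /ufree; lia.
apply: (tri_close P t0); [lia | lia | lia |].
by move=> y yr; rewrite (crit_wrap0 y P); apply/negP=> /ufree; lia.
Qed.

(** * The possible patterns of joined ears *)

(** If y1 and y2 were not consecutive, [two_spokes] would make one of them a middle. *)
Lemma ear_nbrs_adjacent (n : Z) (b : Z -> Z -> bool) (v y1 y2 : Z) : crit n b ->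
  ~~ mid b v -> ~~ mid b y1 -> ~~ mid b y2 -> v < y1 < y2 -> y2 < v + n ->
  b v y1 -> b v y2 -> y2 = y1 + 1 /\ nbrs2 n b v y1 y2.
Proof.
move=> P ev e1 e2 v12 v2n b1 b2.
have [z1 [z2 Nz]] := linked_ears_nbrs2 P ev e1 ltac:(lia) b1.
have Nv := nbrs2_known Nz v12 v2n b1 b2; split=> //; have [_ _ _ _ nv] := Nv.
case: (Z_le_gt_dec (y1 + 2) y2) => ?; last by lia.
have r1 := @chord_range _ _ v y1 P ltac:(lia) b1.
have r2 := @chord_range _ _ v y2 P ltac:(lia) b2.
have [||||m|m] := @two_spokes n b v y1 y2 P; try lia.
- by move=> y yr by_; apply: nv.
- by rewrite m in e1.
by rewrite m in e2.
Qed.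

(** The run containing the middle neighbour of p is rotated to follow 0. The ear q lies before or
    after it, which decides whether p or q comes first in the new labels. *)
Lemma pair_case (n : Z) (b : Z -> Z -> bool) (p q : Z) : crit n b ->
  ~~ mid b p -> ~~ mid b q -> p < q < p + n -> b p q ->
  (forall y, b p y -> p < y < p + n -> y = q \/ mid b y) ->
  (forall y, b q y -> q < y < q + n -> y = p + n \/ mid b y) -> chords3 n b.
Proof.
move=> P ep eq pq bpq np nq; have n5 := crit_n P.
have wrap x y := crit_wrap x y P.
have mper k v w : w = v + k * n -> mid b w = mid b v by apply: mid_per P.
have bper k l x y x' y' : x' = x + k * n -> y' = y + l * n -> b x' y' = b x y.
  exact: crit_per2 P.
have epn : ~~ mid b (p + n) by rewrite (mper 1 p) //; lia.
have pq2 := chord_range P pq bpq.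
have [_ [x [xr bpx mx _]]] := linked_ear_attached P ep eq pq bpq np.
have [c cr [ec cmax]] := @Zlast (fun v => ~~ mid b v) p x ltac:(lia) ep.
have [e er [ee emin]] := @Zfirst (fun v => ~~ mid b v) x (p + n) ltac:(lia) epn.
have cx : c <> x by move=> E; rewrite E mx in ec.
have ex : e <> x by move=> E; rewrite E mx in ee.
have run v : c < v < e -> mid b v.
  by move=> vr; case: (Z_le_gt_dec v x) => ?; apply/negPn; [apply: cmax | apply: emin]; lia.
have Pc := crit_shift c P.
have mE v w : w = v + c -> mid (shift c b) v = mid b w by apply: mid_shift.
apply: (@chords3_shift n b c).
have e0 : ~~ mid (shift c b) 0 by rewrite (mE 0 c).
have ee' : ~~ mid (shift c b) (e - c) by rewrite (mE _ e) //; lia.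
have run' v : 1 <= v < e - c -> mid (shift c b) v by move=> vr; rewrite (mE _ (v + c)) //; apply: run; lia.
have ep' : ~~ mid (shift c b) (p + n - c) by rewrite (mE _ (p + n)) //; lia.
case: (Z_le_gt_dec q c) => qc.
  apply: (linked_ears_case (p := p + n - c) (q := q + n - c) Pc e0 ee' run') => //; try lia.
  - by rewrite (mE _ (q + n)) ?(mper 1 q) //; lia.
  - by rewrite /shift (bper 1 1 p q) //; lia.
  - move=> y; rewrite /shift (bper 1 1 p (y + c - n)); [|lia|lia] => /np H yr.
    case: H => [|?|my]; [lia | left; lia | right].
    by rewrite (mE _ (y + c)) // (mper 1 (y + c - n)) //; lia.
  - move=> y; rewrite /shift (bper 1 1 q (y + c - n)); [|lia|lia] => /nq H yr.
    case: H => [|?|my]; [lia | left; lia | right].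
    by rewrite (mE _ (y + c)) // (mper 1 (y + c - n)) //; lia.
  exists (x - c); first lia.
  by apply/orP; left; rewrite /shift (crit_sym P) (bper 1 0 p x) //; lia.
have qe : e <= q.
  by case: (Z_le_gt_dec e q) => // ?; rewrite (run q) // in eq; lia.
apply: (linked_ears_case (p := q - c) (q := p + n - c) Pc e0 ee' run') => //; try lia.
- by rewrite (mE _ q) //; lia.
- by rewrite /shift (bper 0 1 q p) ?(crit_sym P q) //; lia.
- move=> y; rewrite /shift (bper 0 0 q (y + c)); [|lia|lia] => /nq H yr.
  case: H => [|?|my]; [lia | left; lia | right].
  by rewrite (mE _ (y + c)).
- move=> y; rewrite /shift (bper 1 1 p (y + c - n)); [|lia|lia] => /np H yr.
  case: H => [|?|my]; [lia | left; lia | right].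
  by rewrite (mE _ (y + c)) // (mper 1 (y + c - n)) //; lia.
exists (x - c); first lia.
by apply/orP; right; rewrite /shift (crit_sym P) (bper 1 0 p x) //; lia.
Qed.

Lemma square_case (n : Z) (b : Z -> Z -> bool) (p s : Z) : crit n b ->
  p + 3 <= s <= p + n - 3 -> nbrs2 n b p s (s + 1) -> nbrs2 n b (p + 1) s (s + 1) ->
  nbrs2 n b s (p + n) (p + n + 1) -> nbrs2 n b (s + 1) (p + n) (p + n + 1) -> chords3 n b.
Proof.
move=> P ps Np Nq Ns Nt; have n5 := crit_n P.
apply: (@chords3_shift n b (s + 1)).
apply: (bouquet_of_square (p := p - (s + 1) + n) (crit_shift (s + 1) P)); first lia.
- by apply: (nbrs2_shift (k := 0) P Nt); lia.
- by apply: (nbrs2_shift (k := 1) P Np); lia.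
- by apply: (nbrs2_shift (k := 1) P Nq); lia.
by apply: (nbrs2_shift (k := 1) P Ns); lia.
Qed.

(** If p or p + 1 has an ear neighbour besides r, this one is next to r and the four ears form a
    square. Otherwise both have a middle neighbour, one of which lies in a run of length at least
    two, as required for [ear_linked_to_side_case]. *)
Lemma side_link_case (n : Z) (b : Z -> Z -> bool) (r p : Z) : crit n b ->
  ~~ mid b r -> ~~ mid b p -> ~~ mid b (p + 1) -> r < p -> p + 1 < r + n ->
  b r p -> b r (p + 1) -> chords3 n b.
Proof.
move=> P er ep eq rp pn brp brq; have n5 := crit_n P.
have wrap x y := crit_wrap x y P.
have mper k v w : w = v + k * n -> mid b w = mid b v by apply: mid_per P.
have bper k l x y x' y' : x' = x + k * n -> y' = y + l * n -> b x' y' = b x y.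
  exact: crit_per2 P.
have earper v : ~~ mid b v -> ~~ mid b (v + n) by rewrite (mper 1 v) //; lia.
have [_ Nr] := ear_nbrs_adjacent P er ep eq ltac:(lia) pn brp brq.
pose s := r + n; have sE : s = r + n by []; clearbody s.
have es : ~~ mid b s by rewrite sE; apply: earper.
have bps : b p s by rewrite sE -wrap.
have bqs : b (p + 1) s by rewrite sE -wrap.
have r1 := @chord_range _ _ p s P ltac:(lia) bps.
have r2 := @chord_range _ _ (p + 1) s P ltac:(lia) bqs.
have Ns : nbrs2 n b s (p + n) (p + n + 1) by apply: (nbrs2_per (k := 1) P Nr); lia.
have [_ _ _ _ ns] := Ns.
have [p1 [p2 Np]] := linked_ears_nbrs2 P ep es ltac:(lia) bps.
have [q1 [q2 Nq]] := linked_ears_nbrs2 P eq es ltac:(lia) bqs.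
have square y y1 y2 : ~~ mid b y -> nbrs2 n b y y1 y2 -> p + 3 <= y <= p + n - 2 ->
    y = s - 1 \/ y = s + 1 -> chords3 n b.
  move=> ey Ny yr ys.
  have bpy : b p y by apply: (degree_two_ears_linked P ep ey _ Np Ny); lia.
  have bqy : b (p + 1) y by apply: (degree_two_ears_linked P eq ey _ Nq Ny); lia.
  have Ny' : nbrs2 n b y (p + n) (p + n + 1).
    apply: (nbrs2_known Ny); [lia | lia | by rewrite -wrap |].
    by have -> : p + n + 1 = p + 1 + n by [lia]; rewrite -wrap.
  case: ys => yE.
    have sy : s = y + 1 by lia.
    rewrite sy in bps bqs Ns.
    apply: (square_case (p := p) (s := y) P) => //; first lia.
      by apply: (nbrs2_known Np) => //; lia.
    by apply: (nbrs2_known Nq) => //; lia.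
  rewrite yE in bpy bqy Ny'.
  apply: (square_case (p := p) (s := s) P) => //; first lia.
    by apply: (nbrs2_known Np) => //; lia.
  by apply: (nbrs2_known Nq) => //; lia.
have linked_deg v y : ~~ mid b v -> ~~ mid b y -> v < y < v + n -> b v y ->
    exists y1 y2, nbrs2 n b y y1 y2.
  move=> ev ey vy bvy; apply: (linked_ears_nbrs2 P ey (earper v ev)); first by lia.
  by rewrite -wrap.
have near_s v y : v < s < v + n -> b v s -> ~~ mid b v -> ~~ mid b y -> b v y -> v < y < v + n -> y <> s ->
    y = s - 1 \/ y = s + 1.
  move=> vs bvs ev ey bvy vy ne; case: (Z_lt_ge_dec y s) => ?.
    by have [? _] := ear_nbrs_adjacent P ev ey es ltac:(lia) ltac:(lia) bvy bvs; lia.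
  by have [? _] := ear_nbrs_adjacent P ev es ey ltac:(lia) ltac:(lia) bvs bvy; lia.
have [[y yr /and3P[bpy ey /negP ne]]|np0] :=
    Zrange_dec (fun y => [&& b p y, ~~ mid b y & ~~ (y =? s)]) (p + 1) (p + n).
  have ys : y <> s by move=> E; apply: ne; apply/Z.eqb_spec.
  have sE' := near_s p y ltac:(lia) bps ep ey bpy ltac:(lia) ys.
  have [y1 [y2 Ny]] := linked_deg p y ep ey ltac:(lia) bpy.
  have yr' := @chord_range _ _ p y P ltac:(lia) bpy.
  apply: (square y y1 y2 ey Ny) => //.
  suff : y <> p + 2 by lia.
  by move=> E; move: ey; rewrite (@mid_at b (p + 1) y s) ?bqs //; lia.
have [[y yr /and3P[bqy ey /negP ne]]|nq0] :=
    Zrange_dec (fun y => [&& b (p + 1) y, ~~ mid b y & ~~ (y =? s)]) (p + 2) (p + 1 + n).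
  have ys : y <> s by move=> E; apply: ne; apply/Z.eqb_spec.
  have sE' := near_s (p + 1) y ltac:(lia) bqs eq ey bqy ltac:(lia) ys.
  have [y1 [y2 Ny]] := linked_deg (p + 1) y eq ey ltac:(lia) bqy.
  have yr' := @chord_range _ _ (p + 1) y P ltac:(lia) bqy.
  apply: (square y y1 y2 ey Ny) => //.
  suff : y <> p + n - 1 by lia.
  move=> E; move: ey; rewrite (@mid_at b s y (p + n)) -?wrap ?(crit_sym P s) ?bps //; lia.
have np y : b p y -> p < y < p + n -> y = s \/ mid b y.
  move=> bpy yr; have := np0 y ltac:(lia); rewrite bpy /= negb_and !negbK.
  by case/orP=> [?|/Z.eqb_spec ->]; [right | left].
have nq y : b (p + 1) y -> p + 1 < y < p + 1 + n -> y = s \/ mid b y.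
  move=> bqy yr; have := nq0 y ltac:(lia); rewrite bqy /= negb_and !negbK.
  by case/orP=> [?|/Z.eqb_spec ->]; [right | left].
have [_ [x [xr bpx mx _]]] := linked_ear_attached P ep es ltac:(lia) bps np.
have [_ [y [yr bqy my _]]] := linked_ear_attached P eq es ltac:(lia) bqs nq.
have xr' := chord_range P xr bpx; have yr' := chord_range P yr bqy.
have epn := earper p ep.
have bounds z : p + 1 < z < p + n -> mid b z -> exists c e, [/\ p + 1 <= c < z, z < e <= p + n,
    ~~ mid b c, ~~ mid b e & forall v, c < v < e -> mid b v].
  move=> zr mz.
  have [c cr [ec cmax]] := @Zlast (fun v => ~~ mid b v) (p + 1) z ltac:(lia) eq.
  have [e er' [ee emin]] := @Zfirst (fun v => ~~ mid b v) z (p + n) ltac:(lia) epn.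
  have cx : c <> z by move=> E; rewrite E mz in ec.
  have ex : e <> z by move=> E; rewrite E mz in ee.
  exists c, e; split=> //; try lia.
  by move=> v vr; case: (Z_le_gt_dec v z) => ?; apply/negPn; [apply: cmax | apply: emin]; lia.
have long c e : p + 1 <= c -> c + 3 <= e -> e <= p + n -> ~~ mid b c -> ~~ mid b e ->
    (forall v, c < v < e -> mid b v) -> chords3 n b.
  move=> pc ce epn' ec ee run.
  have Pc := crit_shift c P.
  have mE v w : w = v + c -> mid (shift c b) v = mid b w by apply: mid_shift.
  have sout : s <= c \/ e <= s.
    case: (Z_le_gt_dec s c) => ?; first by left.
    by case: (Z_le_gt_dec e s) => ?; [right | move: es; rewrite (run s) //; lia].
  apply: (@chords3_shift n b c).
  have [r' r'E sr'] : exists2 r', e - c <= r' <= n & s + n - c = r' \/ s + n - c = r' + n.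
    by case: sout => ?; [exists (s + n - c); lia | exists (s - c); lia].
  have bE v w : shift c b (v + n - c) w = b v (w + c - n).
    by rewrite /shift; apply: (bper 1 1); lia.
  have mE' w : mid (shift c b) w = mid b (w + c - n).
    by rewrite (mE _ (w + c)) // (mper 1 (w + c - n)) //; lia.
  have bE1 w : shift c b (p + n - c + 1) w = b (p + 1) (w + c - n).
    by rewrite -bE; congr (shift c b _ _); lia.
  apply: (ear_linked_to_side_case (e := e - c) (p := p + n - c) (r := r') (s := s + n - c) Pc) => //; try lia.
  - by rewrite (mE 0 c).
  - by rewrite (mE _ e) //; lia.
  - by move=> v vr; rewrite (mE _ (v + c)) //; apply: run; lia.
  - by rewrite (mE _ (p + n)) //; lia.
  - by rewrite mE'; have -> : p + n - c + 1 + c - n = p + 1 by lia.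
  - rewrite mE'; case: sr' => E.
      by have -> : r' + c - n = s by lia.
    by rewrite -(mper 1 _ s) //; lia.
  - by rewrite bE; have -> : s + n - c + c - n = s by lia.
  - by rewrite bE1; have -> : s + n - c + c - n = s by lia.
  - by move=> w; rewrite bE mE' => /np H wr; case: H => [|?|?]; [lia | left; lia | right].
  - by move=> w; rewrite bE1 mE' => /nq H wr; case: H => [|?|?]; [lia | left; lia | right].
  by move=> w; rewrite bE => /ns; lia.
have singleton c e : p + 1 <= c -> e = c + 2 -> e <= p + n -> ~~ mid b c -> ~~ mid b e ->
    mid b (c + 1) -> (c = p + 1 /\ s = p + 3) \/ (c = s /\ e = p + n).
  move=> pc ce epn' ec ee mc1.
  have bce : b c e by rewrite -(@mid_at _ _ (c + 1)) //; lia.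
  case: (Z.eq_dec c (p + 1)) => [cE|cp].
    left; split=> //; rewrite cE in bce; have [|] := nq e bce ltac:(lia); first by lia.
    by rewrite (negbTE ee).
  right; have [c1 [c2 Nc]] := linked_ears_nbrs2 P ec ee ltac:(lia) bce.
  have bpc : b p c by apply: (degree_two_ears_linked P ep ec _ Np Nc); lia.
  have cs : c = s by have [|] := np c bpc ltac:(lia); [lia | rewrite (negbTE ec)].
  by rewrite cs in bce; have := ns e bce ltac:(lia); lia.
have [c [e [cx xe ec ee run]]] := bounds x ltac:(lia) mx.
case: (Z_le_gt_dec (c + 3) e) => ce; first by apply: (long c e) => //; lia.
have H1 := singleton c e ltac:(lia) ltac:(lia) ltac:(lia) ec ee (run (c + 1) ltac:(lia)).
have [d [f [dy yf ed ef run']]] := bounds y ltac:(lia) my.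
case: (Z_le_gt_dec (d + 3) f) => df; first by apply: (long d f) => //; lia.
have H2 := singleton d f ltac:(lia) ltac:(lia) ltac:(lia) ed ef (run' (d + 1) ltac:(lia)).
(* If both runs were single vertices, then x = p + 2 and s = p + 3, while y = p + n - 1 and s = p +
   n - 2; this gives n = 5. *)
lia.
Qed.

Lemma linked_case (n : Z) (b : Z -> Z -> bool) (p q : Z) : crit n b ->
  ~~ mid b p -> ~~ mid b q -> p < q < p + n -> b p q -> chords3 n b.
Proof.
move=> P ep eq pq bpq; have wrap x y := crit_wrap x y P.
have epn : ~~ mid b (p + n) by rewrite (@mid_per n b 1 p) //; lia.
have bqp : b q (p + n) by rewrite -wrap.
have side v w y : ~~ mid b v -> ~~ mid b w -> ~~ mid b y -> v < w < v + n -> v < y < v + n ->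
    y <> w -> b v w -> b v y -> chords3 n b.
  move=> ev ew ey vw vy ne bw by_; case: (Z_lt_ge_dec y w) => ?.
    have [E _] := ear_nbrs_adjacent P ev ey ew ltac:(lia) ltac:(lia) by_ bw.
    by rewrite E in ew bw; apply: (side_link_case P ev ey ew) => //; lia.
  have [E _] := ear_nbrs_adjacent P ev ew ey ltac:(lia) ltac:(lia) bw by_.
  by rewrite E in ey by_; apply: (side_link_case P ev ew ey) => //; lia.
have [[y yr /and3P[bpy ey /negP ne]]|np] :=
    Zrange_dec (fun y => [&& b p y, ~~ mid b y & ~~ (y =? q)]) (p + 1) (p + n).
  apply: (side p q y) => //; first lia.
  by move=> E; apply: ne; apply/Z.eqb_spec.
have [[y yr /and3P[bqy ey /negP ne]]|nq] :=
    Zrange_dec (fun y => [&& b q y, ~~ mid b y & ~~ (y =? p + n)]) (q + 1) (q + n).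
  apply: (side q (p + n) y) => //; [lia | lia |].
  by move=> E; apply: ne; apply/Z.eqb_spec.
apply: (pair_case P ep eq pq bpq) => y byy yr.
  have := np y ltac:(lia); rewrite byy /= negb_and !negbK.
  by case/orP=> [?|/Z.eqb_spec ->]; [right | left].
have := nq y ltac:(lia); rewrite byy /= negb_and !negbK.
by case/orP=> [?|/Z.eqb_spec ->]; [right | left].
Qed.

Lemma chords_classification (n : Z) (b : Z -> Z -> bool) : crit n b ->
  [\/ chords1 n b, chords2 n b | chords3 n b].
Proof.
move=> P; have n5 := crit_n P.
have mper k v w : w = v + k * n -> mid b w = mid b v by apply: mid_per P.
have [N NE] : exists N : nat, Z.of_nat N = n by exists (Z.to_nat n); lia.
pose linked u d := [&& 0 <? d, ~~ mid b u, ~~ mid b (u + d) & b u (u + d)].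
(* By periodicity it is enough to search one period for a start u and a distance d, which makes the
   question boolean. *)
case E: [exists u : 'I_N, exists d : 'I_N, linked (Z.of_nat u) (Z.of_nat d)].
  have [u /existsP[d /and4P[/Z.ltb_spec0 d0 eu ew buw]]] := existsP E.
  have /ltP dN := ltn_ord d; apply: Or33; apply: (linked_case P eu ew _ buw).
  lia.
have unl : unlinked n b.
  move=> u w uw buw; case mu: (mid b u); first by left.
  case mw: (mid b w); [by right | exfalso].
  have un := Z.mod_pos_bound u n ltac:(lia); have uE := Z.div_mod u n ltac:(lia).
  have uN : (Z.to_nat (u mod n) < N)%nat by apply/ltP; lia.
  have dN : (Z.to_nat (w - u) < N)%nat by apply/ltP; lia.
  move/existsP: E; apply; exists (Ordinal uN); apply/existsP; exists (Ordinal dN).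
  rewrite /= !Z2Nat.id; try lia; apply/and4P; split.
  - by apply/Z.ltb_spec0; lia.
  - by rewrite (mper (- (u / n)) u) ?mu //; lia.
  - by rewrite (mper (- (u / n)) w) ?mw //; lia.
  by rewrite (@crit_per2 _ _ (- (u / n)) (- (u / n)) u w _ _ P) //; lia.
by case: (unlinked_case P unl); [apply: Or31 | apply: Or32].
Qed.

(** * Labels modulo n *)

Lemma label_subproof (n : nat) (x : Z) : (Z.to_nat (x mod Z.of_nat n.+1) < n.+1)%nat.
Proof. by apply/ltP; have := Z.mod_pos_bound x (Z.of_nat n.+1); lia. Qed.

Definition label (n : nat) (x : Z) : 'I_n.+1 := Ordinal (label_subproof n x).

Definition zedge (n : nat) (x y : Z) : {set 'I_n.+1} := [set label n x; label n y].

Lemma label_val (n : nat) (x : Z) : Z.of_nat (label n x) = x mod Z.of_nat n.+1.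
Proof. by apply: Z2Nat.id; have := Z.mod_pos_bound x (Z.of_nat n.+1); lia. Qed.

Lemma label_eq (n : nat) (x y : Z) :
  x mod Z.of_nat n.+1 = y mod Z.of_nat n.+1 -> label n x = label n y.
Proof. by move=> E; apply: val_inj; apply: Nat2Z.inj; rewrite !label_val. Qed.

(** K is the multiple of the number of vertices at which the labels restart from 0. *)
Lemma label_window (n : nat) (r : Z) : exists2 K, r < K <= r + Z.of_nat n.+1 &
  forall u, r <= u < r + Z.of_nat n.+1 ->
    u < K /\ Z.of_nat (label n u) = u - K + Z.of_nat n.+1 \/ K <= u /\ Z.of_nat (label n u) = u - K.
Proof.
set N := Z.of_nat n.+1; have N0 : 0 < N by lia.
have rE := Z.div_mod r N ltac:(lia); have rb := Z.mod_pos_bound r N N0.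
exists (N * (r / N) + N) => [|u ur]; first lia.
rewrite label_val -/N; case: (Z_lt_ge_dec u (N * (r / N) + N)) => h; [left | right].
  by split=> //; rewrite -(Z.mod_unique u N (r / N) (u - N * (r / N))); [| left |]; lia.
split; first by lia.
rewrite -(Z.mod_unique u N (r / N + 1) (u - (N * (r / N) + N))); [by [] | left; lia | ring].
Qed.

Lemma label_inj (n : nat) (r x y : Z) : r <= x < r + Z.of_nat n.+1 ->
  r <= y < r + Z.of_nat n.+1 -> label n x = label n y -> x = y.
Proof.
move=> xr yr E; have [K Kr H] := label_window n r.
by have := H x xr; have := H y yr; rewrite E; lia.
Qed.

Lemma label_per (n : nat) (x : Z) : label n (x + Z.of_nat n.+1) = label n x.
Proof.
by apply: label_eq; rewrite -{1}(Z.mul_1_l (Z.of_nat n.+1)) Z_mod_plus_full.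
Qed.

Lemma label_onto (n : nat) (r : Z) (a : 'I_n.+1) :
  exists2 x, r <= x < r + Z.of_nat n.+1 & label n x = a.
Proof.
set N := Z.of_nat n.+1; have N0 : 0 < N by lia.
exists (r + (Z.of_nat a - r) mod N).
  by have := Z.mod_pos_bound (Z.of_nat a - r) N N0; lia.
apply: val_inj; apply: Nat2Z.inj; rewrite label_val -/N Zplus_mod_idemp_r.
have -> : r + (Z.of_nat a - r) = Z.of_nat a by lia.
by have /ltP ? := ltn_ord a; rewrite Z.mod_small //; lia.
Qed.

Lemma set2_eq (T : finType) (a b c d : T) : [set a; b] = [set c; d] ->
  (a = c /\ b = d) \/ (a = d /\ b = c).
Proof.
move=> E; have mem x : (x == a) || (x == b) = (x == c) || (x == d).
  by have := congr1 (fun s : {set T} => x \in s) E; rewrite !inE.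
have := mem a; have := mem b; have := mem c; have := mem d; rewrite !eqxx ?orbT /=.
move=> /orP[]/eqP cE /orP[]/eqP dE /esym/orP[]/eqP aE /esym/orP[]/eqP bE; subst; auto.
Qed.

Lemma zedgeC (n : nat) (x y : Z) : zedge n x y = zedge n y x.
Proof. exact: setUC. Qed.

Lemma zedge_inj (n : nat) (r x y u w : Z) : r <= x < y -> y < r + Z.of_nat n.+1 ->
  r <= u < w -> w < r + Z.of_nat n.+1 -> zedge n x y = zedge n u w -> x = u /\ y = w.
Proof.
move=> xy yr uw wr /set2_eq[] [/(@label_inj n r) H1 /(@label_inj n r) H2].
  by split; [apply: H1 | apply: H2]; lia.
by have := H1 ltac:(lia) ltac:(lia); have := H2 ltac:(lia) ltac:(lia); lia.
Qed.

Lemma zedge_onto (n : nat) (r : Z) (a b : 'I_n.+1) : a <> b ->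
  exists x y, [/\ r <= x < y, y < r + Z.of_nat n.+1 & [set a; b] = zedge n x y].
Proof.
move=> ab; move: ab; have [x xr <-] := label_onto r a; have [y yr <-] := label_onto r b => ab.
case: (Z.lt_total x y) => [?|[E|?]].
- by exists x, y; split=> //; lia.
- by case: ab; rewrite E.
by exists y, x; split; [lia | lia | rewrite zedgeC].
Qed.

Lemma cross_sym (n : nat) (e f : {set 'I_n}) : cross e f = cross f e.
Proof. exact: orbC. Qed.

Lemma crossP (n : nat) (e f : {set 'I_n}) : reflect
  (exists a b c d : 'I_n, [/\ (a < c)%nat, (c < b)%nat, (b < d)%nat &
     (e = [set a; b] /\ f = [set c; d]) \/ (f = [set a; b] /\ e = [set c; d])])
  (cross e f).
Proof.
apply: (iffP idP).
  case/orP=> /existsP[a /existsP[b /existsP[c /existsP[d /and5P[/eqP-> /eqP-> ac cb bd]]]]];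
  by exists a, b, c, d; split=> //; first [by left | by right].
case=> a [b [c [d [ac cb bd [] [-> ->]]]]]; apply/orP; [left | right];
by apply/existsP; exists a; apply/existsP; exists b; apply/existsP; exists c;
   apply/existsP; exists d; rewrite !eqxx ac cb bd.
Qed.

(** Interleaving is a cyclic notion, while [cross] compares labels linearly; the five cases are the
    possible positions of the restart K relative to x < z < y < w. *)
Lemma crossing (n : nat) (r x y z w : Z) :
  r <= x < z -> z < y < w -> w < r + Z.of_nat n.+1 -> cross (zedge n x y) (zedge n z w).
Proof.
move=> rx zy wr; have [K Kr H] := label_window n r.
have Hx := H x ltac:(lia); have Hy := H y ltac:(lia); have Hz := H z ltac:(lia); have Hw := H w ltac:(lia).
apply/crossP.
have mk a b c d : Z.of_nat (label n a) < Z.of_nat (label n c) ->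
    Z.of_nat (label n c) < Z.of_nat (label n b) -> Z.of_nat (label n b) < Z.of_nat (label n d) ->
    (zedge n x y = zedge n a b /\ zedge n z w = zedge n c d) \/
    (zedge n z w = zedge n a b /\ zedge n x y = zedge n c d) -> exists a b c d : 'I_n.+1,
    [/\ (a < c)%nat, (c < b)%nat, (b < d)%nat & (zedge n x y = [set a; b] /\ zedge n z w = [set c; d]) \/
       (zedge n z w = [set a; b] /\ zedge n x y = [set c; d])].
  move=> ac cb bd E; exists (label n a), (label n b), (label n c), (label n d).
  by split=> //; apply/ltP; lia.
case: (Z_lt_ge_dec x K) => xK; last by apply: (mk x y z w); [lia | lia | lia | left].
case: (Z_lt_ge_dec z K) => zK; last first.
  by apply: (mk z w y x); [lia | lia | lia | right; split=> //; exact: zedgeC].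
case: (Z_lt_ge_dec y K) => yK; last first.
  by apply: (mk y x w z); [lia | lia | lia | left; split; exact: zedgeC].
case: (Z_lt_ge_dec w K) => wK; first by apply: (mk x y z w); [lia | lia | lia | left].
by apply: (mk w z x y); [lia | lia | lia | right; split=> //; exact: zedgeC].
Qed.

Lemma crossing_inv (n : nat) (r x y z w : Z) :
  r <= x < y -> y < r + Z.of_nat n.+1 -> r <= z < w -> w < r + Z.of_nat n.+1 ->
  cross (zedge n x y) (zedge n z w) -> (x < z < y /\ y < w) \/ (z < x < w /\ w < y).
Proof.
move=> xy yr zw wr /crossP[a [b [c [d [/ltP ac /ltP cb /ltP bd]]]]].
have [K Kr H] := label_window n r.
have Hx := H x ltac:(lia); have Hy := H y ltac:(lia); have Hz := H z ltac:(lia); have Hw := H w ltac:(lia).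
by case=> -[/set2_eq[] [E1 E2] /set2_eq[] [E3 E4]]; subst; lia.
Qed.

Lemma diagonal_zedge (n : nat) (x y : Z) : x + 2 <= y < x + Z.of_nat n -> diagonal (zedge n x y).
Proof.
move=> xy; have [K Kr H] := label_window n x.
have Hx := H x ltac:(lia); have Hy := H y ltac:(lia).
have mk a b : Z.of_nat (label n a) + 1 < Z.of_nat (label n b) ->
    Z.of_nat (label n b) < Z.of_nat (label n a) + Z.of_nat n -> diagonal [set label n a; label n b].
  move=> ab ba; apply/existsP; exists (label n a); apply/existsP; exists (label n b).
  apply/and3P; split; [exact: eqxx | by apply/ltP; lia |].
  apply/negP=> /andP[/eqP a0 /eqP bn]; have {}a0 : nat_of_ord (label n a) = 0%nat := a0.
  by have {}bn : nat_of_ord (label n b) = n := bn; lia.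
case: Hx => -[Kx Hx]; case: Hy => -[Ky Hy]; try by apply: mk; lia.
by rewrite zedgeC; apply: mk; lia.
Qed.

Lemma diagonal_inv (n : nat) (r : Z) (e : {set 'I_n.+1}) : diagonal e ->
  exists x y, [/\ r <= x, x + 2 <= y, y < r + Z.of_nat n.+1, y < x + Z.of_nat n & e = zedge n x y].
Proof.
case/existsP=> a /existsP[b /and3P[/eqP eE /ltP ab nab]].
have [|x [y [rx yr E]]] := zedge_onto r (a := a) (b := b); first by move=> E; rewrite E in ab; lia.
rewrite E in eE.
have [K Kr H] := label_window n r.
have Hx := H x ltac:(lia); have Hy := H y ltac:(lia).
have /ltP bn := ltn_ord b.
have ba : ~ (nat_of_ord a = 0%nat /\ nat_of_ord b = n).
  case=> a0 bn'; have : ~~ ((nat_of_ord a == 0%nat) && (nat_of_ord b == n)) := nab.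
  by rewrite a0 bn' !eqxx.
have xy : x + 2 <= y /\ y < x + Z.of_nat n.
  by case/set2_eq: E => -[E1 E2]; subst; lia.
by exists x, y; split=> //; lia.
Qed.

(** * From triangulated intervals to triangulations of the polygon and back *)

(** S collects the cut chords that are not sides, without the closing chord. It is maximal because a
    further chord passing over c starts at x and crosses (c, y), or starts later and crosses (x,
    c). *)
Lemma tri_triangulation (b : Z -> Z -> bool) (x y : Z) : tri b x y -> exists S : Z -> Z -> bool,
  [/\ forall u w, S u w -> [/\ x <= u, u + 2 <= w <= y, (u, w) <> (x, y) & ~~ b u w],
      forall u w u' w', S u w -> S u' w' -> u < u' < w -> w < w' -> False &
      forall u w, x <= u -> u + 2 <= w <= y -> (u, w) <> (x, y) -> ~~ S u w ->
        exists u' w', S u' w' /\ ((u < u' < w /\ w < w') \/ (u' < u < w' /\ w' < w))].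
Proof.
elim=> {x y} [x|x c y xcy bxc bcy _ [S1 [S1r S1c S1m]] _ [S2 [S2r S2c S2m]]].
  by exists (fun _ _ => false); split=> // u w; lia.
pose S u w := [|| S1 u w, S2 u w, [&& u =? x, w =? c & x + 2 <=? c] |
                 [&& u =? c, w =? y & c + 2 <=? y]].
have SP u w : S u w -> [\/ S1 u w, S2 u w, [/\ u = x, w = c & x + 2 <= c] |
    [/\ u = c, w = y & c + 2 <= y]].
  case/or4P=> [?|?|/and3P[/Z.eqb_spec ? /Z.eqb_spec ? /Z.leb_spec0 ?]|/and3P[/Z.eqb_spec ? /Z.eqb_spec ? /Z.leb_spec0 ?]].
  - exact: Or41.
  - exact: Or42.
  - exact: Or43.
  exact: Or44.
have Sl : x + 2 <= c -> S x c.
  by move=> h; rewrite /S !Z.eqb_refl; have -> := introT (Z.leb_spec0 _ _) h; rewrite /= !orbT.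
have Sr : c + 2 <= y -> S c y.
  by move=> h; rewrite /S !Z.eqb_refl; have -> := introT (Z.leb_spec0 _ _) h; rewrite /= !orbT.
exists S; split.
- move=> u w /SP[/S1r[? ? ? ?]|/S2r[? ? ? ?]|[-> -> ?]|[-> -> ?]]; split=> //; try lia;
  by case; lia.
- move=> u w u' w' /SP[H|H|H|H] /SP[H'|H'|H'|H'] ? ?;
  try (by apply: (S1c u w u' w')); try (by apply: (S2c u w u' w'));
  try (case/S1r: H => ? ? ? ?); try (case/S1r: H' => ? ? ? ?);
  try (case/S2r: H => ? ? ? ?); try (case/S2r: H' => ? ? ? ?);
  try (case: H => ? ? ?); try (case: H' => ? ? ?); lia.
move=> u w xu uw ne nS; have [n1 n2] : ~~ S1 u w /\ ~~ S2 u w.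
  by split; apply: contra nS => h; rewrite /S h ?orbT.
case: (Z_le_gt_dec w c) => wc.
  case: (Z.eq_dec u x) => ux; [case: (Z.eq_dec w c) => wc'|].
  - by exfalso; move: nS; rewrite ux wc' Sl //; lia.
  - have [|||u' [w' [Su H]]] := S1m u w _ _ _ n1; try lia; first by case=> ? ?; lia.
    by exists u', w'; split=> //; rewrite /S Su.
  have [|||u' [w' [Su H]]] := S1m u w _ _ _ n1; try lia; first by case=> ? ?; lia.
  by exists u', w'; split=> //; rewrite /S Su.
case: (Z_le_gt_dec c u) => cu.
  have cne : (u, w) <> (c, y).
    by case=> E1 E2; move: nS; rewrite E1 E2 Sr //; lia.
  have [||u' [w' [Su H]]] := S2m u w _ _ cne n2; try lia.
  by exists u', w'; split=> //; rewrite /S Su orbT.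
case: (Z.eq_dec u x) => ux.
  have wy : w <> y by move=> E; apply: ne; rewrite ux E.
  by exists c, y; split; [apply: Sr; lia | lia].
by exists x, c; split; [apply: Sl; lia | lia].
Qed.

Definition zmem (n : nat) (B : {set {set 'I_n.+1}}) (x y : Z) : bool := zedge n x y \in B.

Lemma blocker_not_tri (n : nat) (B : {set {set 'I_n.+1}}) (r : Z) :
  is_blocker B -> ~ tri (zmem B) r (r + Z.of_nat n.+1 - 1).
Proof.
case=> Bdiag hit /tri_triangulation[S [Sr Sc Sm]].
pose T := [set e : {set 'I_n.+1} | [exists i : 'I_n.+1, exists j : 'I_n.+1,
  let x := r + Z.of_nat i in let y := r + Z.of_nat j in (e == zedge n x y) && S x y]].
have inT x y : S x y -> zedge n x y \in T.
  move=> Sxy; have [? ? _ _] := Sr x y Sxy; rewrite inE.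
  have xn : (Z.to_nat (x - r) < n.+1)%nat by apply/ltP; lia.
  have yn : (Z.to_nat (y - r) < n.+1)%nat by apply/ltP; lia.
  apply/existsP; exists (Ordinal xn); apply/existsP; exists (Ordinal yn) => /=.
  have -> : r + Z.of_nat (Z.to_nat (x - r)) = x by lia.
  have -> : r + Z.of_nat (Z.to_nat (y - r)) = y by lia.
  by rewrite eqxx.
have Tin e : e \in T -> exists x y, e = zedge n x y /\ S x y.
  rewrite inE => /existsP[i /existsP[j /andP[/eqP eE Sij]]].
  by exists (r + Z.of_nat i), (r + Z.of_nat j).
have Trian : is_triangulation T.
  split.
  - move=> _ /Tin[x [y [-> /Sr[? ? ne _]]]]; apply: diagonal_zedge.
    suff: ~ (x = r /\ y = r + Z.of_nat n.+1 - 1) by lia.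
    by case=> E1 E2; apply: ne; rewrite E1 E2.
  - move=> _ _ /Tin[x [y [-> Sxy]]] /Tin[z [w [-> Szw]]]; apply/negP.
    have [? ? _ _] := Sr _ _ Sxy; have [? ? _ _] := Sr _ _ Szw.
    case/(@crossing_inv n r); try lia; case=> ? ?; first by apply: (Sc x y z w).
    by apply: (Sc z w x y).
  move=> e /(diagonal_inv r)[x [y [? ? ? ? ->]]] nT.
  have nS : ~~ S x y by apply: contra nT => /inT.
  have [|||z [w [Szw H]]] := Sm x y _ _ _ nS; try lia; first by case; lia.
  exists (zedge n z w); first exact: inT.
  have [? ? _ _] := Sr _ _ Szw.
  case: H => ?; first by apply: (@crossing n r); lia.
  by rewrite cross_sym; apply: (@crossing n r); lia.
have [e eB /Tin[x [y [eE Sxy]]]] := hit T Trian.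
by have [_ _ _] := Sr x y Sxy; rewrite /zmem -eE eB.
Qed.

(** A triangulation missed by B without e is still hit by B, hence exactly at e. *)
Lemma saturated_triangulation (n : nat) (B : {set {set 'I_n}}) (e : {set 'I_n}) :
  saturated_blocker B -> e \in B ->
  exists T, [/\ is_triangulation T, e \in T & forall f, f \in B -> f \in T -> f = e].
Proof.
case=> -[Bdiag hit] sat eB.
have [T [tT noT]] : exists T, is_triangulation T /\ ~ exists2 f, f \in B :\ e & f \in T.
  apply: NNPP => none; apply: (sat e eB); split=> [f /setD1P[_ /Bdiag] //|T tT].
  by apply: NNPP => noT; apply: none; exists T.
have only f : f \in B -> f \in T -> f = e.
  move=> fB fT; case: (eqVneq f e) => // fe; case: noT; exists f => //.
  by rewrite in_setD1 fe.
have [f fB fT] := hit T tT.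
by exists T; split=> //; rewrite -(only f fB fT).
Qed.

(** The apex is the last c before v that is joined to u. A chord of T crossing (c, v) would cross
    (u, v) or (u, c), or join u to a later label. *)
Lemma triangulation_apex (n : nat) (T : {set {set 'I_n.+1}}) :
  is_triangulation T -> apex_closed (Z.of_nat n.+1) (zmem T).
Proof.
case=> Tdiag Tnc Tmax u v uv tuv.
pose P c := zmem T u c || (c =? u + 1).
have [||c cr [Pc last_c]] := @Zlast P (u + 1) (v - 1); first lia.
  by rewrite /P Z.eqb_refl orbT.
have tuc : zmem T u c \/ c = u + 1 by case/orP: Pc => [|/Z.eqb_spec]; [left | right].
exists c; split=> //; first lia.
case: (Z.eq_dec v (c + 1)) => cv; [by right | left; apply/negPn/negP => ntcv].
have dcv : diagonal (zedge n c v) by apply: diagonal_zedge; lia.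
have [f fT] := Tmax _ dcv ntcv.
have [a [d [ua ad du _ fE]]] := diagonal_inv u (Tdiag f fT); rewrite fE in fT *.
case/(@crossing_inv n u); try lia; move=> H.
  case: tuv => [tuv|?]; last by lia.
  by case/negP: (Tnc _ _ tuv fT); apply: (@crossing n u); lia.
case: (Z.eq_dec a u) => au.
  by have := last_c d ltac:(lia); rewrite /P /zmem -au fT.
case: tuc => [tuc|?]; last by lia.
by case/negP: (Tnc _ _ tuc fT); apply: (@crossing n u); lia.
Qed.

Lemma crit_of_saturated (n : nat) (B : {set {set 'I_n.+1}}) :
  (5 < n.+1)%nat -> saturated_blocker B -> #|B| = n -> crit (Z.of_nat n.+1) (zmem B).
Proof.
move=> /ltP n5 satB cardB; have [[Bdiag hit] _] := satB.
have Binj r x y u w : r <= x < y -> y < r + Z.of_nat n.+1 -> r <= u < w ->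
    w < r + Z.of_nat n.+1 -> zedge n x y = zedge n u w -> x = u /\ y = w by exact: zedge_inj.
split.
- lia.
- by move=> x y; rewrite /zmem zedgeC.
- by move=> x y; rewrite /zmem /zedge label_per.
- move=> x; apply/negP=> /Bdiag /(diagonal_inv x)[u [w [? ? ? ? E]]].
  by have := Binj x x (x + 1) u w ltac:(lia) ltac:(lia) ltac:(lia) ltac:(lia) E; lia.
- move=> x; apply/negP=> /Bdiag /(diagonal_inv x)[u [w [? ? ? ? E]]].
  case/set2_eq: E => -[E1 E2]; have E : label n u = label n w by rewrite -E1 -E2.
    by have := label_inj (r := x) _ _ E; lia.
  by have := label_inj (r := x) _ _ E; lia.
- by move=> r; apply: blocker_not_tri; case: satB.
- move=> x y xy bxy; have [T [tT eT only]] := saturated_triangulation satB bxy.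
  exists (zmem T); split=> //; first exact: triangulation_apex.
  move=> r u v rx yr ru vr buv tuv.
  by apply: (Binj r) => //; try lia; apply: only.
- move=> r s us hs; suff: (size s <= n)%nat by move/leP; lia.
  rewrite -cardB -(size_map (fun p => zedge n p.1 p.2) s) cardE.
  apply: uniq_leq_size.
    rewrite map_inj_in_uniq // => -[x y] [u w] /hs[/= ? ? ? _] /hs[/= ? ? ? _] E.
    by have [-> ->] := Binj r x y u w ltac:(lia) ltac:(lia) ltac:(lia) ltac:(lia) E.
  by move=> _ /mapP[p /hs[_ _ _ bp] ->]; rewrite mem_enum.
move=> r s ss; pose S := [set:: [seq zedge n p.1 p.2 | p <- s]].
have : ~~ (B \subset S).
  apply/negP=> /subset_leq_card; rewrite cardB => cB.
  have cS : (#|S| <= size s)%nat.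
    by rewrite -(size_map (fun p => zedge n p.1 p.2) s) cardsE; apply: card_size.
  by have /leP := leq_trans cB cS; move: (size s) ss => k; lia.
case/subsetPn=> e eB eS; have [x [y [? ? ? ? eE]]] := diagonal_inv r (Bdiag e eB).
exists x, y; split; try lia; first by rewrite /zmem -eE.
by apply: contra eS => xys; rewrite inE eE; apply/mapP; exists (x, y).
Qed.

From mathcomp Require Import zify_ssreflect.

(** * Reading off the three types *)

Lemma edge_zedge (n a b : nat) : edge n.+1 a b = zedge n (Z.of_nat a) (Z.of_nat b).
Proof.
have labE c (x : 'I_n.+1) : (x == label n (Z.of_nat c)) = (val x == c %% n.+1)%nat.
  rewrite -val_eqE; congr (_ == _); apply: Nat2Z.inj; rewrite (label_val n (Z.of_nat c)).
  rewrite {1}(divn_eq c n.+1) -plusE -multE Nat2Z.inj_add Nat2Z.inj_mul Z.add_comm Z_mod_plus_full.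
  by apply: Z.mod_small; have /ltP := ltn_pmod c (ltn0Sn n); move: (c %% n.+1)%nat; lia.
by apply/setP=> x; rewrite !inE !labE.
Qed.

Lemma edges_of_chords (n : nat) (B : {set {set 'I_n.+1}}) (r : Z) (s : seq (nat * nat)) :
  (forall e, e \in B -> diagonal e) ->
  (forall x y, (x, y) \in s -> shift r (zmem B) (Z.of_nat x) (Z.of_nat y)) ->
  (forall x y, (x < y < n.+1)%nat -> shift r (zmem B) (Z.of_nat x) (Z.of_nat y) ->
     (x, y) \in s \/ (y, x) \in s) ->
  B = edges n.+1 (Z.to_nat (r mod Z.of_nat n.+1)) s.
Proof.
move=> Bdiag sB Bs; set r' := Z.to_nat _.
have r'E : Z.of_nat r' = r mod Z.of_nat n.+1.
  by apply: Z2Nat.id; have := Z.mod_pos_bound r (Z.of_nat n.+1); lia.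
have shiftE x y : edge n.+1 (x + r') (y + r') = zedge n (Z.of_nat x + r) (Z.of_nat y + r).
  rewrite edge_zedge -!plusE !Nat2Z.inj_add r'E.
  by congr [set _; _]; apply: label_eq; rewrite Zplus_mod_idemp_r.
apply/setP=> e; rewrite inE; apply/idP/mapP => [eB|[[x y] xys ->]] /=; last first.
  by rewrite shiftE; apply: sB.
have [x [y [rx xy yr _ eE]]] := diagonal_inv r (Bdiag e eB).
have bxy : shift r (zmem B) (Z.of_nat (Z.to_nat (x - r))) (Z.of_nat (Z.to_nat (y - r))).
  by rewrite /shift /zmem !Z2Nat.id; [rewrite !Z.sub_add -eE | lia | lia].
have [|mem|mem] := Bs (Z.to_nat (x - r)) (Z.to_nat (y - r)) _ bxy; first by lia.
  by exists (Z.to_nat (x - r), Z.to_nat (y - r)); rewrite //= shiftE !Z2Nat.id ?Z.sub_add //; lia.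
exists (Z.to_nat (y - r), Z.to_nat (x - r)) => //=.
by rewrite shiftE !Z2Nat.id ?Z.sub_add 1?zedgeC //; lia.
Qed.

Lemma mem_shorts (a len x y : nat) :
  (x, y) \in shorts a len = [&& a <= x, x < a + len & y == x + 2]%nat.
Proof.
apply/mapP/and3P => [[k]|[ax xa /eqP yE]].
  by rewrite mem_iota => /andP[? ?] [-> ->].
by exists x; rewrite ?yE // mem_iota ax.
Qed.

Lemma mem_fan (m : nat) (i : nat -> nat) (J : seq nat) (x y : nat) :
  (x, y) \in fan m i J = [&& m + 2 <= x, (x - (m + 2))%N \in J & y == i (x - (m + 2))%N]%nat.
Proof.
apply/mapP/and3P => [[j jJ [-> ->]]|[mx xJ /eqP yE]].
  by rewrite leq_addr addKn jJ eqxx.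
by exists (x - (m + 2))%nat => //; rewrite yE subnKC.
Qed.

Lemma fan_noncross_of_falling (n m : nat) (I : Z -> Z) (i : nat -> nat) (J : seq nat) :
  (forall j, j \in J -> [/\ (0 < j)%nat, (m + 2 + j < n.+1)%nat, (i j <= m + 1)%nat &
     Z.of_nat (i j) = I (Z.of_nat (m + 2 + j))]) ->
  (forall j1 j2, j1 \in J -> j2 \in J -> (j1 < j2)%nat ->
     I (Z.of_nat (m + 2 + j2)) <= I (Z.of_nat (m + 2 + j1)) + 1) ->
  fan_noncross n.+1 m i J.
Proof.
move=> iJ fall j1 j2 J1 J2 i12; rewrite !edge_zedge.
have [? ? ? E1] := iJ j1 J1; have [? ? ? E2] := iJ j2 J2.
rewrite zedgeC [X in cross _ X]zedgeC; apply/negP=> /(crossing_inv (r := 0)) H.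
have [j12|j21] := leqP j1 j2; last first.
  have := fall j2 j1 J2 J1 j21; rewrite -E1 -E2; lia.
have [E|ne] := eqVneq j1 j2; first by rewrite E in i12 *; lia.
have := fall j1 j2 J1 J2; rewrite -E1 -E2; lia.
Qed.

Lemma type1_of_chords (n : nat) (B : {set {set 'I_n.+1}}) :
  (forall e, e \in B -> diagonal e) -> chords1 (Z.of_nat n.+1) (zmem B) -> type1 B.
Proof.
move=> Bdiag [r [zm [zl [I [mr lr IJ fall bE]]]]].
have [m mE] : exists m : nat, zm = Z.of_nat m by exists (Z.to_nat zm); lia.
have [l lE] : exists l : nat, zl = Z.of_nat l by exists (Z.to_nat zl); lia.
subst zm zl.
pose i j := Z.to_nat (I (Z.of_nat (m + 2 + j))).
have memJ j : (j \in iota 1 (n.+1 - 3 - m)) = (0 < j <= n.+1 - 3 - m)%nat.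
  by rewrite mem_iota; lia.
have iE j : (0 < j <= n.+1 - 3 - m)%nat -> Z.of_nat (i j) = I (Z.of_nat (m + 2 + j)).
  by move=> jr; rewrite /i Z2Nat.id //; have := IJ (Z.of_nat (m + 2 + j)); lia.
have Ij j : (0 < j <= n.+1 - 3 - m)%nat -> (1 <= i j <= m + 1)%nat /\ i j <> l.
  by move=> jr; have := iE j jr; have := IJ (Z.of_nat (m + 2 + j)); lia.
exists (Z.to_nat (r mod Z.of_nat n.+1)), m, l, i; split.
- by lia.
- by lia.
- by move=> j; rewrite memJ => /Ij; lia.
- apply: (@fan_noncross_of_falling n m I).
    by move=> j; rewrite memJ => jr; split; [lia | lia | have := Ij j jr; lia | apply: iE].
  move=> j1 j2; rewrite !memJ => r1 r2 j12; apply: fall; lia.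
have symB x y : shift r (zmem B) x y = shift r (zmem B) y x by rewrite /shift /zmem zedgeC.
apply: edges_of_chords => //.
- move=> x y; rewrite !mem_cat !inE !mem_shorts mem_fan memJ !xpair_eqE.
  case/or3P=> [H|H|/and3P[mx xr /eqP yE]].
  - apply/bE; lia.
  - apply/bE; lia.
  have := Ij _ xr; have := iE _ xr; rewrite -yE subnKC // => ? ?.
  by rewrite symB; apply/bE; lia.
move=> x y xyr /bE H; rewrite !mem_cat !inE !mem_shorts !mem_fan !memJ !xpair_eqE.
case: H => [||H|[H|[H|[ym xI]]]]; [lia | lia | left | left | left |].
- case: (Z_lt_ge_dec (Z.of_nat x) (Z.of_nat l - 2)) => h.
    by have -> : ([&& 0 <= x, x < 0 + (l - 2) & y == x + 2])%nat by [lia]; rewrite !orbT.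
  case: (Z.eq_dec (Z.of_nat x) (Z.of_nat l - 2)) => [xl|?].
    by have -> : ((x == l - 2) && (y == l))%nat by lia.
  case: (Z.eq_dec (Z.of_nat x) (Z.of_nat l)) => [xl|?].
    by have -> : ((x == l) && (y == l + 2))%nat by [lia]; rewrite !orbT.
  by have -> : ([&& l + 1 <= x, x < l + 1 + (m - l) & y == x + 2])%nat by [lia]; rewrite !orbT.
- by have -> : ((x == l - 2) && (y == l + 1))%nat by [lia]; rewrite !orbT.
- by have -> : ((x == l - 1) && (y == l + 2))%nat by [lia]; rewrite !orbT.
right; have my : (m + 2 <= y)%nat by lia.
have yr : (0 < y - (m + 2) <= n.+1 - 3 - m)%nat by lia.
have := iE _ yr; rewrite subnKC // => iy; have xi : x = i (y - (m + 2))%nat by lia.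
by rewrite my yr xi eqxx !orbT.
Qed.

Lemma type2_of_chords (n : nat) (B : {set {set 'I_n.+1}}) :
  (forall e, e \in B -> diagonal e) -> chords2 (Z.of_nat n.+1) (zmem B) -> type2 B.
Proof.
move=> Bdiag [r [zm [zl [I [mr lr IJ fall bE]]]]].
have [m mE] : exists m : nat, zm = Z.of_nat m by exists (Z.to_nat zm); lia.
have [l lE] : exists l : nat, zl = Z.of_nat l by exists (Z.to_nat zl); lia.
subst zm zl.
pose i j := Z.to_nat (I (Z.of_nat (m + 2 + j))).
have memJ j : (j \in iota 1 (n.+1 - 3 - m)) = (0 < j <= n.+1 - 3 - m)%nat.
  by rewrite mem_iota; lia.
have iE j : (0 < j <= n.+1 - 3 - m)%nat -> Z.of_nat (i j) = I (Z.of_nat (m + 2 + j)).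
  by move=> jr; rewrite /i Z2Nat.id //; have := IJ (Z.of_nat (m + 2 + j)); lia.
have Ij j : (0 < j <= n.+1 - 3 - m)%nat -> (1 <= i j <= l - 1 \/ l + 2 <= i j <= m + 1)%nat.
  by move=> jr; have := iE j jr; have := IJ (Z.of_nat (m + 2 + j)); lia.
exists (Z.to_nat (r mod Z.of_nat n.+1)), m, l, i; split.
- by lia.
- by lia.
- by move=> j; rewrite memJ => /Ij; lia.
- apply: (@fan_noncross_of_falling n m I).
    by move=> j; rewrite memJ => jr; split; [lia | lia | have := Ij j jr; lia | apply: iE].
  move=> j1 j2; rewrite !memJ => r1 r2 j12; apply: fall; lia.
have symB x y : shift r (zmem B) x y = shift r (zmem B) y x by rewrite /shift /zmem zedgeC.
apply: edges_of_chords => //.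
- move=> x y; rewrite !mem_cat !inE !mem_shorts mem_fan memJ !xpair_eqE.
  case/or3P=> [H|H|/and3P[mx xr /eqP yE]].
  - apply/bE; lia.
  - apply/bE; lia.
  have := Ij _ xr; have := iE _ xr; rewrite -yE subnKC // => ? ?.
  by rewrite symB; apply/bE; lia.
move=> x y xyr /bE H; rewrite !mem_cat !inE !mem_shorts !mem_fan !memJ !xpair_eqE.
case: H => [||H|[H|[H|[H|[ym xI]]]]]; [lia | lia | left | left | left | left |].
- case: (Z_lt_ge_dec (Z.of_nat x) (Z.of_nat l - 2)) => h.
    by have -> : ([&& 0 <= x, x < 0 + (l - 2) & y == x + 2])%nat by [lia]; rewrite !orbT.
  case: (Z.eq_dec (Z.of_nat x) (Z.of_nat l - 2)) => [xl|?].
    by have -> : ((x == l - 2) && (y == l))%nat by lia.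
  case: (Z.eq_dec (Z.of_nat x) (Z.of_nat l + 1)) => [xl|?].
    by have -> : ((x == l + 1) && (y == l + 3))%nat by [lia]; rewrite !orbT.
  by have -> : ([&& l + 2 <= x, x < l + 2 + (m - l - 1) & y == x + 2])%nat by [lia]; rewrite !orbT.
- by have -> : ((x == l - 2) && (y == l + 1))%nat by [lia]; rewrite !orbT.
- by have -> : ((x == l - 1) && (y == l + 2))%nat by [lia]; rewrite !orbT.
- by have -> : ((x == l) && (y == l + 3))%nat by [lia]; rewrite !orbT.
right; have my : (m + 2 <= y)%nat by lia.
have yr : (0 < y - (m + 2) <= n.+1 - 3 - m)%nat by lia.
have := iE _ yr; rewrite subnKC // => iy; have xi : x = i (y - (m + 2))%nat by lia.
by rewrite my yr xi eqxx !orbT.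
Qed.

Lemma type3_of_chords (n : nat) (B : {set {set 'I_n.+1}}) :
  (forall e, e \in B -> diagonal e) -> chords3 (Z.of_nat n.+1) (zmem B) -> type3 B.
Proof.
move=> Bdiag [r [zl [zm [zk [zt [I [[lr kr tr] [Ik Ikt Im] [IL IR] [fL fR] bE]]]]]]].
have [m mE] : exists m : nat, zm = Z.of_nat m by exists (Z.to_nat zm); lia.
have [l lE] : exists l : nat, zl = Z.of_nat l by exists (Z.to_nat zl); lia.
have [k kE] : exists k : nat, zk = Z.of_nat k by exists (Z.to_nat zk); lia.
have [t tE] : exists t : nat, zt = Z.of_nat t by exists (Z.to_nat zt); lia.
subst zm zl zk zt.
pose i j := Z.to_nat (I (Z.of_nat (m + 2 + j))).
have memL j : (j \in iota 1 (k - m - 3)) = (0 < j <= k - m - 3)%nat.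
  by rewrite mem_iota; lia.
have memR j : (j \in iota (k + t - m - 1) (n.+1 - 1 - (k + t))) =
    (k + t - m - 1 <= j <= n - m - 2)%nat.
  by rewrite mem_iota; lia.
have iL j : (0 < j <= k - m - 3)%nat ->
    Z.of_nat (i j) = I (Z.of_nat (m + 2 + j)) /\ (l <= i j <= m + 1)%nat.
  move=> jr; have h := IL (Z.of_nat (m + 2 + j)) ltac:(lia).
  have iE : Z.of_nat (i j) = I (Z.of_nat (m + 2 + j)) by rewrite /i Z2Nat.id //; lia.
  by split=> //; lia.
have iR j : (k + t - m - 1 <= j <= n - m - 2)%nat ->
    Z.of_nat (i j) = I (Z.of_nat (m + 2 + j)) /\ (1 <= i j <= l)%nat.
  move=> jr; have h := IR (Z.of_nat (m + 2 + j)) ltac:(lia).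
  have iE : Z.of_nat (i j) = I (Z.of_nat (m + 2 + j)) by rewrite /i Z2Nat.id //; lia.
  by split=> //; lia.
exists (Z.to_nat (r mod Z.of_nat n.+1)), l, m, k, t, i; split.
- by lia.
- by move=> j; rewrite memL => /iL[]; lia.
- by move=> j; rewrite memR => /iR[]; lia.
- apply: (@fan_noncross_of_falling n m I).
    move=> j; rewrite mem_cat memL memR => /orP[jr|jr].
      by have [? ?] := iL j jr; split=> //; lia.
    by have [? ?] := iR j jr; split=> //; lia.
  move=> j1 j2; rewrite !mem_cat !memL !memR => /orP[r1|r1] /orP[r2|r2] j12.
  - by apply: fL; lia.
  (* Values on the left part are at least l and those on the right part at most l, so nothing jumps
     up across the bouquet. *)
  - by have [<- ?] := iL j1 r1; have [<- ?] := iR j2 r2; lia.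
  - by lia.
  by apply: fR; lia.
have symB x y : shift r (zmem B) x y = shift r (zmem B) y x by rewrite /shift /zmem zedgeC.
have memS x y : ((x, y) \in [seq ((k + s)%N, l) | s <- iota 1 (t - 1)]) =
    [&& k < x, x < k + t & y == l]%nat.
  apply/mapP/and3P => [[s]|[kx xt /eqP ->]].
    by rewrite mem_iota => sr [-> ->]; split; lia.
  by exists (x - k)%nat; [rewrite mem_iota; lia | rewrite subnKC // ltnW].
apply: edges_of_chords => //.
- move=> x y; rewrite !mem_cat !inE memS !mem_shorts !mem_fan memL memR !xpair_eqE.
  case/orP=> [|/orP[|/orP[H|/orP[H|/orP[|]]]]].
  + case/or4P=> H.
    * apply/bE; lia.
    * by rewrite symB; apply/bE; have := Ik; have -> : Z.of_nat k = Z.of_nat x by [lia]; lia.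
    * by rewrite symB; apply/bE; have := Ikt; have -> : Z.of_nat k + Z.of_nat t = Z.of_nat x by [lia]; lia.
    apply/bE; lia.
  + by case/and3P=> kx xt /eqP yl; rewrite symB; apply/bE; have := Im (Z.of_nat x); lia.
  + apply/bE; lia.
  + apply/bE; lia.
  + case/and3P=> mx xr /eqP yE; have := iL _ xr; rewrite -yE subnKC // => -[? ?].
    by rewrite symB; apply/bE; lia.
  case/and3P=> mx xr /eqP yE; have := iR _ xr; rewrite -yE subnKC // => -[? ?].
  by rewrite symB; apply/bE; lia.
move=> x y xyr /bE H; rewrite !mem_cat !inE !memS !mem_shorts !mem_fan !memL !memR !xpair_eqE.
case: H => [||H|[H|[ym xI]]]; [lia | lia | left | left | right].
- case: (Z_lt_ge_dec (Z.of_nat x) (Z.of_nat l - 1)) => h.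
    by have -> : ([&& 0 <= x, x < 0 + (l - 1) & y == x + 2])%nat by [lia]; rewrite !orbT.
  case: (Z.eq_dec (Z.of_nat x) (Z.of_nat l - 1)) => [xl|?].
    by have -> : ((x == l - 1) && (y == l + 1))%nat by lia.
  by have -> : ([&& l <= x, x < l + (m + 1 - l) & y == x + 2])%nat by [lia]; rewrite !orbT.
- by have -> : ((x == k) && (y == k + t))%nat by [lia]; rewrite !orbT.
have my : (m + 2 <= y)%nat by lia.
case: (Z.lt_total (Z.of_nat y) (Z.of_nat k)) => [yk|[yk|yk]].
- have yr : (0 < y - (m + 2) <= k - m - 3)%nat by lia.
  have := iL _ yr; rewrite subnKC // => -[iy _]; have xi : x = i (y - (m + 2))%nat by lia.
  by rewrite my yr xi eqxx !orbT.
- have h := Ik; rewrite -yk in h.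
  by have -> : ((y == k) && (x == l - 1))%nat by [lia]; rewrite !orbT.
case: (Z.lt_total (Z.of_nat y) (Z.of_nat k + Z.of_nat t)) => [yk'|[yk'|yk']].
- have h := Im (Z.of_nat y) ltac:(lia).
  by have -> : ([&& k < y, y < k + t & x == l])%nat by [lia]; rewrite !orbT.
- have h := Ikt; rewrite -yk' in h.
  by have -> : ((y == k + t) && (x == l + 1))%nat by [lia]; rewrite !orbT.
have yr : (k + t - m - 1 <= y - (m + 2) <= n - m - 2)%nat by lia.
have := iR _ yr; rewrite subnKC // => -[iy _]; have xi : x = i (y - (m + 2))%nat by lia.
by rewrite my yr xi eqxx !orbT.
Qed.

Local Close Scope Z_scope.

Theorem theorem1p4 (n : nat) (B : {set {set 'I_n}}) :
  5 < n -> saturated_blocker B -> #|B| = n - 1 ->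
  type1 B \/ type2 B \/ type3 B.
Proof.
case: n B => [|n] B // n5 satB cardB; have [[Bdiag _] _] := satB.
have P : crit (Z.of_nat n.+1) (zmem B).
  by apply: crit_of_saturated; rewrite // cardB subn1.
case: (chords_classification P) => H.
- by left; apply: type1_of_chords.
- by right; left; apply: type2_of_chords.
by right; right; apply: type3_of_chords.
Qed.
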